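(* Suppose $s\ge\frac12$, $a\in\widehat{\mathcal A}{}_s'(\mathbf C^{2d})$, let $N\ge0$ be an integer, and let $$a_\alpha(w)=\partial_z^\alpha\overline\partial_w^\alpha a(w,w),\quad\alpha\in\mathbf N^d,$$ and $$b_\alpha(z,w)=|\alpha|\int_0^1(1-t)^{|\alpha|-1}\,\partial_z^\alpha\overline\partial_w^\alpha a(w+t(z-w),w)\,dt,\quad\alpha\in\mathbf N^d\setminus0.$$ Then $$\mathrm{Op}_{\mathfrak V}(a)=\sum_{|\alpha|\le N}\frac{(-1)^{|\alpha|}\mathrm{Op}^{\mathrm{aw}}_{\mathfrak V}(a_\alpha)}{\alpha!}+\sum_{|\alpha|=N+1}\frac{(-1)^{|\alpha|}\mathrm{Op}_{\mathfrak V}(b_\alpha)}{\alpha!}.$$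
   Context: Notation: $(z,w)=\sum_jz_j\overline{w_j}$; $d\lambda$ is Lebesgue measure on $\mathbf C^d$; $\partial_z,\overline\partial_w$ are the complex (Wirtinger) derivatives with multi-index powers; $\partial_z^\alpha\overline\partial_w^\alpha a(u,v)$ means that $a(z,w)$ is first differentiated and then evaluated at $(z,w)=(u,v)$. $\lesssim$ means inequality up to a constant independent of $z,w$. $\widehat A(\mathbf C^{2d})$ is the set of functions $a(z,w)$ such that $(z,w)\mapsto a(z,\overline w)$ is entire on $\mathbf C^{2d}$. For $s\ge\frac12$, $\widehat{\mathcal A}{}_s'(\mathbf C^{2d})$ is the set of $a\in\widehat A(\mathbf C^{2d})$ such that for every $r>0$, $|a(z,w)|\lesssim e^{\frac12(|z|^2+|w|^2)+r(|z|^{1/s}+|w|^{1/s})}$. Wick and anti-Wick operators act on $\mathcal A_{\flat_1}(\mathbf C^d)$, the space of entire functions $F$ on $\mathbf C^d$ with $|F(z)|\lesssim e^{r|z|}$ for some $r>0$, with values in the space of entire functions on $\mathbf C^d$. The Wick operator with symbol $a(z,w)$, which is entire in $z$ but need not be conjugate analytic in $w$, is $$\mathrm{Op}_{\mathfrak V}(a)F(z)=\pi^{-d}\int_{\mathbf C^d}a(z,w)F(w)e^{(z-w,w)}\,d\lambda(w),$$ and the anti-Wick operator with symbol $a_0(w)$ is $$\mathrm{Op}^{\mathrm{aw}}_{\mathfrak V}(a_0)F(z)=\pi^{-d}\int_{\mathbf C^d}a_0(w)F(w)e^{(z-w,w)}\,d\lambda(w).$$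
   Formalization: The identity is asserted at each F and z for which the integrals defining the right-hand operators (anti-Wick with a_α, |α|≤N; Wick with b_α, |α|=N+1) converge absolutely; for a=exp(z·w̄), d=1, N=0 they diverge, so the claim is otherwise undefined. *)

(* Defs.v *)
From HB Require Import structures.
From mathcomp Require Import all_boot all_order all_algebra.
From mathcomp Require Import complex.
From mathcomp Require Import all_classical all_reals all_analysis.

Set Implicit Arguments.
Unset Strict Implicit.
Unset Printing Implicit Defensive.

Import Order.TTheory GRing.Theory Num.Theory.
Import numFieldNormedType.Exports.

Local Open Scope classical_set_scope.
Local Open Scope ring_scope.
Local Open Scope complex_scope.

(* MathComp-Analysis gives an abstract numFieldType K the topology of K^o; the
   instances below do the same for R[i], so that R[i], 'rV[R[i]]_d and products
   of these are normed modules over R[i]. *)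
HB.instance Definition _ (R : realType) := GRing.ComAlgebra.copy R[i] R[i]^o.
HB.instance Definition _ (R : realType) := Vector.copy R[i] R[i]^o.
HB.instance Definition _ (R : realType) := NormedModule.copy R[i] R[i]^o.

Section TupleMeasure.
Local Open Scope ereal_scope.

Lemma product_measure_sigma_finite (R : realType) d1 d2
    (T1 : measurableType d1) (T2 : measurableType d2)
    (mu : {sigma_finite_measure set T1 -> \bar R})
    (nu : {sigma_finite_measure set T2 -> \bar R}) :
  sigma_finite setT (mu \x nu).
Proof.
have /sigma_finiteP[F [FT ndF Foo]] := sigma_finiteT mu.
have /sigma_finiteP[G [GT ndG Goo]] := sigma_finiteT nu.
exists (fun k => F k `*` G k).
  apply/seteqP; split => // -[x y] _.
  have [k _ Fx] : (\bigcup_k F k) x by rewrite -FT.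
  have [l _ Gy] : (\bigcup_k G k) y by rewrite -GT.
  exists (maxn k l) => //; split.
  - by move: x Fx; exact/subsetPset/ndF/leq_maxl.
  - by move: y Gy; exact/subsetPset/ndG/leq_maxr.
move=> k; have [mF Fk] := Foo k; have [mG Gk] := Goo k.
split; first exact: measurableX.
by rewrite product_measure1E// lte_mul_pinfty// ge0_fin_numE.
Qed.

Context (R : realType) d (T : measurableType d).

Definition tuple_cons n (p : T * n.-tuple T) : n.+1.-tuple T :=
  [tuple of p.1 :: p.2].

Let measurable_tuple_cons n :
  measurable_fun [set: T * n.-tuple T] (@tuple_cons n).
Proof. exact: measurable_cons. Qed.

Definition cons_measure n (mu : {sigma_finite_measure set T -> \bar R})
    (nu : {sigma_finite_measure set (n.-tuple T) -> \bar R}) :=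
  pushforward (mu \x nu) (@tuple_cons n).

Section cons_measure.
Variables (n : nat) (mu : {sigma_finite_measure set T -> \bar R})
  (nu : {sigma_finite_measure set (n.-tuple T) -> \bar R}).

Let cons_measure0 : cons_measure mu nu set0 = 0.
Proof. by rewrite /cons_measure /pushforward preimage_set0 measure0. Qed.

Let cons_measure_ge0 A : 0 <= cons_measure mu nu A.
Proof. by rewrite /cons_measure /pushforward; apply: measure_ge0. Qed.

Let cons_measure_sigma_additive : semi_sigma_additive (cons_measure mu nu).
Proof.
move=> F mF tF mUF; rewrite /cons_measure /pushforward preimage_bigcup.
apply: measure_semi_sigma_additive.
- by move=> k; rewrite -[X in measurable X]setTI; exact: measurable_tuple_cons.
- apply/trivIsetP => /= i j _ _ ij; rewrite -preimage_setI.
  by move/trivIsetP : tF => /(_ _ _ _ _ ij) ->//; rewrite preimage_set0.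
- rewrite -preimage_bigcup -[X in measurable X]setTI.
  exact: measurable_tuple_cons.
Qed.

HB.instance Definition _ := isMeasure.Build _ _ _ (cons_measure mu nu)
  cons_measure0 cons_measure_ge0 cons_measure_sigma_additive.

Let cons_measure_sigma_finite : sigma_finite setT (cons_measure mu nu).
Proof.
have [F FT Foo] := product_measure_sigma_finite mu nu.
pose uncons (t : n.+1.-tuple T) := (thead t, [tuple of behead t]).
have muncons : measurable_fun [set: n.+1.-tuple T] uncons.
  apply/measurable_fun_pairP; split.
  - exact: (measurable_tnth ord0).
  - exact: measurable_behead.
have unconsK A : @tuple_cons n @^-1` (uncons @^-1` A) = A.
  apply/funext => -[x t] /=; congr (A (_, _)); exact/val_inj.
exists (fun k => uncons @^-1` F k).
  by rewrite -preimage_bigcup -FT preimage_setT.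
move=> k; have [mF Fk] := Foo k; split.
  by rewrite -[X in measurable X]setTI; exact: muncons.
by rewrite /cons_measure /pushforward unconsK.
Qed.

HB.instance Definition _ := Measure_isSigmaFinite.Build _ _ _
  (cons_measure mu nu) cons_measure_sigma_finite.
End cons_measure.

(* The n-fold product mu \x ... \x mu, as a measure on n.-tuple T. *)
Fixpoint tuple_measure (mu : {sigma_finite_measure set T -> \bar R}) (n : nat) :
    {sigma_finite_measure set (n.-tuple T) -> \bar R} :=
  if n is m.+1 then cons_measure mu (tuple_measure mu m)
  else \d_([tuple] : 0.-tuple T).

End TupleMeasure.

Section ComplexSpace.
Variable R : realType.
Local Notation C := R[i].

Definition cexp (z : C) : C :=
  (expR (complex.Re z))%:C * (cos (complex.Im z) +i* sin (complex.Im z)).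

Definition cintegrable d (T : measurableType d)
    (mu : {measure set T -> \bar R}) (D : set T) (f : T -> C) : Prop :=
  mu.-integrable D (EFin \o (fun x => complex.Re (f x))) /\
  mu.-integrable D (EFin \o (fun x => complex.Im (f x))).

Definition cintegral d (T : measurableType d)
    (mu : {measure set T -> \bar R}) (D : set T) (f : T -> C) : C :=
  (\int[mu]_(x in D) complex.Re (f x)) +i* (\int[mu]_(x in D) complex.Im (f x)).

(* C^d is identified with (R^2)^d to carry Lebesgue measure. *)
Definition lebesgue_R2 : set (measurableTypeR R * measurableTypeR R) -> \bar R :=
  (@lebesgue_measure R \x @lebesgue_measure R)%E.

HB.instance Definition _ := Measure.on lebesgue_R2.
HB.instance Definition _ := Measure_isSigmaFinite.Build _ _ _ lebesgue_R2
  (product_measure_sigma_finite lebesgue_measure lebesgue_measure).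

Variable d : nat.
Local Notation Cd := 'rV[C]_d.
Implicit Types (z w : Cd) (F b : Cd -> C) (a : Cd -> Cd -> C).
Implicit Types alpha : 'I_d -> nat.

Definition of_realcoords
    (x : d.-tuple (measurableTypeR R * measurableTypeR R)) : Cd :=
  \row_j ((tnth x j).1 +i* (tnth x j).2).

Definition lebesgue_Cd := tuple_measure lebesgue_R2 d.

Definition inner z w : C := \sum_j z 0 j * conjc (w 0 j).

(* The library norm on 'rV[C]_d is the max norm, with values in C. *)
Definition enorm z : R :=
  Num.sqrt (\sum_j (complex.Re (z 0 j) ^+ 2 + complex.Im (z 0 j) ^+ 2)).

(* Frechet differentiability over the field C at every point. *)
Definition entire (V : normedModType C) (f : V -> C) : Prop :=
  forall x : V, differentiable f x.

Definition A_flat1 F : Prop :=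
  entire F /\ exists r c : R, 0 < r /\
    forall z, `|F z| <= (c * expR (r * enorm z))%:C.

Definition A_hat a : Prop :=
  entire (fun p : Cd * Cd => a p.1 (map_mx conjc p.2)).

Definition A_hat' (s : R) a : Prop :=
  A_hat a /\ forall r : R, 0 < r -> exists c : R, forall z w,
    `|a z w| <= (c * expR (2^-1 * (enorm z ^+ 2 + enorm w ^+ 2)
                  + r * (enorm z `^ s^-1 + enorm w `^ s^-1)))%:C.

Definition mabs alpha : nat := (\sum_j alpha j)%N.

Definition mfact alpha : nat := (\prod_j (alpha j)`!)%N.

(* Derivative at z along the real line z + t v, t in R. *)
Definition real_deriv (v : Cd) F z : C :=
  derive1 (fun t : R => complex.Re (F (z + t%:C *: v))) 0
  +i* derive1 (fun t : R => complex.Im (F (z + t%:C *: v))) 0.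

Definition wirtinger (j : 'I_d) F z : C :=
  2^-1 * (real_deriv (delta_mx 0 j) F z
          - (0 +i* 1) * real_deriv ((0 +i* 1) *: delta_mx 0 j) F z).

Definition wirtinger_bar (j : 'I_d) F z : C :=
  2^-1 * (real_deriv (delta_mx 0 j) F z
          + (0 +i* 1) * real_deriv ((0 +i* 1) *: delta_mx 0 j) F z).

Definition multi_deriv (D : 'I_d -> (Cd -> C) -> Cd -> C) alpha F : Cd -> C :=
  foldr (fun j G => iter (alpha j) (D j) G) F (enum 'I_d).

Definition symbol_deriv alpha a z w : C :=
  multi_deriv wirtinger alpha
    (fun z' => multi_deriv wirtinger_bar alpha (a z') w) z.

Definition diag_symbol a alpha w : C := symbol_deriv alpha a w w.

Definition remainder_symbol a alpha z w : C :=
  (mabs alpha)%:R * cintegral lebesgue_measure `[0, 1]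
    (fun t : measurableTypeR R => ((1 - t) ^+ (mabs alpha).-1)%:C
       * symbol_deriv alpha a (w + t%:C *: (z - w)) w).

Definition wick_integrand a F z w : C := a z w * F w * cexp (inner (z - w) w).

Definition wick_defined a F z : Prop :=
  cintegrable lebesgue_Cd setT (wick_integrand a F z \o of_realcoords).

(* Meaningful when [wick_defined a F z]. *)
Definition Op_wick a F z : C :=
  (pi ^- d)%:C * cintegral lebesgue_Cd setT
    (wick_integrand a F z \o of_realcoords).

Definition aw_integrand b F z w : C := b w * F w * cexp (inner (z - w) w).

Definition aw_defined b F z : Prop :=
  cintegrable lebesgue_Cd setT (aw_integrand b F z \o of_realcoords).

(* Meaningful when [aw_defined b F z]. *)
Definition Op_aw b F z : C :=
  (pi ^- d)%:C * cintegral lebesgue_Cd setT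
    (aw_integrand b F z \o of_realcoords).

(* Multi-indices of length at most n have entries in 'I_n.+1, so finite sums
   over them can be indexed by {ffun 'I_d -> 'I_n.+1}. *)
Definition mindex n (alpha : {ffun 'I_d -> 'I_n}) : 'I_d -> nat :=
  fun j => alpha j.

End ComplexSpace.

(* Main.v *)
(* Write a(z, w) = G(z, conj w) with G entire on C^d x C^d: the Wirtinger
   derivatives of a are complex directional derivatives of G, whose regularity
   and growth come from Cauchy's formula on complex lines. Taylor expansion of
   G(., conj w) at w produces the factors (z - w)^alpha. Since
   (z - w)_j exp (z - w, w) is the derivative of exp (z - w, w) in conj w_j,
   integration by parts turns each such factor into a derivative in conj w,
   with a sign. The integrals produced on the way need not converge absolutely,
   so the exponential is first damped by exp (- (s - 1) |z - w|^2) with s > 1;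
   the damped kernel is still the restriction to the antidiagonal of a
   holomorphic function whose derivative in conj w_j is s (z - w)_j times
   itself. Dominated convergence then lets s tend to 1. *)
Require Import Defs.
From HB Require Import structures.
From mathcomp Require Import all_boot all_order all_algebra.
From mathcomp Require Import complex.
From mathcomp Require Import all_classical all_reals all_analysis.
From mathcomp Require Import measurable_realfun.
From mathcomp Require Import ring lra.

Set Implicit Arguments.
Unset Strict Implicit.
Unset Printing Implicit Defensive.

Import Order.TTheory GRing.Theory Num.Theory.
Import numFieldNormedType.Exports.

Local Open Scope classical_set_scope.
Local Open Scope ring_scope.
Local Open Scope complex_scope.

(** On the antidiagonal the derivatives of G are only known to be bounded by exp ((1 + e) |w|^2) for
    every e > 0, while exp (z - w, w) decays like exp (- |w|^2) up to exponentials of order |w|: no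
    margin is left. Damping turns this into exp (- s |w|^2) up to lower order. Every growth
    condition can therefore carry an arbitrary loss e, and the margin s - 1 pays for Cauchy's
    estimates, the growth of F and the powers of z - w alike. The damping is centred at z, not at 0,
    so that its exponent has a derivative in conj w_j which is again a multiple of (z - w)_j. Each
    integration by parts then costs the single factor - s, whence the coefficients (- s)^(- |alpha|)
    / alpha!, which tend to those of the statement. The operator with symbol a converges undamped:
    with z frozen, a contributes only exp ((1/2 + e) |w|^2). For the other operators convergence at
    the given F and z is assumed, and it supplies the majorant, as the damping factor is at most 1.
    Since z is fixed throughout, a remainder b_alpha(z, w) is one more holomorphic function of (w,
    conj w). *)

Notation cabs := Normc.normc.
Notation Re := complex.Re.
Notation Im := complex.Im.

(** * The complex modulus as a real number *)

Section Modulus.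
Variable R : realType.
Implicit Types (x y z : R[i]) (r : R).

Lemma normr_cabs z : `|z| = (cabs z)%:C. Proof. by []. Qed.

Lemma cabs_ge0 z : 0 <= cabs z.
Proof. by case: z => a b; exact: sqrtr_ge0. Qed.

Lemma cabs0 : cabs (0 : R[i]) = 0. Proof. exact: Normc.normc0. Qed.

Lemma cabsM x y : cabs (x * y) = cabs x * cabs y.
Proof. exact: Normc.normcM. Qed.

Lemma cabsV x : cabs x^-1 = (cabs x)^-1.
Proof. exact: Normc.normcV. Qed.

Lemma cabsD x y : cabs (x + y) <= cabs x + cabs y.
Proof. exact: le_normcD. Qed.

Lemma cabsN x : cabs (- x) = cabs x.
Proof. exact: normcN. Qed.

Lemma cabsB x y : cabs (x - y) <= cabs x + cabs y.
Proof. by rewrite -(cabsN y) cabsD. Qed.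

Lemma cabs_distC x y : cabs (x - y) = cabs (y - x).
Proof. by rewrite -opprB cabsN. Qed.

Lemma cabs_real r : cabs r%:C = `|r|.
Proof. by rewrite /= expr0n addr0 sqrtr_sqr. Qed.

Lemma cabs_eq0 x : cabs x = 0 -> x = 0.
Proof. exact: Normc.eq0_normc. Qed.

Lemma cabs_sqr z : cabs z ^+ 2 = Re z ^+ 2 + Im z ^+ 2.
Proof. by case: z => a b /=; rewrite sqr_sqrtr ?addr_ge0 ?sqr_ge0. Qed.

Lemma cabs_Re z : `|Re z| <= cabs z.
Proof. by rewrite -sqrtr_sqr; case: z => a b; rewrite ler_wsqrtr ?lerDl ?sqr_ge0. Qed.

Lemma cabs_Im z : `|Im z| <= cabs z.
Proof. by rewrite -sqrtr_sqr; case: z => a b; rewrite ler_wsqrtr ?lerDr ?sqr_ge0. Qed.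

Lemma cabs_le_ReIm z : cabs z <= `|Re z| + `|Im z|.
Proof.
rewrite -ler_sqr ?nnegrE ?cabs_ge0 ?addr_ge0// cabs_sqr sqrrD !real_normK ?num_real//.
by rewrite -addrA lerD2l lerDr mulrn_wge0// mulr_ge0.
Qed.

Lemma cabs_conjc z : cabs (conjc z) = cabs z.
Proof. by case: z => a b /=; rewrite sqrrN. Qed.

Lemma ReD x y : Re (x + y) = Re x + Re y. Proof. by case: x y => ? ? []. Qed.
Lemma ImD x y : Im (x + y) = Im x + Im y. Proof. by case: x y => ? ? []. Qed.
Lemma ReN x : Re (- x) = - Re x. Proof. by case: x. Qed.
Lemma ImN x : Im (- x) = - Im x. Proof. by case: x. Qed.
Lemma ReM x y : Re (x * y) = Re x * Re y - Im x * Im y.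
Proof. by case: x y => ? ? []. Qed.
Lemma ImM x y : Im (x * y) = Re x * Im y + Im x * Re y.
Proof. by case: x y => ? ? []. Qed.

End Modulus.

(** * Limits and neighbourhoods through the real modulus *)

Section ModulusTopology.
Variable R : realType.
Local Notation C := R[i].

Lemma cabs_cvgP (T : Type) (F : set_system T) (FF : Filter F) (f : T -> C) l :
  f @ F --> l <-> forall e : R, 0 < e -> \forall x \near F, cabs (f x - l) < e.
Proof.
split=> [/cvgrPdist_lt fl e e0|fl].
  have := fl e%:C; rewrite ltcR => /(_ e0); apply: filterS => x.
  by rewrite normr_cabs ltcR cabs_distC.
apply/cvgrPdist_lt => e; rewrite ltcE => /andP[/eqP Ie Re0].
have := fl _ Re0; apply: filterS => x.
by rewrite normr_cabs ltcE/= cabs_distC Ie eqxx.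
Qed.

(** Norms take values in [R[i]], whose order makes every positive element real; passing to [Re]
    gives neighbourhoods with real radii. *)
Lemma nbhs_normedP (V : normedModType C) (x : V) (P : set V) :
  nbhs x P <-> exists2 e : R, 0 < e &
    forall y, Re `|y - x| < e -> P y.
Proof.
have nr (y : V) : `|y - x| = (Re `|y - x|)%:C by rewrite RRe_real// normr_real.
split=> [/nbhs_ballP[e /= e0 eP]|[e e0 eP]].
  move: e0 eP; rewrite ltcE => /andP[/eqP Ie Re0] eP.
  exists (Re e) => // y ye; apply: eP; rewrite -ball_normE /= distrC nr.
  by rewrite ltcE /= Ie eqxx.
apply/nbhs_ballP; exists e%:C; first by rewrite /= ltcR.
by move=> y; rewrite -ball_normE /= distrC nr ltcR; exact: eP.
Qed.

Lemma nbhs_cabsP (x : C) (P : set C) :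
  nbhs x P <-> exists2 e : R, 0 < e & forall y, cabs (y - x) < e -> P y.
Proof. exact: nbhs_normedP. Qed.

Lemma continuous_Re : continuous (@complex.Re R).
Proof.
move=> x; apply/(@cvgrPdist_lt _ _ _ (nbhs x)) => e e0; apply/nbhs_cabsP; exists e => // y yx.
by rewrite -ReN -ReD (le_lt_trans (cabs_Re _))// cabs_distC.
Qed.

Lemma continuous_Im : continuous (@complex.Im R).
Proof.
move=> x; apply/(@cvgrPdist_lt _ _ _ (nbhs x)) => e e0; apply/nbhs_cabsP; exists e => // y yx.
by rewrite -ImN -ImD (le_lt_trans (cabs_Im _))// cabs_distC.
Qed.

Lemma continuous_conjc : continuous (@conjc R : C -> C).
Proof.
move=> x; apply/(@cabs_cvgP _ (nbhs x)) => e e0; apply/nbhs_cabsP; exists e => // y yx.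
by rewrite -rmorphB cabs_conjc.
Qed.

Lemma continuous_real_complex : continuous (fun r : R => r%:C : C).
Proof.
move=> x; apply/(@cabs_cvgP _ (nbhs x)) => e e0; near=> y; rewrite -rmorphB cabs_real distrC.
by near: y; exact: (@cvgr_dist_lt _ _ _ (nbhs x) _ id).
Unshelve. all: by end_near. Qed.

Lemma cvg_complex (T : Type) (F : set_system T) (FF : Filter F) (f g : T -> R) a b :
  f @ F --> a -> g @ F --> b -> (fun x => f x +i* g x : C) @ F --> (a +i* b : C).
Proof.
move=> /cvgrPdist_lt fa /cvgrPdist_lt gb; apply/cabs_cvgP => e e0.
have e2 : 0 < e / 2 by rewrite divr_gt0.
apply: filterS2 (fa _ e2) (gb _ e2) => x xa xb.
rewrite (le_lt_trans (cabs_le_ReIm _))//= (splitr e).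
by rewrite ltrD// distrC.
Qed.

End ModulusTopology.

Arguments Normc.normc {R} x : simpl never.

(** * Complex-valued integrals *)

Section ComplexIntegral.
Context (R : realType) d (T : measurableType d) (mu : {measure set T -> \bar R}).
Variables (D : set T) (mD : measurable D).
Local Notation C := R[i].
Implicit Types (f g : T -> C) (c : C).

Definition cmeasurable f := measurable_fun D (@Re R \o f) /\ measurable_fun D (@Im R \o f).

Lemma cintegrable_le f (g : T -> R) : cmeasurable f ->
  mu.-integrable D (EFin \o g) -> (forall x, D x -> cabs (f x) <= g x) ->
  cintegrable mu D f.
Proof.
move=> [fr fi] gi fg; split; apply: le_integrable gi => //.
- exact/measurable_EFinP.
- move=> x Dx /=; rewrite lee_fin (le_trans (cabs_Re _))// (le_trans (fg _ Dx))//.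
  exact: ler_norm.
- exact/measurable_EFinP.
- move=> x Dx /=; rewrite lee_fin (le_trans (cabs_Im _))// (le_trans (fg _ Dx))//.
  exact: ler_norm.
Qed.

(** By [cabs_le_ReIm] this sum bounds the modulus, so an integrable function supplies its own
    majorant for dominated convergence. *)
Lemma cintegrable_integrable_cabs f : cintegrable mu D f ->
  mu.-integrable D (EFin \o (fun x => `|Re (f x)| + `|Im (f x)|)).
Proof.
move=> [fr fi]; rewrite (_ : EFin \o _ = (abse \o (EFin \o (fun x => Re (f x)))) \+
  (abse \o (EFin \o (fun x => Im (f x)))))%E; last by apply/funext.
by apply: integrableD => //; exact: integrable_abse.
Qed.

Lemma cintegrableD f g : cintegrable mu D f -> cintegrable mu D g ->
  cintegrable mu D (fun x => f x + g x).
Proof.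
move=> [fr fi] [gr gi]; split.
  rewrite (_ : EFin \o _ = (EFin \o (fun x => Re (f x))) \+ (EFin \o (fun x => Re (g x))))%E.
    exact: integrableD.
  by apply/funext => x /=; rewrite ReD.
rewrite (_ : EFin \o _ = (EFin \o (fun x => Im (f x))) \+ (EFin \o (fun x => Im (g x))))%E.
  exact: integrableD.
by apply/funext => x /=; rewrite ImD.
Qed.

Lemma cintegralD f g : cintegrable mu D f -> cintegrable mu D g ->
  cintegral mu D (fun x => f x + g x) = cintegral mu D f + cintegral mu D g.
Proof.
move=> [fr fi] [gr gi]; apply/eqP; rewrite eq_complex /=.
rewrite -!RintegralD//; apply/andP; split; apply/eqP; apply: eq_Rintegral => x _.
  by rewrite ReD.
by rewrite ImD.
Qed.

Let integrableZ (k : R) (h : T -> R) : mu.-integrable D (EFin \o h) ->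
  mu.-integrable D (EFin \o (fun x => k * h x)).
Proof. by move=> hi; exact: (integrableZl mD k hi). Qed.

Lemma cintegrableZ c f : cintegrable mu D f -> cintegrable mu D (fun x => c * f x).
Proof.
move=> [fr fi]; split.
  rewrite (_ : EFin \o _ = (EFin \o (fun x => (Re c * Re (f x))%R)) \-
    (EFin \o (fun x => (Im c * Im (f x))%R)))%E.
    by apply: integrableB => //; exact: integrableZ.
  by apply/funext => x /=; rewrite ReM.
rewrite (_ : EFin \o _ = (EFin \o (fun x => (Re c * Im (f x))%R)) \+
  (EFin \o (fun x => (Im c * Re (f x))%R)))%E.
  by apply: integrableD => //; exact: integrableZ.
by apply/funext => x /=; rewrite ImM.
Qed.

Lemma cintegralZ c f : cintegrable mu D f ->
  cintegral mu D (fun x => c * f x) = c * cintegral mu D f.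
Proof.
move=> [fr fi]; apply/eqP; rewrite eq_complex ReM ImM /=.
rewrite -!RintegralZl// -RintegralB//; try exact: integrableZ.
rewrite -RintegralD//; try exact: integrableZ.
apply/andP; split; apply/eqP; apply: eq_Rintegral => x _.
  by rewrite ReM.
by rewrite ImM.
Qed.

Lemma eq_cintegral f g : {in D, f =1 g} -> cintegral mu D f = cintegral mu D g.
Proof.
by move=> fg; congr (_ +i* _); apply: eq_Rintegral => x xD; rewrite fg.
Qed.

Lemma cintegrable0 : cintegrable mu D (fun=> 0).
Proof. by split; exact: integrable0. Qed.

Lemma cintegral0 : cintegral mu D (fun=> 0) = 0.
Proof. by rewrite /cintegral /= /Rintegral integral0. Qed.

Lemma cintegrableN f : cintegrable mu D f -> cintegrable mu D (fun x => - f x).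
Proof.
move=> fi; rewrite (_ : (fun x => - f x) = (fun x => -1 * f x)); last first.
  by apply/funext => x; rewrite mulN1r.
exact: cintegrableZ.
Qed.

Lemma cintegralN f : cintegrable mu D f ->
  cintegral mu D (fun x => - f x) = - cintegral mu D f.
Proof.
move=> fi; rewrite -mulN1r -cintegralZ//.
by apply: eq_cintegral => x _; rewrite mulN1r.
Qed.

Lemma cintegralB f g : cintegrable mu D f -> cintegrable mu D g ->
  cintegral mu D (fun x => f x - g x) = cintegral mu D f - cintegral mu D g.
Proof. by move=> fi gi; rewrite cintegralD ?cintegralN//; exact: cintegrableN. Qed.

Lemma cintegrable_sum (I : Type) (s : seq I) (P : pred I) (F : I -> T -> C) :
  (forall i, P i -> cintegrable mu D (F i)) ->
  cintegrable mu D (fun x => \sum_(i <- s | P i) F i x).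
Proof.
move=> Fi; elim: s => [|i s IH].
  by under eq_fun do rewrite big_nil; exact: cintegrable0.
case: (boolP (P i)) => [Pi|/negbTE Pi].
  under eq_fun do rewrite big_cons Pi.
  exact: cintegrableD (Fi _ Pi) IH.
by under eq_fun do rewrite big_cons Pi.
Qed.

Lemma cintegral_sum (I : Type) (s : seq I) (P : pred I) (F : I -> T -> C) :
  (forall i, P i -> cintegrable mu D (F i)) ->
  cintegral mu D (fun x => \sum_(i <- s | P i) F i x) =
  \sum_(i <- s | P i) cintegral mu D (F i).
Proof.
move=> Fi; elim: s => [|i s IH].
  by under eq_fun do rewrite big_nil; rewrite big_nil cintegral0.
rewrite big_cons; case: (boolP (P i)) => [Pi|/negbTE Pi].
  rewrite -IH -cintegralD//; [|exact: Fi|exact: cintegrable_sum].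
  by apply: eq_cintegral => x _; rewrite big_cons Pi.
by rewrite -IH; apply: eq_cintegral => x _; rewrite big_cons Pi.
Qed.

End ComplexIntegral.

(** * Integrals of continuous functions over a segment *)

Section IntervalIntegral.
Variable R : realType.
Local Notation C := R[i].
Local Notation leb := (@lebesgue_measure R).
Implicit Types (f g : R -> C) (a b : R).

Definition itv_integral a b (f : R -> C) : C := cintegral leb `[a, b] (f : measurableTypeR R -> C).

Lemma continuous_cintegrable a b f : continuous f -> cintegrable leb `[a, b] f.
Proof.
move=> cf; split; apply: continuous_compact_integrable; try exact: segment_compact;
  apply: continuous_subspaceT => x; apply: continuous_comp; try exact: cf.
  exact: continuous_Re.
exact: continuous_Im.
Qed.
Local Hint Resolve continuous_cintegrable : core.

Lemma itv_integralD a b f g : continuous f -> continuous g ->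
  itv_integral a b (fun x => f x + g x) = itv_integral a b f + itv_integral a b g.
Proof. by move=> cf cg; rewrite /itv_integral cintegralD//; exact: continuous_cintegrable. Qed.

Lemma itv_integralB a b f g : continuous f -> continuous g ->
  itv_integral a b (fun x => f x - g x) = itv_integral a b f - itv_integral a b g.
Proof. by move=> cf cg; rewrite /itv_integral cintegralB//; exact: continuous_cintegrable. Qed.

Lemma itv_integralZ a b c f : continuous f ->
  itv_integral a b (fun x => c * f x) = c * itv_integral a b f.
Proof. by move=> cf; rewrite /itv_integral cintegralZ//; exact: continuous_cintegrable. Qed.

Lemma itv_integral_sum a b (I : Type) (s : seq I) (P : pred I) (F : I -> R -> C) :
  (forall i, continuous (F i)) ->
  itv_integral a b (fun x => \sum_(i <- s | P i) F i x) =
  \sum_(i <- s | P i) itv_integral a b (F i).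
Proof.
by move=> cF; rewrite /itv_integral cintegral_sum// => i _; exact: continuous_cintegrable.
Qed.

Lemma eq_itv_integral a b f g : (forall x, a <= x <= b -> f x = g x) ->
  itv_integral a b f = itv_integral a b g.
Proof. by move=> fg; apply: eq_cintegral => x; rewrite inE /= in_itv /= => /fg. Qed.

Lemma itv_integral_cst a b c : a <= b -> itv_integral a b (fun=> c) = c * (b - a)%:C.
Proof.
move=> ab; rewrite /itv_integral /cintegral !Rintegral_cst//= lebesgue_measure_itv /=.
rewrite lte_fin; case: (ltgtP a b) ab => //= [ab _|-> _].
  by apply/eqP; rewrite eq_complex ReM ImM /= !mulr0 subr0 add0r !eqxx.
by apply/eqP; rewrite eq_complex ReM ImM /= subrr !mulr0 subr0 addr0 !eqxx.
Qed.

(** The factor 2 comes from bounding real and imaginary parts separately; its size is immaterial to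
    all later estimates. *)
Lemma itv_integral_le a b f M : a <= b -> continuous f ->
  (forall x, a <= x <= b -> cabs (f x) <= M) ->
  cabs (itv_integral a b f) <= 2 * M * (b - a).
Proof.
move=> ab cf fM; have [fr fi] := continuous_cintegrable a b cf.
have M0 : 0 <= M by rewrite (le_trans (cabs_ge0 (f a)))// fM// lexx ab.
have mba : fine (leb `[a, b]) = b - a.
  rewrite lebesgue_measure_itv /= lte_fin; case: (ltgtP a b) ab => //= -> _.
  by rewrite subrr.
have half (h : R -> R) : leb.-integrable `[a, b] (EFin \o h) ->
    (forall x, a <= x <= b -> `|h x| <= M) ->
    `|\int[leb]_(x in `[a, b]) h x| <= M * (b - a).
  move=> hi hM; rewrite (le_trans (le_normr_Rintegral _ hi))//.
  rewrite -mba -Rintegral_cst//; apply: le_Rintegral => //.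
  - exact: integrable_abse hi.
  - apply: continuous_compact_integrable; first exact: segment_compact.
    by apply: continuous_subspaceT => x; exact: cvg_cst.
rewrite (le_trans (cabs_le_ReIm _))//= -mulrA mulr_natl mulr2n lerD//.
  apply: (half (fun x => Re (f x)) fr) => x /fM; exact/le_trans/cabs_Re.
apply: (half (fun x => Im (f x)) fi) => x /fM; exact/le_trans/cabs_Im.
Qed.

Lemma itv_integral_cat a b c f : a <= b -> b <= c -> continuous f ->
  itv_integral a c f = itv_integral a b f + itv_integral b c f.
Proof.
move=> ab bc cf; have [fr fi] := continuous_cintegrable a c cf.
have half (h : R -> R) : leb.-integrable `[a, c] (EFin \o h) ->
   \int[leb]_(x in `[a, c]) h x =
   \int[leb]_(x in `[a, b]) h x + \int[leb]_(x in `[b, c]) h x.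
  move=> hi.
  have hbc : leb.-integrable `]b, c] (EFin \o h).
    apply: integrableS hi => //; apply: subset_itvr.
    by rewrite bnd_simp.
  rewrite -(Rintegral_itv_obnd_cbnd hbc).
  have := @Rintegral_itvB _ h (BLeft a) (BRight c) b hi.
  by rewrite !bnd_simp => /(_ ab bc) <-; ring.
by apply/eqP; rewrite eq_complex /= !half ?eqxx.
Qed.

End IntervalIntegral.

(** * Differentiation along real paths *)

Section PathDerivative.
Variable R : realType.
Local Notation C := R[i].
Implicit Types (f g : R -> C) (t : R) (c : C).

(** Componentwise, because [R[i]] is used as a normed module over itself, where increments are
    complex. *)
Definition path_derive f t c :=
  is_derive t 1 (fun s => Re (f s)) (Re c) /\ is_derive t 1 (fun s => Im (f s)) (Im c).

Lemma path_derive_continuous f (f' : R -> C) :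
  (forall t, path_derive f t (f' t)) -> continuous f.
Proof.
move=> ff' t; have [[dr _] [di _]] := ff' t.
rewrite (_ : f = fun s => Re (f s) +i* Im (f s)); last by apply/funext => s; case: (f s).
apply: (@cvg_complex _ _ (nbhs t)); apply: differentiable_continuous; exact/derivable1_diffP.
Qed.

Lemma path_derive_real (r : R -> R) t (l : R) :
  is_derive t 1 r l -> path_derive (fun s => (r s)%:C) t l%:C.
Proof. by move=> rl; split => //=; exact: is_derive_cst. Qed.

Lemma path_derive_cst c t : path_derive (fun=> c) t 0.
Proof. by split; exact: is_derive_cst. Qed.

Lemma path_deriveD f g t a b : path_derive f t a -> path_derive g t b ->
  path_derive (fun s => f s + g s) t (a + b).
Proof.
move=> [fr fi] [gr gi]; split; rewrite ?ReD ?ImD.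
  by rewrite (_ : (fun s => _) = (fun s => Re (f s)) + (fun s => Re (g s)));
    [exact: is_deriveD|apply/funext => s; rewrite ReD].
by rewrite (_ : (fun s => _) = (fun s => Im (f s)) + (fun s => Im (g s)));
  [exact: is_deriveD|apply/funext => s; rewrite ImD].
Qed.

Lemma path_deriveM f g t a b : path_derive f t a -> path_derive g t b ->
  path_derive (fun s => f s * g s) t (f t * b + a * g t).
Proof.
move=> [fr fi] [gr gi]; split.
  rewrite (_ : (fun s => _) = (fun s => Re (f s)) * (fun s => Re (g s))
    - (fun s => Im (f s)) * (fun s => Im (g s)));
    last by apply/funext => s; rewrite ReM.
  apply: (is_derive_eq (is_deriveB (is_deriveM fr gr) (is_deriveM fi gi))).
  rewrite !(ReD, ReM) /GRing.scale /=; ring.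
rewrite (_ : (fun s => _) = (fun s => Re (f s)) * (fun s => Im (g s))
    + (fun s => Im (f s)) * (fun s => Re (g s)));
    last by apply/funext => s; rewrite ImM.
apply: (is_derive_eq (is_deriveD (is_deriveM fr gi) (is_deriveM fi gr))).
rewrite !(ImD, ImM) /GRing.scale /=; ring.
Qed.

Lemma path_deriveZ c f t a : path_derive f t a ->
  path_derive (fun s => c * f s) t (c * a).
Proof.
by move=> /(path_deriveM (path_derive_cst c t)); rewrite mul0r addr0.
Qed.

Lemma path_derive_sum (I : Type) (s : seq I) (P : pred I) (f : I -> R -> C) (f' : I -> C) t :
  (forall i, P i -> path_derive (f i) t (f' i)) ->
  path_derive (fun u => \sum_(i <- s | P i) f i u) t (\sum_(i <- s | P i) f' i).
Proof.
move=> fi; elim: s => [|i s IH].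
  by rewrite big_nil; under eq_fun do rewrite big_nil; exact: path_derive_cst.
rewrite big_cons; case: (boolP (P i)) => [Pi|/negbTE Pi].
  under eq_fun do rewrite big_cons Pi.
  exact: path_deriveD (fi _ Pi) IH.
by under eq_fun do rewrite big_cons Pi.
Qed.

Lemma Rintegral_derive (a b : R) (f f' : R -> R) : a <= b ->
  (forall t, is_derive t 1 f (f' t)) -> continuous f' ->
  \int[lebesgue_measure]_(x in `[a, b]) f' x = f b - f a.
Proof.
rewrite le_eqVlt => /predU1P[->|ab] ff' cf'.
  by rewrite set_itv1 Rintegral_set1 subrr.
have cf : continuous f.
  by move=> t; apply: differentiable_continuous; apply/derivable1_diffP; case: (ff' t).
rewrite /Rintegral (@continuous_FTC2 _ f' f)//.
- by apply: continuous_subspaceT.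
- split; first by move=> t _; case: (ff' t).
  + exact/cvg_at_right_filter/cf.
  + exact/cvg_at_left_filter/cf.
- by move=> t _; rewrite derive1E; case: (ff' t).
Qed.

Lemma itv_integral_derive (a b : R) (f f' : R -> C) : a <= b ->
  (forall t, path_derive f t (f' t)) -> continuous f' ->
  itv_integral a b f' = f b - f a.
Proof.
move=> ab ff' cf'; apply/eqP; rewrite eq_complex !ReD !ImD !ReN !ImN /=.
apply/andP; split; apply/eqP.
  apply: (@Rintegral_derive a b (fun s => Re (f s)) (fun s => Re (f' s))) => //.
    by move=> t; case: (ff' t).
  by move=> x; apply: continuous_comp; [exact: cf'|exact: continuous_Re].
apply: (@Rintegral_derive a b (fun s => Im (f s)) (fun s => Im (f' s))) => //.
  by move=> t; case: (ff' t).
by move=> x; apply: continuous_comp; [exact: cf'|exact: continuous_Im].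
Qed.

Let real_mean_value (f f' : R -> R) (k e : R) :
  (forall t, is_derive t 1 f (f' t)) -> (forall t, 0 <= t <= 1 -> `|f' t - k| <= e) ->
  `|f 1 - f 0 - k| <= e.
Proof.
move=> ff' fe.
have cf : {within `[0, 1], continuous f}.
  apply: continuous_subspaceT => t; apply: differentiable_continuous.
  by apply/derivable1_diffP; case: (ff' t).
have [y y01 ->] := MVT_segment ler01 (fun t _ => ff' t) cf.
by rewrite subr0 mulr1 fe//; move: y01; rewrite in_itv.
Qed.

(** The mean value theorem concerns real functions, so it is applied to both parts, whence the
    factor 2. *)
Lemma path_mean_value (f f' : R -> C) c (e : R) :
  (forall t, path_derive f t (f' t)) ->
  (forall t, 0 <= t <= 1 -> cabs (f' t - c) <= e) ->
  cabs (f 1 - f 0 - c) <= 2 * e.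
Proof.
move=> ff' fe; rewrite (le_trans (cabs_le_ReIm _))// !(ReD, ImD) !(ReN, ImN).
rewrite mulr_natl mulr2n lerD//.
  apply: (@real_mean_value (fun s => Re (f s)) (fun s => Re (f' s))).
    by move=> t; case: (ff' t).
  by move=> t /fe; apply: le_trans; rewrite -ReN -ReD; exact: cabs_Re.
apply: (@real_mean_value (fun s => Im (f s)) (fun s => Im (f' s))).
  by move=> t; case: (ff' t).
by move=> t /fe; apply: le_trans; rewrite -ImN -ImD; exact: cabs_Im.
Qed.

(** The limit over complex increments is restricted to real ones, and then a continuous real-linear
    projection, [Re] or [Im], is passed through it. *)
Lemma path_derive_line (V : normedModType C) (G : V -> C) (x v : V) t :
  derivable G (x + t%:C *: v) v ->
  path_derive (fun s => G (x + s%:C *: v)) t ('D_v G (x + t%:C *: v)).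
Proof.
move=> dG; set y := x + _; set l := 'D_v G y.
have Gl : (fun h : R => (h%:C)^-1 * (G (x + (h + t)%:C *: v) - G y)) @ 0^' --> l.
  apply/cabs_cvgP => e e0.
  have /cabs_cvgP/(_ e e0)/nbhs_cabsP[r r0 Hr] : (fun h : C => h^-1 *: ((G \o shift y) (h *: v) - G y)) @ 0^' --> l by exact: dG.
  near=> h.
  have h0 : h != 0 by near: h; exact: nbhs_dnbhs_neq.
  rewrite (_ : x + _ = h%:C *: v + y); last first.
    by rewrite /y rmorphD scalerDl addrCA.
  apply: (Hr h%:C).
    rewrite subr0 cabs_real; near: h; apply: dnbhs0_lt => //.
  by rewrite eq_complex /= eqxx andbT.
have dl (p : C -> R) : continuous p -> (forall r z, p (r%:C * z) = r * p z) ->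
    (forall z w, p (z - w) = p z - p w) ->
    is_derive t 1 (fun s => p (G (x + s%:C *: v))) (p l).
  move=> cp pZ pB.
  have pl : (fun h : R => h^-1 *: (((fun s => p (G (x + s%:C *: v))) \o shift t) (h *: 1) - p (G y)))
       @ 0^' --> p l.
    have := cvg_comp _ _ Gl (cp l); apply: cvg_trans; apply: near_eq_cvg; near=> h.
    by rewrite /= -fmorphV pZ pB /GRing.scale /= mulr1.
  by split; [apply/cvg_ex; exists (p l)|exact: cvg_lim].
split; apply: dl.
- exact: continuous_Re.
- by move=> r z; rewrite ReM /= mul0r subr0.
- by move=> z w; rewrite ReD ReN.
- exact: continuous_Im.
- by move=> r z; rewrite ImM /= mul0r addr0.
- by move=> z w; rewrite ImD ImN.
Unshelve. all: by end_near. Qed.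

End PathDerivative.

(** * Goursat's theorem and Cauchy's formula *)

Section ContinuousC.
Variables (R : realType) (T : topologicalType).
Implicit Types f g : T -> R[i].

Lemma ccontinuousD_at x f g : {for x, continuous f} -> {for x, continuous g} ->
  {for x, continuous (fun y => f y + g y)}.
Proof. by move=> cf cg; exact: (cvgD cf cg). Qed.

Lemma ccontinuousB_at x f g : {for x, continuous f} -> {for x, continuous g} ->
  {for x, continuous (fun y => f y - g y)}.
Proof. by move=> cf cg; exact: (cvgB cf cg). Qed.

Lemma ccontinuousM_at x f g : {for x, continuous f} -> {for x, continuous g} ->
  {for x, continuous (fun y => f y * g y)}.
Proof. by move=> cf cg; exact: (cvgM cf cg). Qed.

Lemma ccontinuousD f g : continuous f -> continuous g -> continuous (fun x => f x + g x).
Proof. by move=> cf cg x; exact: (ccontinuousD_at (cf x) (cg x)). Qed.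

Lemma ccontinuousB f g : continuous f -> continuous g -> continuous (fun x => f x - g x).
Proof. by move=> cf cg x; exact: (ccontinuousB_at (cf x) (cg x)). Qed.

Lemma ccontinuousM f g : continuous f -> continuous g -> continuous (fun x => f x * g x).
Proof. by move=> cf cg x; exact: (ccontinuousM_at (cf x) (cg x)). Qed.

Lemma ccontinuous_cst (c : R[i]) : continuous (fun _ : T => c).
Proof. by move=> x; exact: cvg_cst. Qed.

End ContinuousC.

Lemma ccontinuous_id (R : realType) : continuous (fun z : R[i] => z).
Proof. by move=> z; exact: cvg_id. Qed.

Section Goursat.
Variable R : realType.
Local Notation C := R[i].
Implicit Types (f g : C -> C) (x y a b : R).

(* The boundary integral of [f] over the rectangle [x, x + a] x [y, y + b],
   opposite sides being paired so that affine functions give constant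
   integrands. *)
Definition rect_integral f x y a b : C :=
  itv_integral x (x + a) (fun s => f (s +i* y) - f (s +i* (y + b))) +
  'i * itv_integral y (y + b) (fun s => f ((x + a) +i* s) - f (x +i* s)).

Lemma continuous_hline f y : continuous f -> continuous (fun s : R => f (s +i* y)).
Proof.
move=> cf s; apply: (continuous_comp (f := fun s : R => s +i* y)); last exact: cf.
by apply: (@cvg_complex _ _ (nbhs s)); [exact: cvg_id|exact: cvg_cst].
Qed.

Lemma continuous_vline f x : continuous f -> continuous (fun s : R => f (x +i* s)).
Proof.
move=> cf s; apply: (continuous_comp (f := fun s : R => x +i* s)); last exact: cf.
by apply: (@cvg_complex _ _ (nbhs s)); [exact: cvg_cst|exact: cvg_id].
Qed.

Let ch f y z : continuous f -> continuous (fun s : R => f (s +i* y) - f (s +i* z)).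
Proof. by move=> cf; apply: ccontinuousB; exact: continuous_hline. Qed.

Let cv f y z : continuous f -> continuous (fun s : R => f (y +i* s) - f (z +i* s)).
Proof. by move=> cf; apply: ccontinuousB; exact: continuous_vline. Qed.

(** The side shared by the two rectangles is traversed in opposite directions and cancels. *)
Lemma rect_integral_hsplit f x y a1 a2 b : continuous f -> 0 <= a1 -> 0 <= a2 ->
  rect_integral f x y (a1 + a2) b =
  rect_integral f x y a1 b + rect_integral f (x + a1) y a2 b.
Proof.
move=> cf a10 a20; rewrite /rect_integral !addrA.
rewrite (@itv_integral_cat _ x (x + a1))//; [|lra|lra|exact: ch].
rewrite -!addrA; congr (_ + _); rewrite [RHS]addrCA; congr (_ + _).
rewrite -mulrDr -itv_integralD; [|exact: cv|exact: cv].
by congr (_ * _); apply: eq_itv_integral => s _ /=; rewrite !addrA; ring.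
Qed.

Lemma rect_integral_vsplit f x y a b1 b2 : continuous f -> 0 <= b1 -> 0 <= b2 ->
  rect_integral f x y a (b1 + b2) =
  rect_integral f x y a b1 + rect_integral f x (y + b1) a b2.
Proof.
move=> cf b10 b20; rewrite /rect_integral !addrA.
rewrite (@itv_integral_cat _ y (y + b1))//; [|lra|lra|exact: cv].
rewrite mulrDr addrA; congr (_ + _); rewrite [RHS]addrAC; congr (_ + _).
rewrite -itv_integralD; [|exact: ch|exact: ch].
by apply: eq_itv_integral => s _ /=; rewrite addrA; ring.
Qed.

(** For an affine function the paired integrands are constant and the two sides contribute
    [- i c a b] and [i c a b]. Only the error [h] remains; each pair of values is at most [2 M],
    doubled by [itv_integral_le]. *)
Lemma rect_integral_affine_approx f (k c : C) x y a b M : continuous f ->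
  0 <= a -> 0 <= b ->
  (forall s t, x <= s <= x + a -> y <= t <= y + b ->
     cabs (f (s +i* t) - (k + c * (s +i* t))) <= M) ->
  cabs (rect_integral f x y a b) <= 4 * M * (a + b).
Proof.
move=> cf a0 b0 fM.
pose h z := f z - (k + c * z).
have fh z w : f z - f w = (h z - h w) + c * (z - w) by rewrite /h; ring.
have ch' : continuous h.
  have cid : continuous (fun z : C => z) by move=> z; exact: cvg_id.
  exact: (ccontinuousB cf (ccontinuousD (@ccontinuous_cst R C k)
    (ccontinuousM (@ccontinuous_cst R C c) cid))).
have -> : rect_integral f x y a b = rect_integral h x y a b.
  rewrite /rect_integral.
  rewrite (@eq_itv_integral _ x _ _ (fun s => (h (s +i* y) - h (s +i* (y + b)))
      + c * (0 -i* b))); last first.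
    by move=> s _; rewrite fh; congr (_ + c * _); apply/eqP; rewrite eq_complex /=;
      apply/andP; split; apply/eqP; ring.
  rewrite (@eq_itv_integral _ y _ _ (fun s => (h ((x + a) +i* s) - h (x +i* s))
      + c * a%:C)); last first.
    by move=> s _; rewrite fh; congr (_ + c * _); apply/eqP; rewrite eq_complex /=;
      apply/andP; split; apply/eqP; ring.
  rewrite (itv_integralD _ _ (@ch h y (y + b) ch') (@ccontinuous_cst R R (c * (0 -i* b)))).
  rewrite (itv_integralD _ _ (@cv h (x + a) x ch') (@ccontinuous_cst R R (c * a%:C))).
  rewrite !itv_integral_cst ?lerDl//.
  rewrite mulrDr addrACA.
  have -> : 0 -i* b = - ('i * b%:C) :> C.
    by apply/eqP; rewrite eq_complex ReN ImN ReM ImM /=; apply/andP; split; apply/eqP; ring.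
  have -> : x + a - x = a by ring.
  have -> : y + b - y = b by ring.
  suff -> : c * - ('i * b%:C) * a%:C + 'i * (c * a%:C * b%:C) = 0 by rewrite addr0.
  by ring.
rewrite (le_trans (cabsD _ _))//.
have hM2 z w : cabs (h z) <= M -> cabs (h w) <= M -> cabs (h z - h w) <= 2 * M.
  by move=> zM wM; rewrite (le_trans (cabsB _ _))// mulr_natl mulr2n lerD.
have -> : 4 * M * (a + b) = 2 * (2 * M) * (x + a - x) + 2 * (2 * M) * (y + b - y) by ring.
apply: lerD; last rewrite cabsM (_ : cabs 'i = 1) ?mul1r; last first.
  by rewrite /Normc.normc expr0n add0r expr1n sqrtr1.
  apply: (itv_integral_le _ (cv (y := x + a) (z := x) ch')) => [|s sy]; first by rewrite lerDl.
  by apply: hM2; apply: fM => //; rewrite ?lexx lerDl ?a0//= lexx.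
apply: (itv_integral_le _ (ch (y := y) (z := y + b) ch')) => [|s sx]; first by rewrite lerDl.
by apply: hM2; apply: fM => //; rewrite ?lexx lerDl ?b0//= lexx.
Qed.

(** The integrals over the four half-size rectangles add up to the whole, so one of them has at
    least a quarter of its modulus. *)
Lemma Goursat_step f x y a b : continuous f -> 0 <= a -> 0 <= b ->
  exists x' y', [/\ x <= x' <= x + a / 2, y <= y' <= y + b / 2 &
   cabs (rect_integral f x y a b) <= 4 * cabs (rect_integral f x' y' (a / 2) (b / 2))].
Proof.
move=> cf a0 b0; have a20 : 0 <= a / 2 by lra. have b20 : 0 <= b / 2 by lra.
pose J x' y' := rect_integral f x' y' (a / 2) (b / 2).
have JE : rect_integral f x y a b =
    (J x y + J x (y + b / 2)) + (J (x + a / 2) y + J (x + a / 2) (y + b / 2)).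
  rewrite /J -!rect_integral_vsplit// -rect_integral_hsplit//.
  by rewrite -!splitr.
have := cabsD (J x y + J x (y + b / 2)) (J (x + a / 2) y + J (x + a / 2) (y + b / 2)).
rewrite -JE => JD.
have J1 := cabsD (J x y) (J x (y + b / 2)).
have J2 := cabsD (J (x + a / 2) y) (J (x + a / 2) (y + b / 2)).
set K := cabs (rect_integral _ _ _ _ _) in JD *.
have [h1|h1] := leP K (4 * cabs (J x y)).
  by exists x, y; split; rewrite ?lexx ?lerDl.
have [h2|h2] := leP K (4 * cabs (J x (y + b / 2))).
  by exists x, (y + b / 2); split; rewrite ?lexx ?lerDl ?a20 ?b20.
have [h3|h3] := leP K (4 * cabs (J (x + a / 2) y)).
  by exists (x + a / 2), y; split; rewrite ?lexx ?lerDl ?a20 ?b20.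
exists (x + a / 2), (y + b / 2); split; rewrite ?lexx ?lerDl ?a20 ?b20 //.
rewrite -/(J _ _); set K1 := cabs (J _ _) in J1 h1; set K2 := cabs (J x _) in J1 h2.
set K3 := cabs (J _ y) in J2 h3; set K4 := cabs (J (x + a / 2) (y + b / 2)) in J2 *.
by move: (K) (K1) (K2) (K3) (K4) JD J1 J2 h1 h2 h3 => ? ? ? ? ? JD J1 J2 h1 h2 h3; lra.
Qed.

(* A point [l] with [u n <= l <= u n + a / 2 ^ n] for all [n]. *)
Lemma nested_interval_point (u : nat -> R) (a : R) : 0 <= a ->
  (forall n, u n <= u n.+1 <= u n + a / 2 ^+ n / 2) ->
  exists l, forall n, u n <= l <= u n + a / 2 ^+ n.
Proof.
move=> a0 uS.
have u_homo m n : (m <= n)%N -> u m <= u n.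
  apply: (homo_leq (r := fun p q : R => p <= q)) => //; first exact: le_trans.
  by move=> k; case/andP: (uS k).
have v_homo m n : (m <= n)%N -> u n + a / 2 ^+ n <= u m + a / 2 ^+ m.
  apply: (homo_leq (r := fun p q => q <= p) (f := fun k => u k + a / 2 ^+ k)) => //.
    by move=> p q r pq qr; exact: le_trans qr pq.
  move=> k; case/andP: (uS k) => _ uk; rewrite exprS invfM mulrCA.
  move: uk; set z := a / 2 ^+ k; lra.
have ub m n : u m <= u n + a / 2 ^+ n.
  have pos k : 0 <= a / 2 ^+ k by rewrite divr_ge0// exprn_ge0.
  have [/u_homo mn|/ltnW/v_homo nm] := leqP m n.
    by rewrite (le_trans mn)// lerDl.
  by rewrite (le_trans _ nm)// lerDl.
have hs : has_sup (range u).
  by split; [exists (u 0), 0|exists (u 0 + a / 2 ^+ 0) => _ [m _ <-]; exact: ub].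
exists (sup (range u)) => n; apply/andP; split.
  by apply: ub_le_sup; [case: hs|exists n].
by apply: sup_le_ub; [case: hs|move=> _ [m _ <-]; exact: ub].
Qed.

Definition cdiff f (p : C) := exists c, forall e : R, 0 < e ->
  exists2 r : R, 0 < r & forall z, cabs (z - p) < r ->
    cabs (f z - f p - c * (z - p)) <= e * cabs (z - p).

Lemma Goursat f x y a b : (forall p, cdiff f p) -> continuous f ->
  0 <= a -> 0 <= b -> rect_integral f x y a b = 0.
Proof.
move=> df cf a0 b0; apply: cabs_eq0; apply/eqP; apply/contraT => J0.
have {}J0 : 0 < cabs (rect_integral f x y a b) by rewrite lt_neqAle eq_sym J0 cabs_ge0.
(* The level [n] determines the side lengths, so only the lower left corner has to be chosen. *)
have [step stepP] : {step : nat -> R * R -> R * R & forall n p,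
    [/\ p.1 <= (step n p).1 <= p.1 + a / 2 ^+ n / 2,
     p.2 <= (step n p).2 <= p.2 + b / 2 ^+ n / 2 &
     cabs (rect_integral f p.1 p.2 (a / 2 ^+ n) (b / 2 ^+ n)) <=
     4 * cabs (rect_integral f (step n p).1 (step n p).2 (a / 2 ^+ n.+1) (b / 2 ^+ n.+1))]}.
  have /choice[s sP] : forall np : nat * (R * R), exists q : R * R,
    [/\ np.2.1 <= q.1 <= np.2.1 + a / 2 ^+ np.1 / 2,
     np.2.2 <= q.2 <= np.2.2 + b / 2 ^+ np.1 / 2 &
     cabs (rect_integral f np.2.1 np.2.2 (a / 2 ^+ np.1) (b / 2 ^+ np.1)) <=
     4 * cabs (rect_integral f q.1 q.2 (a / 2 ^+ np.1.+1) (b / 2 ^+ np.1.+1))].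
    move=> [n [x' y']] /=; have := @Goursat_step f x' y' (a / 2 ^+ n) (b / 2 ^+ n) cf.
    rewrite !divr_ge0 ?exprn_ge0// => /(_ isT isT)[x2 [y2 [? ? ?]]].
    by exists (x2, y2); split => //=; rewrite exprSr invfM !mulrA.
  by exists (fun n p => s (n, p)) => n p; exact: (sP (n, p)).
pose q := fix q n := if n is m.+1 then step m (q m) else (x, y).
have [lx lxP] := @nested_interval_point (fun n => (q n).1) a a0
  (fun n => let: And3 h _ _ := stepP n (q n) in h).
have [ly lyP] := @nested_interval_point (fun n => (q n).2) b b0
  (fun n => let: And3 _ h _ := stepP n (q n) in h).
have Jq n : cabs (rect_integral f x y a b) <=
    4 ^+ n * cabs (rect_integral f (q n).1 (q n).2 (a / 2 ^+ n) (b / 2 ^+ n)).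
  elim: n => [|n IH]; first by rewrite expr0 mul1r !divr1.
  rewrite (le_trans IH)// exprSr -mulrA ler_wpM2l ?exprn_ge0//.
  by case: (stepP n (q n)).
have [c cP] := df (lx +i* ly).
pose S := a + b; have S0 : 0 <= S by rewrite addr_ge0.
pose J := cabs (rect_integral f x y a b).
(* At level [n] the affine approximation bounds the integral by [4 e S^2 / 4^n]; this [e] makes that
   smaller than [J / 4^n]. The [+ 1] gives strictness and covers [S = 0]. *)
pose e := J / (4 * S ^+ 2 + 1).
have D0 : 0 < 4 * S ^+ 2 + 1 by rewrite ltr_wpDl// mulr_ge0// sqr_ge0.
have e0 : 0 < e by rewrite divr_gt0.
have [r r0 rP] := cP _ e0.
have [n nr] : exists n, S / 2 ^+ n < r.
  have := @cvg_geometric _ S 2^-1; rewrite ger0_norm ?invr_ge0// invf_lt1// ltr1n.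
  move=> /(_ isT)/cvgrPdist_lt/(_ _ r0)[n _ /(_ n (leqnn n))].
  rewrite sub0r normrN /= exprVn ger0_norm => [nr|]; first by exists n.
  by rewrite divr_ge0// exprn_ge0.
have p2 : 0 < 2 ^+ n :> R by rewrite exprn_gt0.
have /andP[lx1 lx2] := lxP n; have /andP[ly1 ly2] := lyP n.
suff : 4 ^+ n * cabs (rect_integral f (q n).1 (q n).2 (a / 2 ^+ n) (b / 2 ^+ n)) < J.
  by rewrite ltNge Jq.
have ap (k : R) : 0 <= k -> 0 <= k / 2 ^+ n by move=> k0; rewrite divr_ge0// ltW.
have := @rect_integral_affine_approx f (f (lx +i* ly) - c * (lx +i* ly)) c
  (q n).1 (q n).2 (a / 2 ^+ n) (b / 2 ^+ n) (e * (S / 2 ^+ n)) cf (ap _ a0) (ap _ b0).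
have near_l s t : (q n).1 <= s <= (q n).1 + a / 2 ^+ n ->
    (q n).2 <= t <= (q n).2 + b / 2 ^+ n ->
    cabs ((s +i* t) - (lx +i* ly)) <= S / 2 ^+ n.
  move=> /andP[s1 s2] /andP[t1 t2]; rewrite (le_trans (cabs_le_ReIm _))//=.
  rewrite /S mulrDl lerD// ler_norml; apply/andP; split; lra.
move=> /(_ _)/le_lt_trans Jn; rewrite mulrC -ltr_pdivlMr ?exprn_gt0//.
apply: Jn => [s t sq tq|].
  have st := near_l _ _ sq tq.
  rewrite (_ : _ - _ = f (s +i* t) - f (lx +i* ly) - c * (s +i* t - (lx +i* ly)));
    last by ring.
  rewrite (le_trans (rP _ (le_lt_trans st nr)))// ler_wpM2l// ltW//.
rewrite -mulrDl -/S (_ : 4 * (e * (S / 2 ^+ n)) * (S / 2 ^+ n) =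
  (4 * S ^+ 2 * e) / (2 ^+ n * 2 ^+ n)); last first.
  by rewrite invfM; ring.
rewrite -exprMn (_ : 2 * 2 = 4 :> R); last by ring.
rewrite ltr_pM2r ?invr_gt0 ?exprn_gt0// /e mulrCA gtr_pMr// ltr_pdivrMr// mul1r.
by rewrite ltrDl.
Qed.
End Goursat.

(** * The complex exponential *)

Section ComplexExponential.
Variable R : realType.
Local Notation C := R[i].

Lemma cexpD (z w : C) : cexp (z + w) = cexp z * cexp w.
Proof.
rewrite /cexp ReD ImD expRD cosD sinD rmorphM mulrACA; congr (_ * _).
by apply/eqP; rewrite eq_complex ReM ImM /=; apply/andP; split; apply/eqP; ring.
Qed.

Lemma cexp0 : cexp (0 : C) = 1.
Proof. by rewrite /cexp /= expR0 cos0 sin0 mul1r. Qed.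

Lemma cabs_cexp (z : C) : cabs (cexp z) = expR (Re z).
Proof.
by rewrite /cexp cabsM cabs_real ger0_norm ?expR_ge0// /Normc.normc cos2Dsin2 sqrtr1 mulr1.
Qed.

Lemma cexp_period (x y : R) : cexp (x +i* (y + 2 * pi) : C) = cexp (x +i* y).
Proof. by rewrite /cexp /= mulr_natl cosD2pi sinD2pi. Qed.

Lemma is_derive_bound (f : R -> R) (x l : R) : is_derive x 1 f l ->
  forall e, 0 < e -> \forall h \near (0 : R), `|f (x + h) - f x - l * h| <= e * `|h|.
Proof.
move=> [df fl] e e0.
have : (fun h => h^-1 *: ((f \o shift x) (h *: 1) - f x)) @ 0^' --> l.
  by rewrite -fl; exact: df.
move=> /cvgrPdist_le/(_ e e0); rewrite near_withinE => fe.
near=> h; have [->|h0] := eqVneq h 0; first by rewrite addr0 !subrr mulr0 subrr normr0 mulr0.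
rewrite -ler_pdivrMr ?normr_gt0// -normfV -normrM mulrBl mulfK// distrC.
have : h != 0 -> `|l - h^-1 *: ((f \o shift x) (h *: 1) - f x)| <= e by near: h.
by move=> /(_ h0); rewrite /= /GRing.scale /= mulr1 [h + x]addrC mulrC [X in l - X]mulrC mulrC.
Unshelve. all: by end_near. Qed.

Lemma near0_ReIm (P : R -> Prop) : (\forall s \near (0 : R), P s) ->
  exists2 r : R, 0 < r & forall h : C, cabs h < r -> P (Re h) /\ P (Im h).
Proof.
move=> /nbhs_ballP[r /= r0 rP]; exists r => // h hr; split; apply: rP;
  rewrite -ball_normE /= sub0r normrN (le_lt_trans _ hr)//; [exact: cabs_Re|exact: cabs_Im].
Qed.

(** For [h = s + i t] the remainder has real part [(e^s - 1 - s) + e^s (cos t - 1)] and imaginary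
    part [e^s (sin t - t) + (e^s - 1) t], so first-order bounds for the real functions at 0
    suffice. *)
Lemma cexp_taylor1 (e : R) : 0 < e ->
  exists2 r : R, 0 < r & forall h : C, cabs h < r -> cabs (cexp h - 1 - h) <= e * cabs h.
Proof.
(* With [e^s <= 2] near 0, each of the two parts costs [3 k |h|]. *)
move=> e0; pose k := e / 6; have k0 : 0 < k by rewrite divr_gt0.
have E := @is_derive_bound expR 0 _ (is_derive_expR 0) k k0.
have S := @is_derive_bound sin 0 _ (is_derive_sin 0) k k0.
have K := @is_derive_bound cos 0 _ (is_derive_cos 0) k k0.
have E2 : \forall s \near (0 : R), `|expR s - 1| <= Num.min k 1.
  have : expR s @[s --> (0 : R)] --> expR 0 by exact: continuous_expR.
  move=> /cvgrPdist_le/(_ (Num.min k 1)); rewrite lt_min k0 ltr01 => /(_ isT).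
  by apply: filterS => s; rewrite expR0 distrC.
have [r r0 rP] := near0_ReIm (filterI (filterI E S) (filterI K E2)).
exists r => // h /rP[]; rewrite expR0 sin0 cos0 oppr0 => -[[+ _] [_ +]] [[_ +] [+ _]].
rewrite !add0r addr0 mul0r !mul1r subr0 le_min => Es /andP[es1 es2] St Ct.
rewrite (le_trans (cabs_le_ReIm _))//.
set s := Re h in Es es1 es2 *; set t := Im h in St Ct *.
have -> : Re (cexp h - 1 - h) = (expR s - 1 - s) + expR s * (cos t - 1).
  by rewrite /cexp !ReD !ReN ReM /= -/s -/t; ring.
have -> : Im (cexp h - 1 - h) = expR s * (sin t - t) + (expR s - 1) * t.
  by rewrite /cexp !ImD !ImN ImM /= -/s -/t; ring.
have sh : `|s| <= cabs h by exact: cabs_Re.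
have th : `|t| <= cabs h by exact: cabs_Im.
have e2 : expR s <= 2.
  by move: es2; rewrite ler_norml => /andP[_ es]; lra.
have e0' : 0 <= expR s by exact: expR_ge0.
have b1 : `|expR s * (cos t - 1)| <= 2 * (k * `|t|).
  by rewrite normrM (ger0_norm e0') ler_pM.
have b2 : `|expR s * (sin t - t)| <= 2 * (k * `|t|).
  by rewrite normrM (ger0_norm e0') ler_pM.
have b3 : `|(expR s - 1) * t| <= k * `|t| by rewrite normrM ler_wpM2r.
have c1 := ler_normD (expR s - 1 - s) (expR s * (cos t - 1)).
have c2 := ler_normD (expR s * (sin t - t)) ((expR s - 1) * t).
have k1 : k * `|s| <= k * cabs h by rewrite ler_pM2l.
have k2 : k * `|t| <= k * cabs h by rewrite ler_pM2l.
have -> : e = 6 * k by rewrite /k mulrC divfK.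
rewrite -mulrA.
set A := `|_ + _ * (_ - 1)| in c1 *; set B := `|_ + _ * t| in c2 *.
clear - c1 c2 b1 b2 b3 Es k1 k2; lra.
Qed.

End ComplexExponential.

(* Caratheodory's form of complex differentiability makes products and
   compositions algebraic. *)
Section Caratheodory.
Variable R : realType.
Local Notation C := R[i].
Implicit Types (f g : C -> C) (p : C).

Definition caratheodory f p c := exists q : C -> C,
  [/\ {for p, continuous q}, q p = c & forall z, f z = f p + q z * (z - p)].

Lemma cdiff_caratheodory f p c :
  (forall e : R, 0 < e -> exists2 r : R, 0 < r & forall z, cabs (z - p) < r ->
    cabs (f z - f p - c * (z - p)) <= e * cabs (z - p)) -> caratheodory f p c.
Proof.
move=> cP; exists (fun z => if z == p then c else (f z - f p) / (z - p)).
split; last 2 first.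
- by rewrite eqxx.
- move=> z; case: eqVneq => [->|zp]; first by rewrite subrr mulr0 addr0.
  by rewrite divfK ?subr_eq0// addrC subrK.
rewrite /prop_for /continuous_at eqxx; apply/(@cabs_cvgP _ _ (nbhs p)) => e e0.
have e2 : 0 < e / 2 by rewrite divr_gt0.
have [r r0 rP] := cP _ e2; apply/nbhs_cabsP; exists r => // z zp.
case: eqVneq => [_|nzp]; first by rewrite subrr cabs0.
have nz : 0 < cabs (z - p).
  rewrite lt_neqAle cabs_ge0 andbT eq_sym; apply/eqP => /cabs_eq0/eqP.
  by rewrite subr_eq0; exact/negP.
rewrite -(@ltr_pM2r _ (cabs (z - p)))// -cabsM mulrBl divfK ?subr_eq0//.
by rewrite (le_lt_trans (rP _ zp))// ltr_pM2r// ltr_pdivrMr// mulr_natr mulr2n ltrDl.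
Qed.

Lemma caratheodory_bound f p c : caratheodory f p c ->
  forall e : R, 0 < e -> exists2 r : R, 0 < r & forall z, cabs (z - p) < r ->
    cabs (f z - f p - c * (z - p)) <= e * cabs (z - p).
Proof.
move=> [q [cq <- fq]] e e0.
have /(@cabs_cvgP _ _ (nbhs p))/(_ e e0)/nbhs_cabsP[r r0 rP] := cq.
exists r => // z /rP qe.
rewrite (fq z) (_ : _ - _ = (q z - q p) * (z - p)) ?cabsM; last by ring.
by rewrite ler_wpM2r ?cabs_ge0// ltW.
Qed.

Lemma caratheodory_cdiff f p c : caratheodory f p c -> cdiff f p.
Proof. by move=> fc; exists c; exact: caratheodory_bound. Qed.

Lemma caratheodory_continuous f p c : caratheodory f p c -> {for p, continuous f}.
Proof.
move=> [q [cq _ fq]]; rewrite /prop_for /continuous_at (_ : f = fun z => f p + q z * (z - p));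
  last by apply/funext.
have cid : {for p, continuous (fun z : C => z - p)}.
  exact: (ccontinuousB_at (@ccontinuous_id R p) (@ccontinuous_cst R C p p)).
have ck := @ccontinuous_cst R C (f p) p.
exact: (ccontinuousD_at ck (ccontinuousM_at cq cid)).
Qed.

Lemma caratheodoryM f g p a b : caratheodory f p a -> caratheodory g p b ->
  caratheodory (fun z => f z * g z) p (a * g p + f p * b).
Proof.
move=> cf cg; have cgp := caratheodory_continuous cg.
have [q [cq <- fq]] := cf; have [r [cr <- gr]] := cg.
exists (fun z => q z * g z + f p * r z); split.
- have ck := @ccontinuous_cst R C (f p) p.
  exact: (ccontinuousD_at (ccontinuousM_at cq cgp) (ccontinuousM_at ck cr)).
- reflexivity.
- by move=> z; rewrite {1}(fq z) mulrDl {1}(gr z); ring.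
Qed.

Lemma caratheodory_comp f g p a b : caratheodory g p b -> caratheodory f (g p) a ->
  caratheodory (fun z => f (g z)) p (a * b).
Proof.
move=> cg; have cgp := caratheodory_continuous cg.
have [r [cr <- gr]] := cg; move=> [q [cq <- fq]].
exists (fun z => q (g z) * r z); split.
- exact: (ccontinuousM_at (continuous_comp cgp cq) cr).
- reflexivity.
- by move=> z; rewrite (fq (g z)) {2}(gr z) [_ + _ - _]addrAC subrr add0r mulrA.
Qed.

Lemma caratheodoryN p : caratheodory (fun z => - z) p (-1).
Proof.
exists (fun _ : C => -1); split.
- exact: (@ccontinuous_cst R C (-1) p).
- reflexivity.
- by move=> z; ring.
Qed.

Lemma caratheodory_cexp p : caratheodory (@cexp R) p (cexp p).
Proof.
apply: cdiff_caratheodory => e e0.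
pose k := e / expR (Re p).
have k0 : 0 < k by rewrite divr_gt0// expR_gt0.
have [r r0 rP] := cexp_taylor1 k0; exists r => // z /rP.
have -> : cexp z - cexp p - cexp p * (z - p) = cexp p * (cexp (z - p) - 1 - (z - p)).
  by rewrite -[z in cexp z](subrK p) addrC cexpD; ring.
rewrite cabsM cabs_cexp => h; rewrite mulrC -ler_pdivlMr ?expR_gt0//.
by rewrite (le_trans h)// /k; rewrite mulrAC.
Qed.

Lemma continuous_cexp : continuous (@cexp R).
Proof. by move=> p; apply: caratheodory_continuous; exact: caratheodory_cexp. Qed.

(** Stated at any parameter [p] of the line, not only at 0, so that it can be composed with [cexp]
    in Cauchy's formula. *)
Lemma derivable_caratheodory (V : normedModType C) (G : V -> C) (x v : V) p :
  derivable G (x + p *: v) v ->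
  caratheodory (fun z => G (x + z *: v)) p ('D_v G (x + p *: v)).
Proof.
move=> dG; apply: cdiff_caratheodory => e e0; set l := 'D_v G _; set y := x + _ in dG l *.
have /cabs_cvgP/(_ e e0)/nbhs_cabsP[r r0 Hr] :
  (fun h : C => h^-1 *: ((G \o shift y) (h *: v) - G y)) @ 0^' --> l by exact: dG.
exists r => // z; have -> : x + z *: v = y + (z - p) *: v.
  by rewrite /y -addrA -scalerDl [p + _]addrC subrK.
move: (z - p) => h hr; have [->|h0] := eqVneq h 0.
  by rewrite scale0r addr0 subrr mulr0 subr0 cabs0 mulr0.
have := Hr h; rewrite subr0 => /(_ hr h0)/ltW/=; rewrite -(@ler_pM2r _ (cabs h)); last first.
  rewrite lt_neqAle cabs_ge0 andbT eq_sym; apply/eqP => /cabs_eq0/eqP.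
  by apply/negP.
by rewrite -cabsM mulrBl /GRing.scale/= mulrAC mulVf// mul1r [_ *: v + y]addrC.
Qed.

Lemma caratheodory_derivable (V : normedModType C) (G : V -> C) (x v : V) l :
  caratheodory (fun z => G (x + z *: v)) 0 l -> derivable G x v /\ 'D_v G x = l.
Proof.
move=> [q [cq <- Gq]].
have ql : (fun h : C => h^-1 *: ((G \o shift x) (h *: v) - G x)) @ 0^' --> q 0.
  have q0 : q @ 0^' --> q 0 by apply: cvg_within_filter; exact: cq.
  apply: cvg_trans q0; apply: near_eq_cvg; near=> h.
  have h0 : h != 0 by near: h; exact: nbhs_dnbhs_neq.
  rewrite /= [h *: v + x]addrC Gq scale0r addr0 subr0 addrAC subrr add0r.
  by rewrite /GRing.scale /= mulrCA mulVf// mulr1.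
by split; [apply/cvg_ex; exists (q 0)|exact: cvg_lim].
Unshelve. all: by end_near. Qed.

Lemma derivable_bound (V : normedModType C) (G : V -> C) (y v : V) (e : R) :
  derivable G y v -> 0 < e -> exists2 r : R, 0 < r & forall h : C, cabs h < r ->
    cabs (G (y + h *: v) - G y - 'D_v G y * h) <= e * cabs h.
Proof.
move=> dG e0; have := @derivable_caratheodory V G y v 0.
rewrite scale0r addr0 => /(_ dG)/caratheodory_bound/(_ e e0)[r r0 rP].
by exists r => // h; have := rP h; rewrite subr0 scale0r addr0.
Qed.

Lemma derivable_of_bound (V : normedModType C) (G : V -> C) (y v : V) l :
  (forall e : R, 0 < e -> exists2 r : R, 0 < r & forall h : C, cabs h < r ->
    cabs (G (y + h *: v) - G y - l * h) <= e * cabs h) ->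
  derivable G y v /\ 'D_v G y = l.
Proof.
move=> H; apply: caratheodory_derivable; apply: cdiff_caratheodory => e /H[r r0 rP].
by exists r => // h; rewrite subr0 scale0r addr0; exact: rP.
Qed.

End Caratheodory.

(** * Cauchy's formula for a directional derivative *)

Section CauchyFormula.
Variable R : realType.
Local Notation C := R[i].

Definition cis (s : R) : C := cos s +i* sin s.

Lemma cabs_cis s : cabs (cis s) = 1.
Proof. by rewrite /Normc.normc /cis cos2Dsin2 sqrtr1. Qed.

Lemma cis_conjc s : cis s * conjc (cis s) = 1.
Proof.
apply/eqP; rewrite eq_complex ReM ImM /=; apply/andP; split; apply/eqP.
  by rewrite mulrN opprK -!expr2 cos2Dsin2.
by ring.
Qed.

Lemma cexp_cis (x y : R) : cexp (x +i* y) = (expR x)%:C * cis y.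
Proof. by []. Qed.

Lemma cexpN (z : C) : cexp (- z) = (cexp z)^-1.
Proof.
have zz : cexp z * cexp (- z) = 1 by rewrite -cexpD subrr cexp0.
have z0 : cexp z != 0 by apply/eqP => z0; move: zz; rewrite z0 mul0r => /esym/eqP; rewrite oner_eq0.
by apply: (mulfI z0); rewrite zz mulfV.
Qed.

Lemma continuous_cis : continuous cis.
Proof. by move=> s; apply: (@cvg_complex _ _ (nbhs s)); [exact: continuous_cos|exact: continuous_sin]. Qed.

Lemma continuous_cis_conjc : continuous (fun s => conjc (cis s)).
Proof. by move=> s; apply: continuous_comp; [exact: continuous_cis|exact: continuous_conjc]. Qed.

Lemma itv_integral_cis_conjc : itv_integral 0 (2 * pi) (fun s => conjc (cis s)) = 0.
Proof.
rewrite (@itv_integral_derive _ _ _ (fun s => sin s +i* cos s))//.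
- rewrite mulr_natl -[pi *+ 2]add0r sinD2pi cosD2pi subrr//.
- by rewrite mulr_ge0// pi_ge0.
- by move=> t; split; [exact: is_derive_sin|exact: is_derive_cos].
- exact: continuous_cis_conjc.
Qed.

(* In the coordinate [log], the annulus between radii [rho] and [1] is a
   rectangle whose horizontal sides cancel by periodicity, so Goursat's theorem
   moves the integral to radius [rho -> 0]. *)
Lemma Cauchy_derive (V : normedModType C) (G : V -> C) (x v : V) :
  (forall y, derivable G y v) ->
  (2 * pi)%:C * 'D_v G x =
  itv_integral 0 (2 * pi) (fun s => G (x + cis s *: v) * conjc (cis s)).
Proof.
move=> dG; pose p2 : R := 2 * pi.
have p20 : 0 < p2 by rewrite mulr_gt0// pi_gt0.
(* With [zeta = exp z] this is [G (x + zeta v) / zeta], which is Cauchy's integrand [G / zeta^2]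
   times the factor [zeta] from [d zeta = zeta dz]. *)
pose h (z : C) := G (x + cexp z *: v) * cexp (- z).
have [h' hc] : exists h', forall p, caratheodory h p (h' p).
  eexists => p; apply: caratheodoryM.
    apply: (@caratheodory_comp _ (fun z => G (x + z *: v))); first exact: caratheodory_cexp.
    exact: derivable_caratheodory.
  by apply: (@caratheodory_comp _ (@cexp R)); [exact: caratheodoryN|exact: caratheodory_cexp].
have ch : continuous h by move=> p; exact: (caratheodory_continuous (hc p)).
have hper (s y : R) : h (s +i* (y + p2)) = h (s +i* y).
  by rewrite /h !cexpN cexp_period.
pose I X := itv_integral 0 p2 (fun s => h (X +i* s)).
have IE X : X <= 0 -> I X = I 0.
  move=> X0; have NX0 : 0 <= - X by rewrite oppr_ge0.
  have := @Goursat R h X 0 (- X) p2 (fun p => caratheodory_cdiff (hc p)) ch NX0 (ltW p20).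
  rewrite /rect_integral (@eq_itv_integral _ X _ _ (fun=> 0)); last first.
    by move=> s _; rewrite hper subrr.
  have -> : itv_integral X (X - X) (fun=> 0) = 0 :> C.
    by rewrite itv_integral_cst ?mul0r// lerDl.
  rewrite add0r [X in itv_integral _ X _]add0r subrr => iH.
  have i0 : 'i != 0 :> C by rewrite eq_complex /= oner_eq0 andbF.
  have H : itv_integral 0 p2 (fun s => h (0 +i* s) - h (X +i* s)) = 0.
    by apply: (mulfI i0); rewrite iH mulr0.
  apply/esym/subr0_eq; rewrite -[RHS]H /I -itv_integralB//; exact: continuous_vline.
have I0E : I 0 = itv_integral 0 p2 (fun s => G (x + cis s *: v) * conjc (cis s)).
  apply: eq_itv_integral => s _; rewrite /h cexpN cexp_cis expR0 mul1r; congr (_ * _).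
  by rewrite -[LHS]mulr1 -(cis_conjc s) mulrA mulVf ?mul1r//;
     apply/eqP => c0; move: (cis_conjc s); rewrite c0 mul0r => /esym/eqP; rewrite oner_eq0.
rewrite -/p2 -I0E; set D := 'D_v G x.
suff bnd e : 0 < e -> cabs (I 0 - p2%:C * D) <= 2 * e * p2.
  apply/esym/eqP; rewrite -subr_eq0; apply/eqP/cabs_eq0/eqP; rewrite eq_le cabs_ge0 andbT.
  apply/ler_addgt0Pr => e e0; rewrite add0r.
  have e2 : 0 < e / (2 * p2) by apply: divr_gt0 => //; apply: mulr_gt0.
  have aux (u : R) : u != 0 -> 2 * (e / (2 * u)) * u = e by move=> u0; field.
  by have := bnd _ e2; rewrite aux// gt_eqF.
move=> e0; have [r r0 rP] := derivable_bound (dG x) e0.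
(* The bound 1 makes [X = ln rho] nonpositive, so the rectangle from [X] to 0 has a width
   [- X >= 0]; the bound [r / 2] puts the circle in the disc where [rP] applies. *)
pose rho := Num.min 1 (r / 2).
have rho0 : 0 < rho by rewrite lt_min ltr01 divr_gt0.
have rhor : rho < r by rewrite gt_min [r / 2 < r]ltr_pdivrMr// mulr_natr mulr2n ltrDl r0 orbT.
have [X X0 XE] : exists2 X, X <= 0 & expR X = rho.
  by exists (ln rho); [rewrite ln_le0// ge_min lexx|rewrite lnK// posrE].
pose c := G x * (rho%:C)^-1.
(* On the small circle [h] is [G x / zeta + D] up to [e]. The first term integrates to 0 over a full
   turn and the second gives [2 pi D]. *)
pose err s := h (X +i* s) - c * conjc (cis s) - D.
have cerr : continuous err.
  apply: ccontinuousB; last exact: ccontinuous_cst.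
  apply: ccontinuousB; first exact: continuous_vline.
  apply: ccontinuousM; [exact: ccontinuous_cst|exact: continuous_cis_conjc].
have rhoc0 : rho%:C != 0 :> C by rewrite eq_complex /= eqxx andbT gt_eqF.
have errE s : cabs (err s) <= e.
  have zE : cexp (X +i* s) = rho%:C * cis s by rewrite cexp_cis XE.
  have cz : cabs (rho%:C * cis s) = rho by rewrite cabsM cabs_real cabs_cis mulr1 gtr0_norm.
  set w := rho%:C * cis s in zE cz.
  have w0 : 0 < cabs w by rewrite cz.
  have wn0 : w != 0 by apply/eqP => wE; move: w0; rewrite wE cabs0 ltxx.
  rewrite -(ler_pM2r w0) -cabsM /err /h cexpN zE.
  have -> : (G (x + w *: v) / w - c * conjc (cis s) - D) * w = G (x + w *: v) - G x - D * w.
    rewrite !mulrBl divfK//; congr (_ - _ - _).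
    by rewrite /c /w mulrACA [conjc _ * _]mulrC cis_conjc mulr1 divfK.
  by apply: rP; rewrite cz.
have -> : I 0 - p2%:C * D = itv_integral 0 p2 err.
  have ck := ccontinuousM (@ccontinuous_cst R R c) continuous_cis_conjc.
  have chk := ccontinuousB (continuous_vline (x := X) ch) ck.
  rewrite -(IE X X0) /err (itv_integralB _ _ chk (@ccontinuous_cst R R D)).
  rewrite (itv_integralB _ _ (continuous_vline (x := X) ch) ck).
  rewrite (itv_integralZ _ _ c continuous_cis_conjc) itv_integral_cis_conjc mulr0 subr0.
  by rewrite itv_integral_cst ?ltW// subr0 [D * _]mulrC.
have := @itv_integral_le _ 0 p2 err e (ltW p20) cerr; rewrite subr0; apply => s _; exact: errE.
Qed.

End CauchyFormula.

(** * Holomorphic functions on normed spaces *)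

Section ParametricIntegral.
Variables (R : realType) (V : normedModType R[i]) (a b : R).
Hypothesis ab : a <= b.
Local Notation C := R[i].
Implicit Types (Phi : R -> V -> C) (x u v : V).

Definition param_integral Phi x : C := itv_integral a b (fun s => Phi s x).

Lemma continuous_slice Phi x : continuous (fun p : R * V => Phi p.1 p.2) ->
  continuous (fun s => Phi s x).
Proof.
move=> cP s; apply: (continuous_comp (f := fun s : R => (s, x)) (g := fun p : R * V => Phi p.1 p.2)).
  by apply: (@cvg_pair _ _ _ (nbhs s) (nbhs s) (nbhs x)); [exact: cvg_id|exact: cvg_cst].
exact: cP.
Qed.

(** Compactness of [[a, b]] makes the continuity in the second variable uniform in the first. *)
Lemma uniform_slice Phi x (e : R) : continuous (fun p : R * V => Phi p.1 p.2) -> 0 < e ->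
  \forall y \near x, forall s, a <= s <= b -> cabs (Phi s y - Phi s x) < e.
Proof.
move=> cP e0; have /compact_near_coveringP seg := @segment_compact R a b.
have := seg V (nbhs x) (fun y s => cabs (Phi s y - Phi s x) < e) _.
suff H (s : R) : \forall s' \near s & y \near x, cabs (Phi s' y - Phi s' x) < e.
  move=> /(_ (nbhs_filter x) (fun s _ => H s)).
  by apply: filterS => y yP s sab; apply: yP; rewrite /= in_itv.
have e2 : 0 < e / 2 by rewrite divr_gt0.
have /(@cabs_cvgP _ _ (nbhs (s, x)))/(_ _ e2) H1 := cP (s, x).
have cx := continuous_slice (x := x) cP.
have /(@cabs_cvgP _ _ (nbhs s))/(_ _ e2) H2 := cx s.
have {}H2 : \forall p \near (s, x), cabs (Phi p.1 x - Phi s x) < e / 2.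
  by exists ([set s' | cabs (Phi s' x - Phi s x) < e / 2], setT) => //=;
     [split => //; exact: filterT|case=> s' y /= []].
apply: filterS2 H1 H2 => -[s' y] /= h1 h2.
rewrite (_ : _ - _ = (Phi s' y - Phi s x) - (Phi s' x - Phi s x)); last by ring.
by rewrite (le_lt_trans (cabsB _ _))// (splitr e) ltrD.
Qed.

Lemma param_integral_continuous Phi :
  continuous (fun p : R * V => Phi p.1 p.2) -> continuous (param_integral Phi).
Proof.
move=> cP x; apply/(@cabs_cvgP _ _ (nbhs x)) => e e0.
pose k := e / (2 * (b - a) + 1).
have D0 : 0 < 2 * (b - a) + 1 by rewrite ltr_wpDl// mulr_ge0// subr_ge0.
have k0 : 0 < k by rewrite divr_gt0.
have := uniform_slice x cP k0; apply: filterS => y yP.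
have cy := continuous_slice (x := y) cP; have cx := continuous_slice (x := x) cP.
rewrite /param_integral -(itv_integralB _ _ cy cx).
apply: (@le_lt_trans _ _ (2 * k * (b - a))).
  by apply: (itv_integral_le ab (ccontinuousB cy cx)) => s /yP/ltW.
rewrite /k mulrAC mulrA ltr_pdivrMr// mulrC ltr_pM2l//.
by rewrite ltrDl.
Qed.

Lemma derive_scale (G : V -> C) x u (h : C) : derivable G x u ->
  derivable G x (h *: u) /\ 'D_(h *: u) G x = h * 'D_u G x.
Proof.
move=> dG; apply: derivable_of_bound => e e0.
pose k := e / (cabs h + 1).
have h1 : 0 < cabs h + 1 by rewrite ltr_wpDl// cabs_ge0.
have k0 : 0 < k by rewrite divr_gt0.
have [r r0 rP] := derivable_bound dG k0.
exists (r / (cabs h + 1)); first by rewrite divr_gt0.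
move=> w; rewrite ltr_pdivlMr// => wr.
have wh : cabs w * cabs h <= cabs w * (cabs h + 1) by rewrite ler_wpM2l ?cabs_ge0// lerDl.
have := rP (w * h); rewrite cabsM => /(_ (le_lt_trans wh wr)).
rewrite scalerA (_ : h * 'D_u G x * w = 'D_u G x * (w * h)); last by ring.
move=> H; apply: (le_trans H).
apply: (le_trans (ler_wpM2l (ltW k0) wh)).
by rewrite /k mulrCA divfK ?gt_eqF// mulrC.
Qed.

(** Near [x] the derivative of every slice varies by less than [k], uniformly in [s], so the mean
    value estimate on the segment from [x] to [x + h u] gives an error [2 k |h|] per slice.
    Integration doubles it, whence the 4 in [k]. *)
Lemma param_integral_derive Phi u :
  continuous (fun p : R * V => Phi p.1 p.2) ->
  (forall s x, derivable (Phi s) x u) ->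
  continuous (fun p : R * V => 'D_u (Phi p.1) p.2) ->
  forall x, derivable (param_integral Phi) x u /\
    'D_u (param_integral Phi) x = itv_integral a b (fun s => 'D_u (Phi s) x).
Proof.
move=> cP dP cD x; apply: derivable_of_bound => e e0.
pose k := e / (4 * (b - a) + 1).
have D0 : 0 < 4 * (b - a) + 1 by rewrite ltr_wpDl// mulr_ge0// subr_ge0.
have k0 : 0 < k by rewrite divr_gt0.
have /nbhs_normedP[r r0 rP] := @uniform_slice (fun s => 'D_u (Phi s)) x k cD k0.
have nu : 0 <= Re `|u| by have := normr_ge0 u; rewrite lecE => /andP[].
have u1 : 0 < Re `|u| + 1 by rewrite ltr_wpDl.
exists (r / (Re `|u| + 1)); first by rewrite divr_gt0.
move=> h; rewrite ltr_pdivlMr// => hr.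
have sc s (t : R) : 0 <= t <= 1 -> a <= s <= b ->
    cabs ('D_u (Phi s) (x + t%:C *: (h *: u)) - 'D_u (Phi s) x) < k.
  move=> /andP[t0 t1] sab; apply: rP => //; rewrite [x + _]addrC addrK scalerA normrZ.
  rewrite normr_cabs cabsM cabs_real ger0_norm// ReM /= mul0r subr0.
  apply: le_lt_trans hr; rewrite -mulrA -[leRHS]mul1r ler_pM//.
    by rewrite mulr_ge0// cabs_ge0.
  by rewrite ler_wpM2l ?cabs_ge0// lerDl.
have cy y := continuous_slice (x := y) cP; have cDx := @continuous_slice (fun s => 'D_u (Phi s)) x cD.
have E : param_integral Phi (x + h *: u) - param_integral Phi x
    - itv_integral a b (fun s => 'D_u (Phi s) x) * h =
    itv_integral a b (fun s => Phi s (x + h *: u) - Phi s x - h * 'D_u (Phi s) x).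
  have ch := ccontinuousM (@ccontinuous_cst R R h) cDx.
  rewrite (itv_integralB _ _ (ccontinuousB (cy (x + h *: u)) (cy x)) ch).
  by rewrite (itv_integralB _ _ (cy (x + h *: u)) (cy x)) (itv_integralZ _ _ h cDx) [h * _]mulrC.
rewrite E.
apply: (@le_trans _ _ (2 * (2 * (k * cabs h)) * (b - a))); last first.
  rewrite (_ : _ * (b - a) = (4 * (b - a)) * k * cabs h); last by ring.
  rewrite ler_wpM2r ?cabs_ge0// /k mulrA ler_pdivrMr// mulrC ler_wpM2l ?ltW//.
  by rewrite ltrDl.
have ch := ccontinuousM (@ccontinuous_cst R R h) cDx.
apply: (itv_integral_le ab (ccontinuousB (ccontinuousB (cy (x + h *: u)) (cy x)) ch)) => s sab.
pose f (t : R) := Phi s (x + t%:C *: (h *: u)).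
pose f' (t : R) := h * 'D_u (Phi s) (x + t%:C *: (h *: u)).
have ff' t : path_derive f t (f' t).
  have [d1 d2] := derive_scale h (dP s (x + t%:C *: (h *: u))).
  by rewrite /f' -d2; exact: path_derive_line.
have := @path_mean_value R f f' (h * 'D_u (Phi s) x) (k * cabs h) ff'.
rewrite /f scale1r scale0r addr0; apply => t t01.
by rewrite /f' -mulrBr cabsM mulrC ler_wpM2r ?cabs_ge0// ltW// sc.
Qed.

End ParametricIntegral.

(** * Stability of holomorphy under differentiation *)

Section Holomorphic.
Variable R : realType.
Local Notation C := R[i].

(* Continuity, complex derivability along every line, and linearity of the
   derivative in the direction: by Cauchy's formula all three pass to the
   directional derivatives. *)
Definition hol (V : normedModType C) (G : V -> C) :=
  [/\ continuous G, forall x v, derivable G x v &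
      forall x (k : C) u v, 'D_(k *: u + v) G x = k * 'D_u G x + 'D_v G x].

Section Closure.
Variable V : normedModType C.
Implicit Types (G H : V -> C) (x u v : V).

Lemma entire_hol G : entire G -> hol G.
Proof.
move=> eG; split.
- by move=> x; exact: differentiable_continuous.
- by move=> x v; exact: diff_derivable.
- move=> x k u v; rewrite !deriveE//; exact: linearP.
Qed.

Lemma hol_continuous G : hol G -> continuous G. Proof. by case. Qed.
Lemma hol_derivable G : hol G -> forall x v, derivable G x v. Proof. by case. Qed.
Arguments hol_derivable {G} hG x v : rename.

Lemma derive_cauchy G v x : hol G -> 'D_v G x =
  ((2 * pi)%:C)^-1 * param_integral 0 (2 * pi)
    (fun s y => G (y + cis s *: v) * conjc (cis s)) x.
Proof.
move=> [_ dG _]; rewrite /param_integral -Cauchy_derive// mulKf//.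
by rewrite eq_complex /= eqxx andbT mulf_neq0// gt_eqF// pi_gt0.
Qed.

Let twopi0 : 0 <= 2 * pi :> R. Proof. by rewrite mulr_ge0// pi_ge0. Qed.

Let continuous_shift (f : V -> C) v : continuous f ->
  continuous (fun p : R * V => f (p.2 + cis p.1 *: v) * conjc (cis p.1)).
Proof.
move=> cf; apply: ccontinuousM; last first.
  by move=> p; apply: (continuous_comp (f := fst) (g := fun s => conjc (cis s)));
    [exact: cvg_fst|exact: continuous_cis_conjc].
move=> p; apply: (continuous_comp (f := fun p : R * V => p.2 + cis p.1 *: v)); last exact: cf.
apply: cvgD; first exact: cvg_snd.
apply: cvgZr_tmp; apply: (continuous_comp (f := fst)); [exact: cvg_fst|exact: continuous_cis].
Qed.

Lemma hol_derive_continuous G v : hol G -> continuous ('D_v G).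
Proof.
move=> hG; rewrite (_ : 'D_v G = fun x => ((2 * pi)%:C)^-1 * param_integral 0 (2 * pi)
    (fun s y => G (y + cis s *: v) * conjc (cis s)) x); last first.
  by apply/funext => x; exact: derive_cauchy.
apply: ccontinuousM; first exact: ccontinuous_cst.
apply: param_integral_continuous => //; apply: continuous_shift; exact: hol_continuous.
Qed.

Lemma derive_shift_scale G x w (k : C) u : derivable G (x + w) u ->
  derivable (fun y => G (y + w) * k) x u /\
  'D_u (fun y => G (y + w) * k) x = 'D_u G (x + w) * k.
Proof.
move=> dG; apply: caratheodory_derivable.
rewrite -[X in caratheodory _ _ X]addr0 -[0 in X in caratheodory _ _ X](mulr0 (G (x + 0 *: u + w))).
apply: caratheodoryM.
  have := @derivable_caratheodory _ V G (x + w) u 0.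
  rewrite scale0r addr0 => /(_ dG); congr caratheodory.
  by apply/funext => z; rewrite addrAC.
exists (fun=> 0); split; [exact: ccontinuous_cst|reflexivity|].
by move=> z; rewrite mul0r addr0.
Qed.

Lemma deriveM_at G H x u : derivable G x u -> derivable H x u ->
  derivable (fun y => G y * H y) x u /\
  'D_u (fun y => G y * H y) x = 'D_u G x * H x + G x * 'D_u H x.
Proof.
move=> dG dH; apply: caratheodory_derivable.
have := @derivable_caratheodory _ V G x u 0; have := @derivable_caratheodory _ V H x u 0.
rewrite scale0r addr0 => /(_ dH) cH /(_ dG) cG.
by have := caratheodoryM cG cH; rewrite scale0r addr0.
Qed.

Lemma derive_cexp_at G x u : derivable G x u ->
  derivable (fun y => cexp (G y)) x u /\ 'D_u (fun y => cexp (G y)) x = cexp (G x) * 'D_u G x.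
Proof.
move=> dG; apply: caratheodory_derivable.
have := @derivable_caratheodory _ V G x u 0; rewrite scale0r addr0 => /(_ dG) cG.
have := @caratheodory_comp _ (@cexp R) _ _ _ _ cG; rewrite scale0r addr0; apply.
exact: caratheodory_cexp.
Qed.

Lemma derive_cst_at (k : C) x u :
  derivable (fun _ : V => k) x u /\ 'D_u (fun _ : V => k) x = 0.
Proof.
apply: caratheodory_derivable; exists (fun=> 0).
split; [exact: ccontinuous_cst|reflexivity|].
by move=> z; rewrite mul0r addr0.
Qed.

Lemma hol_cst (k : C) : hol (fun _ : V => k).
Proof.
split; first exact: ccontinuous_cst.
  by move=> x v; case: (derive_cst_at k x v).
move=> x c u v; have D w := (derive_cst_at k x w).2.
by rewrite (D (c *: u + v)) (D u) (D v) mulr0 addr0.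
Qed.

Lemma holM G H : hol G -> hol H -> hol (fun y => G y * H y).
Proof.
move=> [cG dG lG] [cH dH lH]; split; first exact: (ccontinuousM cG cH).
  by move=> x v; case: (deriveM_at (dG x v) (dH x v)).
move=> x k u v; have D w := (deriveM_at (dG x w) (dH x w)).2.
rewrite (D (k *: u + v)) (D u) (D v) lG lH.
by move: (G x) (H x) ('D_u G x) ('D_v G x) ('D_u H x) ('D_v H x) => *; ring.
Qed.

Lemma hol_cexp G : hol G -> hol (fun y => cexp (G y)).
Proof.
move=> [cG dG lG]; split.
- by move=> x; apply: continuous_comp; [exact: cG|exact: continuous_cexp].
- by move=> x v; case: (derive_cexp_at (dG x v)).
- move=> x k u v; have D w := (derive_cexp_at (dG x w)).2.
  rewrite (D (k *: u + v)) (D u) (D v) lG.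
  by move: (cexp (G x)) ('D_u G x) ('D_v G x) => *; ring.
Qed.

Section Param.
Variables (a b : R) (Phi : R -> V -> C).
Hypothesis ab : a <= b.
Hypothesis cPhi : continuous (fun p : R * V => Phi p.1 p.2).
Hypothesis hPhi : forall s, hol (Phi s).
Hypothesis cDPhi : forall u, continuous (fun p : R * V => 'D_u (Phi p.1) p.2).

Lemma derive_param_integral x u : 'D_u (param_integral a b Phi) x =
  param_integral a b (fun s => 'D_u (Phi s)) x.
Proof.
have dP s y := hol_derivable (hPhi s) y u.
by have [_ ->] := @param_integral_derive R V a b ab Phi u cPhi dP (@cDPhi u) x.
Qed.

Lemma hol_param_integral : hol (param_integral a b Phi).
Proof.
split; first exact: param_integral_continuous.
  move=> x u; have dP s y := hol_derivable (hPhi s) y u.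
  by have [] := @param_integral_derive R V a b ab Phi u cPhi dP (@cDPhi u) x.
move=> x k u v; rewrite !derive_param_integral /param_integral.
have cu := @continuous_slice R V (fun s => 'D_u (Phi s)) x (@cDPhi u).
have cv := @continuous_slice R V (fun s => 'D_v (Phi s)) x (@cDPhi v).
rewrite -(itv_integralZ _ _ k cu) -(itv_integralD _ _ (ccontinuousM (@ccontinuous_cst R R k) cu) cv).
by apply: eq_itv_integral => s _; case: (hPhi s) => _ _ ->.
Qed.

End Param.

Lemma hol_shift_scale G w (k : C) : hol G -> hol (fun y => G (y + w) * k).
Proof.
move=> [cG dG lG]; split.
- apply: ccontinuousM; last exact: ccontinuous_cst.
  move=> x; apply: continuous_comp; last exact: cG.
  by apply: cvgD; [exact: cvg_id|exact: cvg_cst].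
- by move=> x v; case: (derive_shift_scale k (dG (x + w) v)).
- move=> x c u v; have D t := (derive_shift_scale k (dG (x + w) t)).2.
  rewrite (D (c *: u + v)) (D u) (D v) lG.
  by move: ('D_u G _) ('D_v G _) => *; ring.
Qed.

Let Psi G v (s : R) (y : V) : C := G (y + cis s *: v) * conjc (cis s).

Let DPsi G u v : hol G -> (fun p : R * V => 'D_u (Psi G v p.1) p.2) =
  (fun p => 'D_u G (p.2 + cis p.1 *: v) * conjc (cis p.1)).
Proof.
move=> hG; apply/funext => -[s y].
exact: (derive_shift_scale _ (hol_derivable hG _ _)).2.
Qed.

Let cPsi G v : hol G -> continuous (fun p : R * V => Psi G v p.1 p.2).
Proof. by move=> hG; exact: continuous_shift (hol_continuous hG). Qed.

Let hPsi G v : hol G -> forall s, hol (Psi G v s).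
Proof. by move=> hG s; exact: hol_shift_scale. Qed.

Let cDPsi G v : hol G -> forall u, continuous (fun p : R * V => 'D_u (Psi G v p.1) p.2).
Proof. by move=> hG u; rewrite DPsi//; exact: continuous_shift (hol_derive_continuous hG). Qed.

Let derive_cauchy_fun G v : hol G -> 'D_v G = (fun x => ((2 * pi)%:C)^-1 *
  param_integral 0 (2 * pi) (Psi G v) x).
Proof. by move=> hG; apply/funext => x; exact: derive_cauchy. Qed.

Lemma hol_derive G v : hol G -> hol ('D_v G).
Proof.
move=> hG; rewrite (@derive_cauchy_fun G v hG); apply: holM; first exact: hol_cst.
apply: (hol_param_integral twopi0 (@cPsi G v hG) (@hPsi G v hG) (@cDPsi G v hG)).
Qed.

(** Differentiating Cauchy's formula for ['D_v G] along [u] under the integral gives Cauchy's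
    formula for ['D_v ('D_u G)]. *)
Lemma hol_derive_commute G u v : hol G -> 'D_u ('D_v G) = 'D_v ('D_u G).
Proof.
move=> hG; apply/funext => x.
transitivity (((2 * pi)%:C)^-1 * param_integral 0 (2 * pi)
    (fun s y => 'D_u G (y + cis s *: v) * conjc (cis s)) x); last first.
  by apply/esym/derive_cauchy; exact: hol_derive.
have hK := hol_param_integral twopi0 (@cPsi G v hG) (@hPsi G v hG) (@cDPsi G v hG).
have [d1 d2] := derive_cst_at ((2 * pi)%:C)^-1 x u.
rewrite (@derive_cauchy_fun G v hG).
have [_ ->] := deriveM_at d1 (hol_derivable hK x u).
rewrite d2 mul0r add0r; congr (_ * _).
rewrite (derive_param_integral twopi0 (@cPsi G v hG) (@hPsi G v hG) (@cDPsi G v hG)).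
apply: eq_itv_integral => s _.
by have [] := derive_shift_scale (conjc (cis s)) (hol_derivable hG (x + cis s *: v) u).
Qed.

End Closure.

Section AffineComposition.
Variables (V W : normedModType C) (A L : V -> W).
Hypothesis AL : forall x (k : C) u, A (x + k *: u) = A x + k *: L u.
Hypothesis cA : continuous A.
Hypothesis Llin : forall (k : C) u v, L (k *: u + v) = k *: L u + L v.

(** [L] is the linear part of [A]: a complex line is carried to a complex line with the same
    parameter, so both difference quotients coincide. *)
Lemma derive_affine_at (G : W -> C) x u : derivable G (A x) (L u) ->
  derivable (fun y => G (A y)) x u /\ 'D_u (fun y => G (A y)) x = 'D_(L u) G (A x).
Proof.
move=> dG; apply: caratheodory_derivable.
have := @derivable_caratheodory _ W G (A x) (L u) 0; rewrite scale0r addr0 => /(_ dG).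
by congr caratheodory; apply/funext => z; rewrite AL.
Qed.

Lemma hol_affine (G : W -> C) : hol G -> hol (fun y => G (A y)).
Proof.
move=> [cG dG lG]; split.
- by move=> x; apply: continuous_comp; [exact: cA|exact: cG].
- by move=> x u; case: (derive_affine_at (dG (A x) (L u))).
- move=> x k u v; have D w := (derive_affine_at (dG (A x) (L w))).2.
  by rewrite (D (k *: u + v)) (D u) (D v) Llin lG.
Qed.

End AffineComposition.

(** Cauchy's estimate on the unit circle, with the factor 2 of [itv_integral_le]. *)
Lemma cabs_derive_le (V : normedModType C) (G : V -> C) x v (M : R) : hol G ->
  (forall z : C, cabs z = 1 -> cabs (G (x + z *: v)) <= M) -> cabs ('D_v G x) <= 2 * M.
Proof.
move=> hG GM; have p2 : 0 < 2 * pi :> R by rewrite mulr_gt0// pi_gt0.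
rewrite derive_cauchy// cabsM cabsV cabs_real gtr0_norm// mulrC ler_pdivrMr//.
have cP : continuous (fun s : R => G (x + cis s *: v) * conjc (cis s)).
  apply: ccontinuousM; last exact: continuous_cis_conjc.
  move=> s; apply: (continuous_comp (f := fun s => x + cis s *: v)); last exact: hol_continuous.
  by apply: cvgD; [exact: cvg_cst|apply: cvgZr_tmp; exact: continuous_cis].
have := @itv_integral_le R 0 (2 * pi) _ M (ltW p2) cP; rewrite subr0; apply => s _.
by rewrite cabsM cabs_conjc cabs_cis mulr1 GM ?cabs_cis.
Qed.

End Holomorphic.

Section DirectionLinearity.
Variables (R : realType) (V : normedModType R[i]).
Local Notation C := R[i].
Implicit Types (G : V -> C) (x u v : V).

Lemma hol_derive0 G x : hol G -> 'D_0 G x = 0.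
Proof.
move=> [_ _ lG]; have := lG x 1 0 0; rewrite scaler0 addr0 mul1r => /esym/eqP.
by rewrite -subr_eq0 addrK => /eqP.
Qed.

Lemma hol_deriveZ G x (k : C) u : hol G -> 'D_(k *: u) G x = k * 'D_u G x.
Proof. by move=> hG; have [_ _ /(_ x k u 0)] := hG; rewrite addr0 hol_derive0// addr0. Qed.

Lemma hol_deriveD G x u v : hol G -> 'D_(u + v) G x = 'D_u G x + 'D_v G x.
Proof. by move=> [_ _ /(_ x 1 u v)]; rewrite scale1r mul1r. Qed.

Lemma hol_path_derive G x v (t : R) : hol G ->
  path_derive (fun s => G (x + s%:C *: v)) t ('D_v G (x + t%:C *: v)).
Proof. by move=> hG; apply: path_derive_line; exact: hol_derivable. Qed.

End DirectionLinearity.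

Local Opaque derive hol.

(** * Iterated directional derivatives *)

Section MultiDerivative.
Variables (R : realType) (V : normedModType R[i]) (I : eqType).
Local Notation C := R[i].
Implicit Types (G : V -> C) (e : I -> V) (alpha : I -> nat) (l : seq I).

(** The same fold as [multi_deriv], so that iterated Wirtinger derivatives translate one at a
    time. *)
Definition dir_derive l e alpha G : V -> C :=
  foldr (fun j H => iter (alpha j) (fun K => 'D_(e j) K) H) G l.

Lemma hol_iter_derive v n G : hol G -> hol (iter n (fun K => 'D_v K) G).
Proof. move=> hG; elim: n => [|n IH]; [exact: hG|exact: hol_derive IH]. Qed.

Lemma hol_dir_derive l e alpha G : hol G -> hol (dir_derive l e alpha G).
Proof. move=> hG; elim: l => [|j l IH]; [exact: hG|exact: hol_iter_derive IH]. Qed.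

Lemma iter_derive_commute u v n G : hol G ->
  'D_u (iter n (fun K => 'D_v K) G) = iter n (fun K => 'D_v K) ('D_u G).
Proof.
move=> hG; elim: n => [|n IH]; first reflexivity.
rewrite !iterS -IH; exact: hol_derive_commute (hol_iter_derive v n hG).
Qed.

Lemma dir_derive_commute1 u l e alpha G : hol G ->
  'D_u (dir_derive l e alpha G) = dir_derive l e alpha ('D_u G).
Proof.
move=> hG; elim: l => [|j l IH]; first reflexivity.
rewrite /dir_derive /= -/(dir_derive l e alpha _) -/(dir_derive l e alpha _) -IH.
exact: iter_derive_commute (hol_dir_derive l e alpha hG).
Qed.

Lemma dir_derive_commute l e alpha l' e' beta G : hol G ->
  dir_derive l e alpha (dir_derive l' e' beta G) =
  dir_derive l' e' beta (dir_derive l e alpha G).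
Proof.
move=> hG; elim: l => //= j l ->.
elim: (alpha j) => //= n ->; apply: dir_derive_commute1.
by apply: hol_iter_derive; apply: hol_dir_derive.
Qed.

Lemma eq_dir_derive l e alpha beta G : {in l, alpha =1 beta} ->
  dir_derive l e alpha G = dir_derive l e beta G.
Proof.
elim: l => //= j l IH ab; rewrite ab ?mem_head// IH// => i il.
by rewrite ab// in_cons il orbT.
Qed.

(** The extra derivative appears at the place of [j] inside the fold, once because [l] has no
    repetition, and is carried outwards by commutation. *)
Lemma dir_deriveS l e alpha beta j G : hol G -> uniq l -> j \in l ->
  (forall i, beta i = (i == j) + alpha i)%N ->
  dir_derive l e beta G = 'D_(e j) (dir_derive l e alpha G).
Proof.
move=> hG + + bE; elim: l => //= i l IH /andP[il ul]; rewrite in_cons => /orP[/eqP ji|jl].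
  rewrite -ji bE eqxx /= (@eq_dir_derive l e beta alpha)// => k kl.
  by rewrite bE; case: eqP => // kj; move: il; rewrite -ji -kj kl.
rewrite (IH ul jl) bE (_ : (i == j) = false); last first.
  by apply/eqP => ij; move: il; rewrite ij jl.
rewrite add0n; apply/esym; exact: iter_derive_commute (hol_dir_derive l e alpha hG).
Qed.

End MultiDerivative.

(** * Symbols as functions on C^d x C^d *)

Section Coordinates.
Variables (R : realType) (d : nat).
Local Notation C := R[i].
Local Notation Cd := 'rV[C]_d.
Local Notation V := (Cd * Cd)%type.
Implicit Types (G : V -> C) (z w u v : Cd) (j : 'I_d) (alpha : 'I_d -> nat).

Definition fst_dir j : V := (delta_mx 0 j, 0).
Definition snd_dir j : V := (0, delta_mx 0 j).
Definition conjv w : Cd := map_mx conjc w.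

Lemma conjvK w : conjv (conjv w) = w.
Proof. by apply/rowP => j; rewrite !mxE conjcK. Qed.

Lemma conjv_line w u (k : C) : conjv (w + k *: u) = conjv w + conjc k *: conjv u.
Proof. by apply/rowP => j; rewrite !mxE rmorphD rmorphM. Qed.

Lemma conjv_delta j : conjv (delta_mx 0 j) = delta_mx 0 j.
Proof. by apply/rowP => k; rewrite !mxE rmorph_nat. Qed.

Lemma real_derivE u (F : Cd -> C) z c :
  path_derive (fun t : R => F (z + t%:C *: u)) 0 c -> real_deriv u F z = c.
Proof.
move=> [fr fi]; rewrite /real_deriv !derive1E.
by rewrite (@derive_val _ _ _ _ _ _ _ fr) (@derive_val _ _ _ _ _ _ _ fi); case: c {fr fi}.
Qed.

Let half_double (x : C) : 2^-1 * (x + x) = x.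
Proof. by rewrite -mulr2n -[x *+ 2]mulr_natl mulrA mulVf ?mul1r// pnatr_eq0. Qed.

(** By complex linearity the derivative along [i e_j] is [i] times that along [e_j], so the two
    terms of the Wirtinger derivative are equal and the factor 1/2 averages them. *)
Lemma wirtingerE G v j : hol G ->
  wirtinger j (fun z => G (z, v)) = (fun z => 'D_(fst_dir j) G (z, v)).
Proof.
move=> hG; apply/funext => z.
have D u : real_deriv u (fun z => G (z, v)) z = 'D_((u, 0) : V) G (z, v).
  apply: real_derivE; have := hol_path_derive (z, v) ((u, 0) : V) 0 hG.
  rewrite scale0r addr0; congr path_derive; apply/funext => t; congr G.
  by congr pair; rewrite /= scaler0 addr0.
rewrite /wirtinger !D.
have -> : ((0 +i* 1) *: delta_mx 0 j, 0) = 'i *: fst_dir j :> V.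
  by congr pair; rewrite /= scaler0.
rewrite (hol_deriveZ _ _ _ hG) -/(fst_dir j) mulrA -expr2 sqr_i mulN1r opprK.
exact: half_double.
Qed.

(** Conjugation turns the direction [i e_j] into [- i e_j], which is why the opposite sign in
    [wirtinger_bar] makes the two terms equal. *)
Lemma wirtinger_barE G z j : hol G ->
  wirtinger_bar j (fun w => G (z, conjv w)) = (fun w => 'D_(snd_dir j) G (z, conjv w)).
Proof.
move=> hG; apply/funext => w.
have D u : real_deriv u (fun w => G (z, conjv w)) w = 'D_((0, conjv u) : V) G (z, conjv w).
  apply: real_derivE; have := hol_path_derive (z, conjv w) ((0, conjv u) : V) 0 hG.
  rewrite scale0r addr0; congr path_derive; apply/funext => t; congr G.
  by congr pair; rewrite /= ?scaler0 ?addr0// conjv_line conjc_real.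
rewrite /wirtinger_bar !D conjv_delta.
have -> : (0, conjv ((0 +i* 1) *: delta_mx 0 j)) = (- 'i) *: snd_dir j :> V.
  congr pair; rewrite /= ?scaler0//; apply/rowP => k.
  rewrite !mxE rmorphM rmorph_nat; congr (_ * _).
  by apply/eqP; rewrite eq_complex /= oppr0 !eqxx.
rewrite (hol_deriveZ _ _ _ hG) -/(snd_dir j) mulrA mulrN -expr2 sqr_i opprK mul1r.
exact: half_double.
Qed.

Lemma multi_deriv_wirtinger G v alpha : hol G ->
  multi_deriv (@wirtinger R d) alpha (fun z => G (z, v)) =
  (fun z => dir_derive (enum 'I_d) fst_dir alpha G (z, v)).
Proof.
move=> hG; rewrite /multi_deriv; elim: (enum 'I_d) => //= j l ->.
elim: (alpha j) => //= n ->; apply: wirtingerE.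
by apply: hol_iter_derive; apply: hol_dir_derive.
Qed.

Lemma multi_deriv_wirtinger_bar G z alpha : hol G ->
  multi_deriv (@wirtinger_bar R d) alpha (fun w => G (z, conjv w)) =
  (fun w => dir_derive (enum 'I_d) snd_dir alpha G (z, conjv w)).
Proof.
move=> hG; rewrite /multi_deriv; elim: (enum 'I_d) => //= j l ->.
elim: (alpha j) => //= n ->; apply: wirtinger_barE.
by apply: hol_iter_derive; apply: hol_dir_derive.
Qed.

Definition dz := dir_derive (enum 'I_d) fst_dir.
Definition dw := dir_derive (enum 'I_d) snd_dir.

(** The definition differentiates in conj w first; commutation puts [dw] outermost, the place where
    integration by parts produces it. *)
Lemma symbol_derivE (a : Cd -> Cd -> C) G alpha z w : hol G ->
  (forall z w, a z w = G (z, conjv w)) ->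
  symbol_deriv alpha a z w = dw alpha (dz alpha G) (z, conjv w).
Proof.
move=> hG aG; rewrite /symbol_deriv.
rewrite (_ : (fun z' => _) = (fun z' => dw alpha G (z', conjv w))); last first.
  apply/funext => z'; rewrite (_ : a z' = fun w => G (z', conjv w)) ?multi_deriv_wirtinger_bar//.
  by apply/funext => w'; rewrite aG.
rewrite multi_deriv_wirtinger; first by rewrite /dw /dz dir_derive_commute.
exact: hol_dir_derive.
Qed.

End Coordinates.

Local Transparent derive hol.

(** * Gaussian growth conditions *)

Section Growth.
Variables (R : realType) (d : nat).
Local Notation C := R[i].
Local Notation Cd := 'rV[C]_d.
Local Notation V := (Cd * Cd)%type.
Implicit Types (u v w z p q : Cd) (G H : V -> C) (j : 'I_d).

Definition sqn u : R := \sum_j cabs (u 0 j) ^+ 2.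

Lemma sqn_ge0 u : 0 <= sqn u.
Proof. by apply: sumr_ge0 => j _; rewrite sqr_ge0. Qed.

Lemma enorm_sqr u : enorm u ^+ 2 = sqn u.
Proof.
rewrite /enorm sqr_sqrtr; first by apply: eq_bigr => j _; rewrite cabs_sqr.
by apply: sumr_ge0 => j _; rewrite addr_ge0// sqr_ge0.
Qed.

Lemma enorm_ge0 u : 0 <= enorm u. Proof. exact: sqrtr_ge0. Qed.

Lemma sqn_conjv u : sqn (conjv u) = sqn u.
Proof. by apply: eq_bigr => j _; rewrite !mxE cabs_conjc. Qed.

Lemma sqnZ (k : C) u : sqn (k *: u) = cabs k ^+ 2 * sqn u.
Proof. by rewrite /sqn mulr_sumr; apply: eq_bigr => j _; rewrite !mxE cabsM exprMn. Qed.

Lemma sqn0 : sqn (0 : Cd) = 0.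
Proof. by rewrite /sqn big1// => j _; rewrite mxE cabs0 expr0n. Qed.

Lemma sqn_delta j : sqn (delta_mx 0 j) = 1.
Proof.
rewrite /sqn (bigD1 j)//= big1 ?addr0 => [|k kj]; first by rewrite mxE !eqxx Normc.normc1 expr1n.
by rewrite mxE (negbTE kj) cabs0 expr0n.
Qed.

Lemma cabs_le_sqn u j : cabs (u 0 j) ^+ 2 <= sqn u.
Proof. by rewrite /sqn (bigD1 j)//= lerDl sumr_ge0// => k _; rewrite sqr_ge0. Qed.

(** Young's inequality [2 a b <= e a^2 + b^2 / e] in each coordinate: a bounded shift costs an
    arbitrarily small increase of the rate. *)
Lemma sqnD_le (e : R) u v : 0 < e -> sqn (u + v) <= (1 + e) * sqn u + (1 + e^-1) * sqn v.
Proof.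
move=> e0; rewrite /sqn !mulr_sumr -big_split /=; apply: ler_sum => j _; rewrite mxE.
set x := u 0 j; set y := v 0 j.
apply: (@le_trans _ _ ((cabs x + cabs y) ^+ 2)).
  by rewrite ler_pXn2r ?nnegrE ?addr_ge0 ?cabs_ge0// cabsD.
move: (cabs x) (cabs y) => a b.
rewrite -subr_ge0 (_ : _ - _ = e^-1 * (e * a - b) ^+ 2); last by field; rewrite gt_eqF.
by rewrite mulr_ge0 ?sqr_ge0// invr_ge0 ltW.
Qed.

(** By convexity [|(1 - t) x + t y|^2 <= (1 - t) |x|^2 + t |y|^2], and both weights are at most
    1. *)
Lemma sqn_segment_le (t : R) u z : 0 <= t <= 1 -> sqn (u + t%:C *: (z - u)) <= sqn u + sqn z.
Proof.
move=> /andP[t0 t1]; rewrite /sqn -big_split /=; apply: ler_sum => j _; rewrite !mxE.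
set x := u 0 j; set y := z 0 j.
have -> : x + t%:C * (y - x) = (1 - t)%:C * x + t%:C * y.
  by rewrite rmorphB rmorph1; ring.
apply: (@le_trans _ _ (((1 - t) * cabs x + t * cabs y) ^+ 2)).
  rewrite ler_pXn2r ?nnegrE ?cabs_ge0//.
    by rewrite (le_trans (cabsD _ _))// !cabsM !cabs_real !ger0_norm// subr_ge0.
  by rewrite addr_ge0// mulr_ge0 ?cabs_ge0// subr_ge0.
have := cabs_ge0 x; have := cabs_ge0 y; move: (cabs x) (cabs y) => a b b0 a0.
have h1 : 0 <= t * (1 - t) * (a - b) ^+ 2.
  by rewrite mulr_ge0 ?sqr_ge0// mulr_ge0// subr_ge0.
have h2 : 0 <= t * a ^+ 2 by rewrite mulr_ge0// sqr_ge0.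
have h3 : 0 <= (1 - t) * b ^+ 2 by rewrite mulr_ge0 ?sqr_ge0// subr_ge0.
rewrite -subr_ge0 (_ : _ - _ = t * (1 - t) * (a - b) ^+ 2 + t * a ^+ 2 + (1 - t) * b ^+ 2); last by ring.
by rewrite !addr_ge0.
Qed.

(** The constants in the growth conditions carry no sign; any instance of the bound shows that they
    are nonnegative. *)
Lemma cabs_le_nonneg (x : C) (c r : R) : cabs x <= c * expR r -> 0 <= c.
Proof. by move=> h; rewrite -(@pmulr_lge0 _ (expR r)) ?expR_gt0// (le_trans (cabs_ge0 x)). Qed.

(** The loss [e] absorbs the term [r |z|^(1/s)] of the hypothesis on the symbol and makes the
    condition stable under Cauchy's estimates. *)
Definition gauss_growth G := forall e : R, 0 < e -> exists c : R, forall x : V,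
  cabs (G x) <= c * expR ((2^-1 + e) * (sqn x.1 + sqn x.2)).

(* Exponential rate [k] in [|w|^2], uniformly in a unit neighbourhood of the
   antidiagonal [(w, conj w)]. *)
Definition diag_growth (k : R) G := forall e : R, 0 < e -> exists c : R,
  forall w p q, sqn p <= 1 -> sqn q <= 1 ->
    cabs (G (w + p, conjv w + q)) <= c * expR ((k + e) * sqn w).

(** Cauchy's estimate evaluates [G] at points shifted by [z *: v] with [|z| = 1]. The loss is split:
    half comes from the bound for [G], and [f] solves [(1/2 + e/2)(1 + f) = 1/2 + e] so that the
    shift uses the rest. *)
Lemma gauss_growth_derive G (v : V) : hol G -> gauss_growth G -> gauss_growth ('D_v G).
Proof.
move=> hG gG e e0; have e2 : 0 < e / 2 by rewrite divr_gt0.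
have [c cP] := gG _ e2.
pose f := e / (1 + e).
have e1 : 0 < 1 + e by rewrite addr_gt0.
have f0 : 0 < f by rewrite divr_gt0.
have fE : (2^-1 + e / 2) * (1 + f) = 2^-1 + e by rewrite /f; field; rewrite gt_eqF.
exists (2 * (c * expR ((2^-1 + e / 2) * ((1 + f^-1) * (sqn v.1 + sqn v.2))))) => x.
rewrite -mulrA; apply: cabs_derive_le => // z z1.
have c0 := cabs_le_nonneg (cP x).
rewrite (le_trans (cP _))// -mulrA -expRD ler_wpM2l// ler_expR -fE -mulrA -mulrDr.
apply: ler_wpM2l; first by rewrite addr_ge0// ltW.
rewrite /=.
have h1 := sqnD_le x.1 (z *: v.1) f0; have h2 := sqnD_le x.2 (z *: v.2) f0.
rewrite (le_trans (lerD h1 h2))// !sqnZ z1 expr1n !mul1r !mulrDr.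
by rewrite addrACA [leRHS]addrC.
Qed.

Lemma diag_growthM k l G H : diag_growth k G -> diag_growth l H ->
  diag_growth (k + l) (fun x => G x * H x).
Proof.
move=> gG gH e e0; have e2 : 0 < e / 2 by rewrite divr_gt0.
have [c cP] := gG _ e2; have [c' cP'] := gH _ e2.
exists (c * c') => w p q p1 q1; rewrite cabsM.
rewrite (le_trans (ler_pM (cabs_ge0 _) (cabs_ge0 _) (cP _ _ _ p1 q1) (cP' _ _ _ p1 q1)))//.
rewrite mulrACA -expRD -mulrDl addrACA -splitr//.
Qed.

(** The rate is 1 because w and conj w contribute 1/2 each on the antidiagonal. *)
Lemma gauss_diag_growth G : gauss_growth G -> diag_growth 1 G.
Proof.
(* The rate obtained is [2 (1/2 + f)(1 + f) = 1 + 3 f + 2 f^2 <= 1 + 5 f]. *)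
move=> gG e e0; pose f := Num.min 1 (e / 5).
have f0 : 0 < f by rewrite lt_min ltr01 divr_gt0.
have f1 : f <= 1 by rewrite ge_min lexx.
have fe : f <= e / 5 by rewrite ge_min lexx orbT.
have [c cP] := gG _ f0.
exists (c * expR ((2^-1 + f) * (2 * (1 + f^-1)))) => w p q p1 q1.
have c0 := cabs_le_nonneg (cP (w, w)).
rewrite (le_trans (cP _))// -mulrA -expRD ler_wpM2l// ler_expR /=.
have h1 := sqnD_le w p f0; have h2 := sqnD_le (conjv w) q f0.
have fi : 0 <= 1 + f^-1 by rewrite addr_ge0// invr_ge0 ltW.
have h3 : (1 + f^-1) * sqn p <= 1 + f^-1 by rewrite ler_piMr.
have h4 : (1 + f^-1) * sqn q <= 1 + f^-1 by rewrite ler_piMr.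
rewrite sqn_conjv in h2.
have h : sqn (w + p) + sqn (conjv w + q) <= 2 * (1 + f) * sqn w + 2 * (1 + f^-1).
  by move: h1 h2 h3 h4; move: (1 + f^-1) => g; lra.
have h5 : 0 <= 2^-1 + f by rewrite addr_ge0// ltW.
rewrite (le_trans (ler_wpM2l h5 h))// mulrDr addrC lerD2l mulrA ler_wpM2r ?sqn_ge0//.
rewrite (_ : (2^-1 + f) * _ = 1 + 3 * f + 2 * (f * f)); last by field.
have : f * f <= f by rewrite ler_piMl// ltW.
lra.
Qed.

(** Exponential growth of order one has Gaussian rate 0: [r t <= e/2 t^2 + r^2 / (2 e)], and
    [|w + p|^2 <= 2 |w|^2 + 2] accounts for the other [e] in the constant. *)
Lemma diag_growth_fst (F : Cd -> C) (r c : R) : 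
  (forall z, `|F z| <= (c * expR (r * enorm z))%:C) -> diag_growth 0 (fun x => F x.1).
Proof.
move=> FP e e0; exists (c * expR (e + r ^+ 2 / (2 * e))) => w p q p1 q1 /=.
have := FP (w + p); rewrite normr_cabs lecR => h; have c0 := cabs_le_nonneg h.
rewrite (le_trans h)// -mulrA -expRD ler_wpM2l// ler_expR add0r.
have s2 := sqnD_le w p ltr01; have pos := enorm_sqr (w + p).
rewrite invr1 in s2.
set t := enorm _ in pos *.
have tt : r * t <= e / 2 * t ^+ 2 + r ^+ 2 / (2 * e).
  rewrite -subr_ge0 (_ : _ - _ = (2 * e)^-1 * (e * t - r) ^+ 2); last by field; rewrite gt_eqF.
  by rewrite mulr_ge0 ?sqr_ge0// invr_ge0 mulr_ge0// ltW.
rewrite (le_trans tt)// pos.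
have : e / 2 * sqn (w + p) <= e / 2 * (2 * sqn w + 2).
  rewrite ler_pM2l ?divr_gt0//; lra.
by move: (r ^+ 2 / _) => g; lra.
Qed.

(** A linear factor has rate 0, since [|w_j| <= 1/e + e |w_j|^2] and
    [e |w_j|^2 <= exp (e |w|^2)]. *)
Lemma diag_growth_coord z j : diag_growth 0 (fun x : V => z 0 j - x.1 0 j).
Proof.
move=> e e0; exists (cabs (z 0 j) + 1 + (1 + e^-1)) => w p q p1 q1 /=.
rewrite !mxE add0r.
have wj : cabs (w 0 j) <= (1 + e^-1) * expR (e * sqn w).
  have l1 : cabs (w 0 j) <= e^-1 + e * cabs (w 0 j) ^+ 2.
    have := cabs_ge0 (w 0 j); move: (cabs _) => t t0.
    have h : 0 <= e^-1 * (e * t - 1) ^+ 2 by rewrite mulr_ge0 ?sqr_ge0// invr_ge0 ltW.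
    have : e^-1 * (e * t - 1) ^+ 2 = e^-1 + e * t ^+ 2 - 2 * t by field; rewrite gt_eqF.
    move: h => /[swap] ->; lra.
  have l2 : e * cabs (w 0 j) ^+ 2 <= expR (e * sqn w).
    apply: (@le_trans _ _ (1 + e * sqn w)); last exact: expR_ge1Dx.
    have := ler_wpM2l (ltW e0) (cabs_le_sqn w j); lra.
  have l3 : 1 <= expR (e * sqn w) by rewrite -expR0 ler_expR mulr_ge0 ?sqn_ge0// ltW.
  have l4 : e^-1 <= e^-1 * expR (e * sqn w) by rewrite ler_peMr// invr_ge0 ltW.
  by rewrite mulrDl mul1r; move: l1 l2 l4; move: (e^-1) => g; lra.
have pj : cabs (p 0 j) <= 1.
  rewrite -(@ler_pXn2r _ 2) ?nnegrE ?cabs_ge0// expr1n.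
  exact: le_trans (cabs_le_sqn p j) p1.
have l3 : 1 <= expR (e * sqn w) by rewrite -expR0 ler_expR mulr_ge0 ?sqn_ge0// ltW.
have zj := cabs_ge0 (z 0 j).
have l5 : cabs (z 0 j) <= cabs (z 0 j) * expR (e * sqn w) by rewrite ler_peMr.
have := cabsB (z 0 j) (w 0 j + p 0 j); have := cabsD (w 0 j) (p 0 j).
by rewrite !mulrDl mul1r in wj *; lra.
Qed.

(** This is where [s >= 1/2] enters: [1/s <= 2] gives [|w|^(1/s) <= 1 + |w|^2]. *)
Lemma A_hat'_gauss_growth (s : R) (a : Cd -> Cd -> C) : 2^-1 <= s -> A_hat' s a ->
  gauss_growth (fun x => a x.1 (conjv x.2)).
Proof.
move=> s2 [_ aP] e e0; have [c cP] := aP _ e0.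
exists (c * expR (2 * e)) => -[z v] /=.
have := cP z (conjv v); rewrite normr_cabs lecR => h; have c0 := cabs_le_nonneg h.
rewrite (le_trans h)// -mulrA -expRD ler_wpM2l// ler_expR !enorm_sqr sqn_conjv.
have s0 : 0 < s by rewrite (lt_le_trans _ s2)// invr_gt0.
have pw w : enorm w `^ s^-1 <= 1 + sqn w.
  have [w1|w1] := leP (enorm w) 1.
    rewrite (@le_trans _ _ 1)//; last by rewrite lerDl sqn_ge0.
    have si0 : 0 <= s^-1 by rewrite invr_ge0 ltW.
    have := @ge0_ler_powR R s^-1 si0 (enorm w) 1; rewrite !nnegrE enorm_ge0 ler01 powR1.
    by apply.
  rewrite (@le_trans _ _ (enorm w `^ 2))//.
    have s12 : s^-1 <= 2 by rewrite -[leRHS]invrK lef_pV2 ?posrE// invr_gt0.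
    by apply: ler_powR => //; exact: ltW.
  by rewrite powR_mulrn ?enorm_ge0// enorm_sqr lerDr.
have := pw z; have := pw (conjv v); rewrite sqn_conjv => h1 h2.
have h3 := ler_wpM2l (ltW e0) (lerD h2 h1).
by move: h3; lra.
Qed.

End Growth.

(** * Taylor's formula *)

Section MultiIndex.
Variables (d M : nat).
Local Notation mi := {ffun 'I_d -> 'I_M.+1}.
Implicit Types (j : 'I_d) (alpha beta : 'I_d -> nat).

Definition incr j alpha : 'I_d -> nat := fun i => ((i == j) + alpha i)%N.

Lemma mabs_incr j alpha : mabs (incr j alpha) = (mabs alpha).+1.
Proof.
rewrite /mabs /incr big_split /= (bigD1 j)//= big1 ?eqxx ?addn0 ?add1n// => i /negbTE.
by move=> ->.
Qed.

Lemma mfact_incr j alpha : mfact (incr j alpha) = ((alpha j).+1 * mfact alpha)%N.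
Proof.
rewrite /mfact /incr (bigD1 j)//= [X in _ = (_ * X)%N](bigD1 j)//= eqxx add1n factS mulnA.
by congr (_ * _)%N; apply: eq_bigr => i /negbTE ->.
Qed.

Lemma leq_mabs alpha j : (alpha j <= mabs alpha)%N.
Proof. by rewrite /mabs (bigD1 j)//= leq_addr. Qed.

Let up j (alpha : mi) : mi := [ffun i => inord (incr j (mindex alpha) i)].
Let down j (beta : mi) : mi := [ffun i => inord (mindex beta i - (i == j))].

Let mindex_up j (alpha : mi) : (mabs (mindex alpha) < M)%N ->
  mindex (up j alpha) = incr j (mindex alpha).
Proof.
move=> aM; apply/funext => i; rewrite /mindex ffunE inordK// ltnS.
apply: leq_trans aM; rewrite /incr -[(mabs _).+1]add1n.
exact: leq_add (leq_b1 _) (leq_mabs _ _).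
Qed.

Let mindex_down j (beta : mi) i : mindex (down j beta) i = (mindex beta i - (i == j))%N.
Proof.
by rewrite /mindex ffunE inordK//; apply: leq_ltn_trans (leq_subr _ _) (ltn_ord _).
Qed.

(** Double counting: [beta] of length [k + 1] is [incr j alpha] for each [j] with [beta j > 0], and
    then [1 / alpha! = beta j / beta!]. The weights [beta j] add up to [k + 1]. The condition
    [k < M] keeps the incremented entries within the index type. *)
Lemma sum_mindex_incr (K : fieldType) (X : ('I_d -> nat) -> K) k :
  [pchar K] =i pred0 -> (k < M)%N ->
  \sum_(alpha : mi | mabs (mindex alpha) == k)
     \sum_j X (incr j (mindex alpha)) / (mfact (mindex alpha))%:R =
  k.+1%:R * \sum_(beta : mi | mabs (mindex beta) == k.+1) X (mindex beta) / (mfact (mindex beta))%:R.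
Proof.
move=> K0 kM; rewrite exchange_big /= mulr_sumr.
transitivity (\sum_j \sum_(beta : mi | mabs (mindex beta) == k.+1)
    (mindex beta j)%:R * (X (mindex beta) / (mfact (mindex beta))%:R)); last first.
  rewrite exchange_big /=; apply: eq_bigr => beta /eqP bk.
  by rewrite -mulr_suml -natr_sum -bk.
apply: eq_bigr => j _; rewrite [RHS](bigID (fun beta : mi => mindex beta j == 0)%N) /=.
rewrite [X in _ = X + _]big1 ?add0r; last by move=> beta /andP[_ /eqP ->]; rewrite mul0r.
rewrite [RHS](reindex_onto (up j) (down j)) /=; last first.
  move=> beta /andP[_ bj]; apply/ffunP => i; apply: val_inj; rewrite ffunE /= inordK.
    rewrite /incr -/(mindex _ i) mindex_down /mindex; case: eqP => [->|_]; last by rewrite subn0.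
    by rewrite add1n subn1 prednK// lt0n.
  rewrite /incr mindex_down /mindex; case: eqP => [->|_]; last by rewrite add0n subn0 ltn_ord.
  by rewrite add1n subn1 prednK ?lt0n// ltn_ord.
apply: eq_big => [alpha|alpha /eqP ak]; last first.
  rewrite mindex_up ?ak// mfact_incr natrM invfM mulrA [RHS]mulrCA.
  have -> : incr j (mindex alpha) j = (mindex alpha j).+1 by rewrite /incr eqxx.
  rewrite -[X in _ = _ * X]mulrA mulKf//.
  by rewrite ((pcharf0P K).1 K0).
apply/eqP/idP => [ak|].
  rewrite mindex_up ?ak// mabs_incr ak eqxx /incr eqxx /=.
  apply/eqP/ffunP => i; apply: val_inj; apply: (etrans (mindex_down j (up j alpha) i)).
  by rewrite mindex_up ?ak// /incr addKn.
move=> /andP[/andP[/eqP uk uj] /eqP ud].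
suff aj : (mindex alpha j < M)%N.
  move: uk; rewrite (_ : mindex (up j alpha) = incr j (mindex alpha)); first by rewrite mabs_incr => -[].
  apply/funext => i; rewrite /mindex ffunE inordK// /incr.
  by case: eqP => [->|_]; [rewrite add1n ltnS|rewrite add0n ltn_ord].
(* If [alpha j] were [M], the [inord] in [up] would overflow to its default 0, against [uj]. *)
rewrite ltnNge; apply/negP => Mj; move: uj; rewrite /mindex ffunE /incr eqxx /inord /insubd insubF//=.
by rewrite add1n ltnS ltnNge Mj.
Qed.

End MultiIndex.

(** The two sums of the theorem have different bounds on the entries; a length at most [N] bounds
    each entry by [N], so both sums can be indexed by the wider type. *)
Lemma sum_mindex_widen (d N : nat) (K : nmodType) (X : ('I_d -> nat) -> K) :
  \sum_(alpha : {ffun 'I_d -> 'I_N.+1} | (mabs (mindex alpha) <= N)%N) X (mindex alpha) =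
  \sum_(alpha : {ffun 'I_d -> 'I_N.+2} | (mabs (mindex alpha) <= N)%N) X (mindex alpha).
Proof.
pose up (alpha : {ffun 'I_d -> 'I_N.+1}) : {ffun 'I_d -> 'I_N.+2} := [ffun i => inord (alpha i)].
pose down (alpha : {ffun 'I_d -> 'I_N.+2}) : {ffun 'I_d -> 'I_N.+1} := [ffun i => inord (alpha i)].
have upE alpha : mindex (up alpha) = mindex alpha.
  by apply/funext => i; rewrite /mindex ffunE inordK// ltnS ltnW// ltn_ord.
rewrite [RHS](reindex_onto up down) /=; last first.
  move=> alpha aN; apply/ffunP => i; apply: val_inj; rewrite !ffunE.
  have iN : (alpha i < N.+1)%N by rewrite ltnS (leq_trans (leq_mabs (mindex alpha) i)).
  by rewrite /= inordK ?inordK// ltnS ltnW.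
apply: eq_big => [alpha|alpha _]; last by rewrite upE.
rewrite upE; case: leqP => //= _; apply/esym/eqP/ffunP => i; apply: val_inj.
by rewrite !ffunE /= inordK ?inordK// ltnS ltnW// ltn_ord.
Qed.

(** * Taylor expansion along a segment, and in the first variable *)

Section Taylor.
Variable R : realType.
Local Notation C := R[i].

Lemma continuous_onem_pow n : continuous (fun t : R => ((1 - t) ^+ n)%:C : C).
Proof.
elim: n => [|n IH].
  under eq_fun do rewrite expr0; exact: ccontinuous_cst.
under eq_fun do rewrite exprS rmorphM; apply: ccontinuousM IH.
under eq_fun do rewrite rmorphB.
exact: (ccontinuousB (@ccontinuous_cst R R 1%:C) (@continuous_real_complex R)).
Qed.

Lemma path_derive_onem_pow n (t : R) :
  path_derive (fun s => ((1 - s) ^+ n.+1)%:C) t (- (n.+1%:R * ((1 - t) ^+ n)%:C)).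
Proof.
have d1 : path_derive (fun s => (1 - s)%:C) t (- 1).
  have -> : - 1 = (0 - 1)%:C :> C by rewrite sub0r rmorphN1.
  apply: path_derive_real; exact: is_deriveB (is_derive_cst (1 : R) t 1) (is_derive_id t 1).
elim: n => [|n IH].
  by rewrite expr0 mulr1; under eq_fun do rewrite expr1.
under eq_fun do rewrite exprS rmorphM; have := path_deriveM d1 IH.
have E : ((1 - t) ^+ n.+1)%:C = (1 - t)%:C * ((1 - t) ^+ n)%:C :> C by rewrite exprS rmorphM.
by congr path_derive; rewrite E -[n.+2%:R]natr1; ring.
Qed.

(* [T k] plays the role of the [k]-th derivative of [T 0] divided by [k!]. *)
Lemma path_taylor (N : nat) (T : nat -> R -> C) :
  (forall k t, (k <= N)%N -> path_derive (T k) t (k.+1%:R * T k.+1 t)) ->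
  continuous (T N.+1) ->
  T 0%N 1 = \sum_(k < N.+1) T k 0 +
    itv_integral 0 1 (fun t => N.+1%:R * ((1 - t) ^+ N)%:C * T N.+1 t).
Proof.
elim: N => [|N IH] dT cT.
  rewrite big_ord1 (eq_itv_integral (g := fun t => 1%:R * T 1%N t)); last first.
    by move=> t _; rewrite expr0 mulr1.
  have d0 t : path_derive (T 0%N) t (1%:R * T 1%N t) by exact: dT.
  rewrite (itv_integral_derive ler01 d0 (ccontinuousM (@ccontinuous_cst R R 1%:R) cT)).
  by rewrite addrC subrK.
have cT1 : continuous (T N.+1) by apply: path_derive_continuous => t; exact: dT.
have cf n k c : continuous (T k) -> continuous (fun t : R => c * ((1 - t) ^+ n)%:C * T k t).
  by move=> cTk; exact: ccontinuousM (ccontinuousM (@ccontinuous_cst R R c) (@continuous_onem_pow n)) cTk.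
rewrite IH//; last by move=> k t kN; apply: dT; rewrite (leq_trans kN).
rewrite [in RHS]big_ord_recr /= -!addrA; congr (_ + _).
(* Consecutive remainders differ by the integral of the derivative of [(1 - t)^(N+1) T_(N+1)], a
   function that vanishes at [t = 1]. *)
have dS t : path_derive (fun t => ((1 - t) ^+ N.+1)%:C * T N.+1 t) t
    (N.+2%:R * ((1 - t) ^+ N.+1)%:C * T N.+2 t - N.+1%:R * ((1 - t) ^+ N)%:C * T N.+1 t).
  have := path_deriveM (path_derive_onem_pow N t) (dT N.+1 t (leqnn _)).
  congr path_derive; move: (_%:C) (_%:C) (T _ _) (T _ _) => *; ring.
have := itv_integral_derive ler01 dS (ccontinuousB (cf _ _ _ cT) (cf _ _ _ cT1)).
rewrite subrr expr0n mul0r subr0 expr1n mul1r sub0r.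
rewrite (itv_integralB _ _ (cf _ _ _ cT) (cf _ _ _ cT1)) => H.
by rewrite -[T N.+1 0]opprK -H opprB subrK.
Qed.

Variables (d : nat).
Local Notation Cd := 'rV[C]_d.
Local Notation V := (Cd * Cd)%type.
Implicit Types (G H : V -> C) (z u v : Cd) (alpha : 'I_d -> nat).

Definition mpow u alpha : C := \prod_j u 0 j ^+ alpha j.

Lemma mpow_incr u j alpha : mpow u (incr j alpha) = u 0 j * mpow u alpha.
Proof.
rewrite /mpow /incr (bigD1 j)//= [X in _ = _ * X](bigD1 j)//= eqxx add1n exprS mulrA.
by congr (_ * _); apply: eq_bigr => i /negbTE ->.
Qed.

(** For [mabs alpha = N.+1] and [H = dw alpha (dz alpha G)], the value at [(w, conjv w)] is the
    remainder symbol b_alpha(z, w). Off the antidiagonal, with [z] frozen, it is holomorphic in [x]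
    when [H] is. *)
Definition taylor_rem z N H (x : V) : C := N.+1%:R *
  param_integral 0 1 (fun t y => ((1 - t) ^+ N)%:C * H (y.1 + t%:C *: (z - y.1), y.2)) x.

Lemma derive_fst_sum G x u : hol G ->
  'D_((u, 0) : V) G x = \sum_j u 0 j * 'D_(fst_dir R j) G x.
Proof.
move=> hG; have -> : (u, 0) = \sum_j u 0 j *: fst_dir R j :> V.
  transitivity ((\sum_j u 0 j *: delta_mx 0 j, 0) : V); first by rewrite -row_sum_delta.
  elim/big_rec2 : _ => // j y1 y2 _ <-; congr pair.
  by rewrite /= scaler0 addr0.
elim/big_rec2 : _ => [|j y1 y2 _ IH]; first exact: hol_derive0.
by case: hG => _ _ ->; rewrite IH.
Qed.

Lemma dz_incr G j alpha : hol G -> dz (incr j alpha) G = 'D_(fst_dir R j) (dz alpha G).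
Proof.
move=> hG; apply: dir_deriveS => //; [exact: enum_uniq|by rewrite mem_enum].
Qed.

Lemma hol_dz alpha G : hol G -> hol (dz alpha G).
Proof. exact: hol_dir_derive. Qed.

Lemma dz0 alpha G : (mabs alpha = 0)%N -> dz alpha G = G.
Proof.
move=> a0; have {}a0 j : alpha j = 0%N by apply/eqP; rewrite -leqn0 -a0 leq_mabs.
by rewrite /dz /dir_derive; elim: (enum _) => //= j l ->; rewrite a0.
Qed.

(** Stated for every [(u, v)], not only on the antidiagonal, because weighted integrands are
    compared as functions on C^d x C^d. *)
Lemma fst_taylor N G z u v : hol G ->
  G (z, v) =
  \sum_(alpha : {ffun 'I_d -> 'I_N.+2} | (mabs (mindex alpha) <= N)%N)
     mpow (z - u) (mindex alpha) / (mfact (mindex alpha))%:R * dz (mindex alpha) G (u, v)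
  + \sum_(alpha : {ffun 'I_d -> 'I_N.+2} | mabs (mindex alpha) == N.+1)
     mpow (z - u) (mindex alpha) / (mfact (mindex alpha))%:R *
       taylor_rem z N (dz (mindex alpha) G) (u, v).
Proof.
move=> hG; pose y := z - u; pose x (t : R) : V := (u + t%:C *: y, v).
have xE t : x t = (u, v) + t%:C *: ((y, 0) : V) by congr pair; rewrite /= scaler0 addr0.
pose mi := {ffun 'I_d -> 'I_N.+2}.
pose F (alpha : 'I_d -> nat) t := mpow y alpha * dz alpha G (x t).
(* The part of length [k], that is, the [k]-th derivative along the segment divided by [k!]; the
   relation between [T k] and [T k.+1] required by [path_taylor] is [sum_mindex_incr]. *)
pose T k t := \sum_(alpha : mi | mabs (mindex alpha) == k)
   F (mindex alpha) t / (mfact (mindex alpha))%:R.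
have dF alpha t : path_derive (F alpha) t (\sum_j F (incr j alpha) t).
  have -> : \sum_j F (incr j alpha) t = mpow y alpha * 'D_((y, 0) : V) (dz alpha G) (x t).
    rewrite derive_fst_sum ?mulr_sumr; last exact: hol_dz.
    apply: eq_bigr => j _; rewrite /F mpow_incr (dz_incr _ _ hG).
    by rewrite mulrA [mpow y alpha * _]mulrC.
  apply: path_deriveZ; have := hol_path_derive (u, v) ((y, 0) : V) t (hol_dz alpha hG).
  by rewrite xE; under [X in _ -> path_derive X _ _]eq_fun do rewrite xE.
have cF alpha : continuous (F alpha) by exact: path_derive_continuous (dF alpha).
have dT' k t : path_derive (T k) t (\sum_(alpha : mi | mabs (mindex alpha) == k)
    \sum_j F (incr j (mindex alpha)) t / (mfact (mindex alpha))%:R).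
  apply: path_derive_sum => alpha _; under eq_fun do rewrite mulrC.
  by rewrite -mulr_suml mulrC; apply: path_deriveZ.
have dT k t : (k <= N)%N -> path_derive (T k) t (k.+1%:R * T k.+1 t).
  move=> kN; rewrite -(@sum_mindex_incr d N.+1 C (F^~ t))//; exact: pchar_num.
have cT k : continuous (T k) by exact: path_derive_continuous (dT' k).
have T01 : T 0%N 1 = G (z, v).
  rewrite /T (big_pred1 [ffun=> ord0]) => [|alpha]; last first.
    apply/eqP/eqP => [a0|->]; last by rewrite /mabs big1// => i _; rewrite /mindex ffunE.
    apply/ffunP => i; apply: val_inj; rewrite ffunE /=; apply/eqP.
    by rewrite -leqn0 -[X in (_ <= X)%N]a0; exact: leq_mabs.
  set al := mindex _; have al0 i : al i = 0%N by rewrite /al /mindex ffunE.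
  have m0 : mabs al = 0%N by rewrite /mabs big1.
  rewrite /F dz0// /mpow big1 => [|i _]; last by rewrite al0 expr0.
  rewrite /mfact big1 => [|i _]; last by rewrite al0.
  by rewrite divr1 mul1r /x scale1r /y addrC subrK.
have T0 : \sum_(k < N.+1) T k 0 =
    \sum_(alpha : mi | (mabs (mindex alpha) <= N)%N)
     mpow y (mindex alpha) / (mfact (mindex alpha))%:R * dz (mindex alpha) G (u, v).
  rewrite [RHS](partition_big (fun alpha : mi => inord (mabs (mindex alpha)) : 'I_N.+1) xpredT)//=.
  apply: eq_bigr => k _; apply: eq_big => [alpha|alpha _]; last first.
    by rewrite /F /x scale0r addr0 mulrAC.
  apply/eqP/andP => [ak|[aN /eqP <-]]; last by rewrite inordK.
  by rewrite ak -ltnS ltn_ord; split => //; apply/eqP/val_inj; rewrite /= inordK.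
have := path_taylor dT (cT N.+1); rewrite T01 T0 => ->; congr (_ + _).
have cg (alpha : 'I_d -> nat) : continuous (fun t : R => ((1 - t) ^+ N)%:C * dz alpha G (x t)).
  apply: ccontinuousM; first exact: continuous_onem_pow.
  move=> t; apply: (continuous_comp (f := x)); last exact: hol_continuous (hol_dz alpha hG) _.
  apply: (@cvg_pair _ _ _ (nbhs t) (nbhs (u + t%:C *: y)) (nbhs v)); last exact: cvg_cst.
  apply: cvgD; [exact: cvg_cst|apply: cvgZr_tmp; exact: continuous_real_complex].
transitivity (itv_integral 0 1 (fun t => \sum_(alpha : mi | mabs (mindex alpha) == N.+1)
    (mpow y (mindex alpha) / (mfact (mindex alpha))%:R * N.+1%:R) *
    (((1 - t) ^+ N)%:C * dz (mindex alpha) G (x t)))).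
  apply: eq_itv_integral => t _; rewrite /T mulr_sumr; apply: eq_bigr => alpha _.
  by rewrite /F; move: (mpow _ _) (dz _ _ _) ((_)%:C) => *; ring.
rewrite itv_integral_sum; last first.
  by move=> alpha; exact: ccontinuousM (@ccontinuous_cst R R _) (cg _).
apply: eq_bigr => alpha _; rewrite (itv_integralZ _ _ _ (cg _)) -mulrA; congr (_ * _).
Qed.

End Taylor.

(** * Integration over C^d *)

Section MeasurableContinuous.
Variables (R : realType) (d : nat).
Local Notation C := R[i].
Local Notation Cd := 'rV[C]_d.
Local Notation R2 := (measurableTypeR R * measurableTypeR R)%type.

Lemma cvg_row (T : Type) (F : set_system T) (FF : Filter F) (u : T -> Cd) (l : Cd) :
  (forall j, (fun n => u n 0 j) @ F --> l 0 j) -> u @ F --> l.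
Proof.
move=> ul A [P Pl PA].
have H (r : seq 'I_d) : \forall n \near F, forall j, j \in r -> P 0 j (u n 0 j).
  elim: r => [|k r IH]; first exact: filterE.
  have Pk : \forall n \near F, P 0 k (u n 0 k) by apply: (ul k); exact: Pl.
  apply: filterS2 Pk IH => n nk nr j; rewrite in_cons => /orP[/eqP ->//|]; exact: nr.
apply: filterS (H (enum 'I_d)) => n nP; apply: PA => i j; rewrite (ord1 i).
by apply: nP; rewrite mem_enum.
Qed.

Let grid (m : nat) (k : int) : R := k%:~R / m.+1%:R.
Let cell (m : nat) (a : R) : int := Num.floor (m.+1%:R * a).

Let grid_cell m a : `|grid m (cell m a) - a| <= m.+1%:R^-1.
Proof.
have m0 : 0 < m.+1%:R :> R by rewrite ltr0n.
rewrite (_ : grid m (cell m a) - a = ((cell m a)%:~R - m.+1%:R * a) / m.+1%:R); last first.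
  by rewrite /grid mulrBl [m.+1%:R * a]mulrC mulfK// gt_eqF.
rewrite normrM (gtr0_norm (x := _^-1)) ?invr_gt0// ler_piMl ?invr_ge0// ler_norml /cell.
have := floor_itv (m.+1%:R * a); rewrite intrD; move: (_ * a) => b /andP[b1 b2].
by apply/andP; split; lra.
Qed.

Let cvg_grid a : grid m (cell m a) @[m --> \oo] --> a.
Proof.
apply/cvgrPdist_le => e e0.
have := @cvg_harmonic R; move=> /cvgrPdist_le/(_ e e0); apply: filterS => m.
rewrite sub0r normrN ger0_norm ?invr_ge0// => me.
by rewrite distrC (le_trans (grid_cell _ _)).
Qed.

Let measurable_cell m (k : int) : measurable ([set a | cell m a = k] : set (measurableTypeR R)).
Proof.
have m0 : 0 < m.+1%:R :> R by rewrite ltr0n.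
rewrite (_ : [set a | _] = `[grid m k, grid m (k + 1)[%classic).
  exact: measurable_itv.
apply/seteqP; split => a /=; rewrite in_itv /= /grid ler_pdivrMr// ltr_pdivlMr// ![a * _]mulrC.
  by move=> <-; rewrite floor_itv.
by move=> /floor_def.
Qed.

(* [f] is the pointwise limit of its values at grid points, which take
   countably many values on measurable cells. *)
Lemma measurable_continuous_coords (f : Cd -> R) : continuous f ->
  measurable_fun [set: d.-tuple R2] (f \o @of_realcoords R d).
Proof.
move=> cf.
pose K := {ffun 'I_d -> int * int}.
pose pt m (k : K) : Cd := \row_j (grid m (k j).1 +i* grid m (k j).2).
pose idx m (x : d.-tuple R2) : K := [ffun j => (cell m (tnth x j).1, cell m (tnth x j).2)].
apply: (@measurable_fun_cvg _ _ _ _ (fun m x => f (pt m (idx m x)))); last first.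
  move=> x _; apply: (continuous_cvg _ (cf _)); apply: cvg_row => j.
  rewrite mxE; under eq_fun do rewrite mxE ffunE /=.
  by apply: (@cvg_complex R nat \oo); exact: cvg_grid.
move=> m _ B mB; rewrite setTI.
rewrite (_ : _ @^-1` _ = \bigcup_(k : K) [set x | idx m x = k /\ B (f (pt m k))]); last first.
  by apply/seteqP; split => [x Bx|x [k _ [<-]]//]; exists (idx m x).
apply: countable_bigcupT_measurable => [|k]; first exact: countableP.
have [Bk|nBk] := pselect (B (f (pt m k))); last first.
  by rewrite (_ : [set x | _] = set0)//; apply/seteqP; split => x // -[].
rewrite (_ : [set x | _] = \bigcap_(j in setT) [set x | cell m (tnth x j).1 = (k j).1 /\
    cell m (tnth x j).2 = (k j).2]); last first.
  apply/seteqP; split => [x [<- _] j _|x xk]; first by rewrite ffunE.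
  split=> //; apply/ffunP => j; rewrite ffunE; have [-> ->] := xk j I.
  by case: (k j).
apply: fin_bigcap_measurable => [|j _]; first exact: finite_finset.
rewrite (_ : [set x | _] = (@tnth d R2)^~ j @^-1`
   ([set a | cell m a = (k j).1] `*` [set a | cell m a = (k j).2]))//.
rewrite -[X in measurable X]setTI; apply: measurable_tnth => //.
by apply: measurableX; exact: measurable_cell.
Qed.

Lemma cmeasurable_continuous_coords (f : Cd -> C) : continuous f ->
  cmeasurable [set: d.-tuple R2] (f \o @of_realcoords R d).
Proof.
move=> cf; split.
  apply: (@measurable_continuous_coords (fun w => Re (f w))) => w.
  by apply: continuous_comp; [exact: cf|exact: continuous_Re].
apply: (@measurable_continuous_coords (fun w => Im (f w))) => w.
by apply: continuous_comp; [exact: cf|exact: continuous_Im].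
Qed.

End MeasurableContinuous.

(** * Fubini's theorem on tuples *)

Section TupleIntegral.
Context (R : realType) d (T : measurableType d).
Variable mu : {sigma_finite_measure set T -> \bar R}.
Local Open Scope ereal_scope.

Let mcons n : measurable_fun [set: T * n.-tuple T] (@tuple_cons d T n).
Proof. exact: measurable_cons. Qed.

Let muncons n : measurable_fun [set: n.+1.-tuple T]
  (fun t : n.+1.-tuple T => (thead t, [tuple of behead t])).
Proof.
apply/measurable_fun_pairP; split; first exact: (measurable_tnth ord0).
exact: measurable_behead.
Qed.

Let consK n (t : n.+1.-tuple T) : tuple_cons (thead t, [tuple of behead t]) = t.
Proof. by rewrite /tuple_cons [in RHS](tuple_eta t). Qed.

Lemma integrable_tuple_cons n (f : n.+1.-tuple T -> R) :
  (tuple_measure mu n.+1).-integrable setT (EFin \o f) <->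
  (mu \x tuple_measure mu n).-integrable setT (EFin \o (f \o @tuple_cons d T n)).
Proof.
split=> fi.
  have mf := measurable_int _ fi.
  have mfc : measurable_fun setT ((EFin \o f) \o @tuple_cons d T n) by exact: (measurableT_comp mf (@mcons n)).
  apply/integrableP; split => //; move/integrableP : fi => [_].
  have mabs : measurable_fun setT (fun t => `|(EFin \o f) t|) by exact: measurableT_comp.
  by rewrite /= (ge0_integral_pushforward (@mcons n))// preimage_setT.
have mf : measurable_fun setT (EFin \o f).
  rewrite (_ : f = (f \o @tuple_cons d T n) \o (fun t => (thead t, [tuple of behead t]))).
    exact: measurableT_comp (measurable_int _ fi) (@muncons n).
  by apply/funext => t /=; rewrite consK.
by apply: (integrable_pushforward (@mcons n)) => //; rewrite preimage_setT.
Qed.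

Lemma integral_tuple_cons n (f : n.+1.-tuple T -> R) :
  (tuple_measure mu n.+1).-integrable setT (EFin \o f) ->
  \int[tuple_measure mu n.+1]_t (f t)%:E =
  \int[mu \x tuple_measure mu n]_p (f (tuple_cons p))%:E.
Proof.
move=> fi; rewrite (integral_pushforward (@mcons n))//.
  exact: measurable_int fi.
by rewrite preimage_setT; exact/integrable_tuple_cons.
Qed.

Lemma integrable_prodM d' (T' : measurableType d') (nu : {sigma_finite_measure set T' -> \bar R})
    (f : T -> R) (g : T' -> R) :
  mu.-integrable setT (EFin \o f) -> nu.-integrable setT (EFin \o g) ->
  (mu \x nu).-integrable setT (fun p => (f p.1 * g p.2)%:E).
Proof.
move=> fi gi.
have mf : measurable_fun setT f by exact/measurable_EFinP/(measurable_int _ fi).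
have mg : measurable_fun setT g by exact/measurable_EFinP/(measurable_int _ gi).
apply/integrable12ltyP.
  apply/measurable_EFinP; apply: measurable_funM; exact: measurableT_comp.
have gE : \int[nu]_y `|(g y)%:E| = (fine (\int[nu]_y `|(g y)%:E|))%:E.
  move/integrableP : gi => [_ gi]; rewrite fineK// ge0_fin_numE//; exact: integral_ge0.
rewrite (eq_integral (fun x => `|(f x)%:E| * (fine (\int[nu]_y `|(g y)%:E|))%:E)); last first.
  move=> x _; rewrite -gE -ge0_integralZl//.
  - by apply: eq_integral => y _; rewrite EFinM abseM.
  - by do 2 apply: measurableT_comp => //.
move/integrableP : fi => [_ fi].
rewrite ge0_integralZr//; last 2 first.
- by do 2 apply: measurableT_comp => //.
- by rewrite lee_fin fine_ge0// integral_ge0.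
rewrite lte_mul_pinfty//; first exact: integral_ge0.
  by rewrite ge0_fin_numE// integral_ge0.
exact: ltry.
Qed.

Lemma integrable_tuple_prod n (g : T -> R) :
  mu.-integrable setT (EFin \o g) ->
  (tuple_measure mu n).-integrable setT (EFin \o (fun t => \prod_(i < n) g (tnth t i))%R).
Proof.
move=> gi; elim: n => [|n IH].
  rewrite (_ : EFin \o _ = fun=> 1%:E); last first.
    by apply/funext => t /=; rewrite big_ord0.
  apply/integrableP; split; first exact: measurable_cst.
  by rewrite integral_dirac//= diracE in_setT mul1e normr1 ltry.
apply/integrable_tuple_cons.
rewrite (_ : EFin \o _ = fun p => (g p.1 * \prod_(i < n) g (tnth p.2 i))%:E); last first.
  apply/funext => -[x t] /=; congr EFin; rewrite big_ord_recl (tnth_nth x) /=.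
  by congr (_ * _)%R; apply: eq_bigr => i _; rewrite !(tnth_nth x).
exact: (@integrable_prodM _ _ (tuple_measure mu n) g (fun t => \prod_(i < n) g (tnth t i))%R gi IH).
Qed.

Definition tuple_set n (t : n.-tuple T) (j : 'I_n) (x : T) : n.-tuple T :=
  [tuple if i == j then x else tnth t i | i < n].

(* The hypothesis concerns every slice, so no almost-everywhere argument is
   needed for the [j]-th variable. *)
Lemma integral_tuple_slice0 n (f : n.-tuple T -> R) (j : 'I_n) :
  (tuple_measure mu n).-integrable setT (EFin \o f) ->
  (forall t, \int[mu]_x (f (tuple_set t j x))%:E = 0) ->
  \int[tuple_measure mu n]_t (f t)%:E = 0.
Proof.
elim: n f j => [|n IH] f j fi f0; first by have := ltn_ord j.
have fi' := (integrable_tuple_cons f).1 fi.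
rewrite integral_tuple_cons//.
have setE (x : T) (t : n.-tuple T) (k : 'I_n) y : tuple_set (tuple_cons (x, t)) (lift ord0 k) y = tuple_cons (x, tuple_set t k y).
  apply: eq_from_tnth => i; rewrite tnth_mktuple; case: (unliftP ord0 i) => [i'|] ->.
    by rewrite /tuple_cons !tnthS tnth_mktuple (inj_eq lift_inj).
  by rewrite !(tnth_nth x).
have set0E (x : T) (t : n.-tuple T) y : tuple_set (tuple_cons (x, t)) ord0 y = tuple_cons (y, t).
  apply: eq_from_tnth => i; rewrite tnth_mktuple; case: (unliftP ord0 i) => [i'|] ->.
    by rewrite /= !(tnth_nth x).
  by rewrite eqxx !(tnth_nth x).
(* If [j] is the head, it is integrated first and the inner integral vanishes for every tail.
   Otherwise the tail is integrated first, and the induction hypothesis applies for almost every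
   head. *)
case: (unliftP ord0 j) => [k|] jE; last first.
  have [x0 _] : exists x : T, True by exact: (ex_intro _ point).
  rewrite -(integral21_prod_meas1 fi') /fubini_G integral0_eq// => t _.
  rewrite -[RHS](f0 (tuple_cons (x0, t))) jE.
  by apply: eq_integral => y _; rewrite set0E.
rewrite -(integral12_prod_meas1 fi') -(integral0 mu setT).
apply: ae_eq_integral; [exact: measurableT|exact: (measurable_fubini_F (T1 := T) fi')|exact: measurable_cst|].
apply: filterS (ae_integrable1 fi') => x /= fx _.
apply: (IH (fun t => f (tuple_cons (x, t))) k) => // t.
rewrite -[RHS](f0 (tuple_cons (x, t))) jE.
by apply: eq_integral => y _; rewrite setE.
Qed.

End TupleIntegral.

(** * Dominated convergence for complex integrands *)

Section DominatedConvergence.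
Context (R : realType) d (T : measurableType d) (mu : {measure set T -> \bar R}).
Variables (D : set T) (mD : measurable D).
Local Notation C := R[i].

Lemma Rintegral_dominated_cvg (f_ : nat -> T -> R) (f g : T -> R) :
  (forall n, measurable_fun D (f_ n)) -> measurable_fun D f ->
  (forall x, D x -> f_ n x @[n --> \oo] --> f x) ->
  mu.-integrable D (EFin \o g) -> (forall n x, D x -> `|f_ n x| <= g x) ->
  \int[mu]_(x in D) f_ n x @[n --> \oo] --> \int[mu]_(x in D) f x.
Proof.
move=> mf_ mf f_f ig f_g.
have [| | |//| |fi _ cv] := @dominated_convergence _ _ _ mu D mD
  (fun n => EFin \o f_ n) (EFin \o f) (EFin \o g).
- by move=> n; exact/measurable_EFinP.
- exact/measurable_EFinP.
- by apply: aeW => x Dx; apply: cvg_EFin; [exact: nearW|exact: f_f].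
- by apply: aeW => x n Dx; rewrite /= lee_fin f_g.
apply: fine_cvg; rewrite fineK//; exact: integrable_fin_num.
Qed.

Lemma cintegral_dominated_cvg (f_ : nat -> T -> C) (f : T -> C) (g : T -> R) :
  (forall n, cmeasurable D (f_ n)) -> cmeasurable D f ->
  (forall x, D x -> f_ n x @[n --> \oo] --> f x) ->
  mu.-integrable D (EFin \o g) -> (forall n x, D x -> cabs (f_ n x) <= g x) ->
  cintegral mu D (f_ n) @[n --> \oo] --> cintegral mu D f.
Proof.
move=> mf_ mf f_f ig f_g; apply: (@cvg_complex R nat \oo).
  apply: (Rintegral_dominated_cvg (f_ := fun n x => Re (f_ n x)) (g := g)) => //.
  - by move=> n; case: (mf_ n).
  - by case: mf.
  - by move=> x Dx; apply: (continuous_cvg _ (@continuous_Re R _) (f_f x Dx)).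
  - by move=> n x Dx; apply: le_trans (cabs_Re _) (f_g n x Dx).
apply: (Rintegral_dominated_cvg (f_ := fun n x => Im (f_ n x)) (g := g)) => //.
- by move=> n; case: (mf_ n).
- by case: mf.
- by move=> x Dx; apply: (continuous_cvg _ (@continuous_Im R _) (f_f x Dx)).
- by move=> n x Dx; apply: le_trans (cabs_Im _) (f_g n x Dx).
Qed.

End DominatedConvergence.

(** * Gaussian integrability and vanishing integrals of derivatives *)

Section Gaussian.
Variable R : realType.
Local Notation leb := (@lebesgue_measure R).
Local Notation mR := (measurableTypeR R).

(** Up to a constant factor this is the normal density of variance [1 / (2 k)]. *)
Lemma integrable_gauss (k : R) : 0 < k ->
  leb.-integrable setT (EFin \o (fun x : mR => expR (- (k * x ^+ 2)))).
Proof.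
move=> k0; pose s := Num.sqrt ((2 * k)^-1).
have s0 : s != 0 by rewrite gt_eqF// sqrtr_gt0 invr_gt0 mulr_gt0.
have s2 : s ^+ 2 *+ 2 = k^-1.
  by rewrite sqr_sqrtr ?invr_ge0 ?mulr_ge0 ?(ltW k0)// invfM -[LHS]mulr_natl mulrA divff// mul1r.
have := integrableZl measurableT (normal_peak s)^-1 (integrable_normal_pdf 0 s).
apply: eq_integrable => // x _ /=.
rewrite (normal_pdfE _ s0) -EFinM; congr EFin; rewrite mulKf; last by rewrite gt_eqF// normal_peak_gt0.
by rewrite /normal_fun s2 invrK subr0 mulNr mulrC.
Qed.

(** Over [[- n, n]] the integral is [h n - h (- n)], which tends to 0; the Gaussian bound on [h']
    allows dominated convergence to the whole line. *)
Lemma Rintegral_derive0 (h h' : R -> R) (k c : R) : 0 < k ->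
  (forall t : R, is_derive t 1 h (h' t)) -> continuous h' ->
  (forall t, `|h t| <= c * expR (- (k * t ^+ 2))) ->
  (forall t, `|h' t| <= c * expR (- (k * t ^+ 2))) ->
  \int[leb]_(x in [set: mR]) h' x = 0.
Proof.
move=> k0 dh ch' bh bh'.
have c0 : 0 <= c.
  by have := le_trans (normr_ge0 _) (bh 0); rewrite pmulr_lge0// expR_gt0.
have mh' : measurable_fun [set: mR] h' by exact: continuous_measurable_fun.
pose J n : set mR := `[- n%:R, n%:R]%classic.
have mJ n : measurable (J n) by exact: measurable_itv.
have intJ n : \int[leb]_(x in [set: mR]) (h' \_ (J n)) x = h n%:R - h (- n%:R).
  rewrite -(Rintegral_derive (f := h) (f' := h'))//; last first.
    by rewrite ge0_cp ?ler0n// .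
  by rewrite [RHS]Rintegral_mkcond.
have gi := integrableZl measurableT c (integrable_gauss k0).
have cv : \int[leb]_(x in [set: mR]) (h' \_ (J n)) x @[n --> \oo] -->
    \int[leb]_(x in [set: mR]) h' x.
  apply: (@Rintegral_dominated_cvg _ _ _ _ _ measurableT (fun n => h' \_ (J n)) h' (fun x => c * expR (- (k * x ^+ 2)))) => //.
  - move=> n; apply/(measurable_restrictT _ _).1 => //.
    exact: measurable_funS mh'.
  - move=> x _; apply: cvg_near_cst.
    near=> n; rewrite patchE mem_set//= /J /= in_itv /= -ler_norml.
    by near: n; exact: nbhs_infty_ger.
  - move=> n x _; rewrite patchE; case: ifP => _ //.
    by rewrite normr0 mulr_ge0// expR_ge0.
have cv0 : h n%:R - h (- n%:R) @[n --> \oo] --> (0 : R).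
  have H (e : R -> R) : (forall x, e x ^+ 2 = x ^+ 2) -> h (e n%:R) @[n --> \oo] --> (0 : R).
    move=> ee; apply: norm_cvg0.
    (* From [exp y >= y] and [n^2 >= n]: [c exp (- k n^2) <= c / (k n)]. *)
    apply: (@squeeze_cvgr _ _ _ _ (fun=> 0) (fun n => c / k * n%:R^-1)).
    - near=> n; rewrite normr_ge0 /= (le_trans (bh _))// ee -mulrA ler_wpM2l//.
      have n0 : (0 < n)%N by near: n; exact: nbhs_infty_gt.
      have n1 : 1 <= n%:R :> R by rewrite ler1n.
      rewrite expRN -invfM lef_pV2 ?posrE ?expR_gt0 ?mulr_gt0//; last by rewrite (lt_le_trans ltr01).
      apply: (le_trans _ (expR_ge1Dx _)); rewrite (le_trans (y := k * n%:R ^+ 2))//; last by rewrite lerDr.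
      by rewrite ler_pM2l// expr2 ler_peMl// (le_trans ler01).
    - exact: cvg_cst.
    - rewrite -[X in _ --> X](mulr0 (c / k)); apply: cvgMr.
      apply/gtr0_cvgV0; first by near=> n; rewrite ltr0n; near: n; exact: nbhs_infty_gt.
      exact: cvgr_idn.
  rewrite -[X in _ --> X](subr0 0); apply: cvgB; first exact: (H id).
  by apply: (H -%R) => x; rewrite sqrrN.
by apply: (cvg_unique (@Rhausdorff R) cv); rewrite (funext intJ).
Unshelve. all: by end_near. Qed.

End Gaussian.

Section GaussianCoords.
Variables (R : realType) (d : nat).
Local Notation C := R[i].
Local Notation Cd := 'rV[C]_d.
Local Notation mR := (measurableTypeR R).
Local Notation R2 := (mR * mR)%type.
Local Notation leb := (@lebesgue_measure R).
Implicit Types (f : Cd -> C).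

Let g2 (k : R) (p : R2) : R := expR (- (k * p.1 ^+ 2)) * expR (- (k * p.2 ^+ 2)).

Lemma integrable_gauss2 (k : R) : 0 < k ->
  (@lebesgue_R2 R).-integrable setT (EFin \o g2 k).
Proof.
move=> k0; exact: (integrable_prodM (integrable_gauss k0) (integrable_gauss k0)).
Qed.

Lemma integrable_gauss_coords (k c : R) : 0 < k ->
  (lebesgue_Cd R d).-integrable setT
    (EFin \o (fun x => c * expR (- (k * sqn (of_realcoords x))))).
Proof.
move=> k0.
have := integrableZl measurableT c (integrable_tuple_prod d (integrable_gauss2 k0)).
apply: eq_integrable => // x _ /=; congr (_ * _)%:E.
rewrite /sqn mulr_sumr -sumrN expR_sum; apply: eq_bigr => j _.
by rewrite mxE cabs_sqr /= mulrDr opprD expRD.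
Qed.

Definition gauss_decay f := exists k c : R, 0 < k /\
  forall w, cabs (f w) <= c * expR (- (k * sqn w)).

Lemma gauss_decay_cintegrable f : continuous f -> gauss_decay f ->
  cintegrable (lebesgue_Cd R d) setT (f \o @of_realcoords R d).
Proof.
move=> cf [k [c [k0 fk]]].
apply: cintegrable_le (integrable_gauss_coords c k0) _ => //.
exact: cmeasurable_continuous_coords.
by move=> x _; exact: fk.
Qed.

Let slice_measurable n (t : n.-tuple R2) j : measurable_fun [set: R2] (tuple_set t j).
Proof.
apply/measurable_fun_tnthP => i.
rewrite (_ : _ \o _ = fun x => if i == j then x else tnth t i).
  by case: (i == j).
by apply/funext => x /=; rewrite tnth_mktuple.
Qed.

Let coords0 (t : d.-tuple R2) j (p : R2) : of_realcoords (tuple_set t j p) =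
  of_realcoords (tuple_set t j (0, p.2)) + p.1%:C *: delta_mx 0 j.
Proof.
apply/rowP => i; rewrite !mxE !tnth_mktuple eqxx /=; case: eqP => _ /=.
  by rewrite mulr1; apply/eqP; rewrite eq_complex /= add0r addr0 !eqxx.
by rewrite mulr0 addr0.
Qed.

Let coords1 (t : d.-tuple R2) j (p : R2) : of_realcoords (tuple_set t j p) =
  of_realcoords (tuple_set t j (p.1, 0)) + p.2%:C *: ('i *: delta_mx 0 j).
Proof.
apply/rowP => i; rewrite !mxE !tnth_mktuple eqxx /=; case: eqP => _ /=.
  by rewrite mulr1; apply/eqP; rewrite eq_complex /= !(mulr0, mul0r, mulr1, subr0, addr0, add0r) !eqxx.
by rewrite mulr0 mulr0 addr0.
Qed.

Let sqn_set (t : d.-tuple R2) j (p : R2) :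
  p.1 ^+ 2 + p.2 ^+ 2 <= sqn (of_realcoords (tuple_set t j p)).
Proof.
have := cabs_le_sqn (of_realcoords (tuple_set t j p)) j.
by rewrite mxE tnth_mktuple eqxx cabs_sqr.
Qed.

(** [Rintegral_derive0] kills the inner integral over the one real coordinate that moves along [v]:
    in the [j]-th plane, the second coordinate for [i e_j] and the first for [e_j]. Fubini puts that
    coordinate innermost. *)
Lemma Rintegral_line_derive0 (h h' : Cd -> R) (k c : R) j (b : bool) : 0 < k ->
  let v := (if b then 'i else 1 : C) *: delta_mx 0 j in
  (forall w (t : R), is_derive t 1 (fun s : R => h (w + s%:C *: v)) (h' (w + t%:C *: v))) ->
  continuous h' ->
  (forall w, `|h w| <= c * expR (- (k * sqn w))) ->
  (forall w, `|h' w| <= c * expR (- (k * sqn w))) ->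
  \int[lebesgue_Cd R d]_x h' (of_realcoords x) = 0.
Proof.
move=> k0 v dh ch' bh bh'.
have c0 : 0 <= c.
  by have := le_trans (normr_ge0 _) (bh 0); rewrite pmulr_lge0// expR_gt0.
have mh' := measurable_continuous_coords ch'.
have cg t p : c * expR (- (k * sqn (of_realcoords (tuple_set t j p)))) <= c * g2 k p.
  by rewrite ler_wpM2l// /g2 -expRD ler_expR -opprD lerN2 -mulrDr ler_wpM2l ?(ltW k0).
have cline w : continuous (fun s : R => h' (w + s%:C *: v)).
  move=> s; apply: (@continuous_comp _ _ _ (fun s : R => w + s%:C *: v) h'); last exact: ch'.
  apply: continuousD; first exact: cvg_cst.
  by apply: continuousZr_tmp; exact: continuous_real_complex.
rewrite /Rintegral (integral_tuple_slice0 (j := j) (f := h' \o @of_realcoords R d))//.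
  apply: le_integrable (integrable_gauss_coords c k0) => //.
    exact/measurable_EFinP.
  by move=> x _ /=; rewrite lee_fin (le_trans (bh' _))// ler_norm.
move=> t.
have fi : (leb \x leb)%E.-integrable setT
   (EFin \o (fun p : R2 => h' (of_realcoords (tuple_set t j p)))).
  have := integrableZl measurableT c (integrable_gauss2 k0).
  apply: le_integrable => //.
    apply/measurable_EFinP; exact: (measurableT_comp mh' (@slice_measurable _ t j)).
  by move=> p _ /=; rewrite lee_fin (le_trans (bh' _))// (le_trans (cg _ _))// ler_norm.
have zero (w : R -> Cd) (e : R) : (forall s, w s = w 0 + s%:C *: v) ->
    (forall s, s ^+ 2 <= sqn (w s)) ->
    (\int[leb]_s (h' (w s))%:E = 0)%E.
  move=> wE ws.
  have fin : \int[leb]_(x in [set: mR]) h' (w x) = 0.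
    apply: (@Rintegral_derive0 _ (h \o w) (h' \o w) k c) => //.
    - move=> s /=; rewrite wE; have := dh (w 0) s.
      by under eq_fun do rewrite -wE.
    - by move=> s; rewrite /= (funext wE); exact: cline.
    - move=> s /=; rewrite (le_trans (bh _))// ler_wpM2l// ler_expR lerN2 ler_wpM2l ?(ltW k0)//.
    - move=> s /=; rewrite (le_trans (bh' _))// ler_wpM2l// ler_expR lerN2 ler_wpM2l ?(ltW k0)//.
  have : leb.-integrable setT (EFin \o (h' \o w)).
    have := integrableZl measurableT c (integrable_gauss k0).
    apply: le_integrable => //.
      apply/measurable_EFinP; apply: continuous_measurable_fun.
      by move=> s; rewrite /= (funext wE); exact: cline.
    move=> s _ /=; rewrite lee_fin (le_trans (bh' _))// (le_trans _ (ler_norm _))//.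
    by rewrite ler_wpM2l// ler_expR lerN2 ler_wpM2l ?(ltW k0).
  by move=> /integrable_fin_num - /(_ measurableT) fn; rewrite -[LHS]fineK// [fine _]fin.
rewrite /lebesgue_R2; have [vE|vE] : v = 'i *: delta_mx 0 j \/ v = delta_mx 0 j by rewrite /v; case: (b); [left|right; rewrite scale1r].
  rewrite -(integral12_prod_meas1 fi) /fubini_F integral0_eq// => x _.
  apply: (zero (fun y => of_realcoords (tuple_set t j (x, y))) 0) => s.
    by rewrite coords1 vE.
  by rewrite (le_trans _ (sqn_set _ _ _))//= lerDr sqr_ge0.
rewrite -(integral21_prod_meas1 fi) /fubini_G integral0_eq// => y _.
apply: (zero (fun x => of_realcoords (tuple_set t j (x, y))) 0) => s.
  by rewrite coords0 vE.
by rewrite (le_trans _ (sqn_set _ _ _))//= lerDl sqr_ge0.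
Qed.

Lemma cintegral_line_derive0 (h h' : Cd -> C) j (b : bool) :
  let v := (if b then 'i else 1 : C) *: delta_mx 0 j in
  (forall w t, path_derive (fun s : R => h (w + s%:C *: v)) t (h' (w + t%:C *: v))) ->
  continuous h' -> gauss_decay h -> gauss_decay h' ->
  cintegral (lebesgue_Cd R d) setT (h' \o @of_realcoords R d) = 0.
Proof.
move=> v dh ch' [k [c [k0 bh]]] [k' [c' [k'0 bh']]].
pose m := Num.min k k'; pose M := Num.max c c'.
have m0 : 0 < m by rewrite lt_min k0.
have M0 : 0 <= M by rewrite le_max (cabs_le_nonneg (bh 0)).
have H (l a : R) w : m <= l -> a <= M -> a * expR (- (l * sqn w)) <= M * expR (- (m * sqn w)).
  move=> ml aM; apply: (le_trans (y := M * expR (- (l * sqn w)))).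
    by rewrite ler_wpM2r// expR_ge0.
  by rewrite ler_wpM2l// ler_expR lerN2 ler_wpM2r// sqn_ge0.
have hM w : cabs (h w) <= M * expR (- (m * sqn w)).
  by rewrite (le_trans (bh w))// H// /m /M ?ge_min ?le_max lexx.
have h'M w : cabs (h' w) <= M * expR (- (m * sqn w)).
  by rewrite (le_trans (bh' w))// H// /m /M ?ge_min ?le_max lexx orbT.
have zero (g : C -> R) : continuous g -> (forall x, `|g x| <= cabs x) ->
    (forall w t, is_derive (t : R) 1 (fun s : R => g (h (w + s%:C *: v))) (g (h' (w + t%:C *: v)))) ->
    \int[lebesgue_Cd R d]_x g (h' (of_realcoords x)) = 0.
  move=> cg gle dg.
  apply: (@Rintegral_line_derive0 (g \o h) (g \o h') m M j b m0) => //.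
  - by move=> w; apply: continuous_comp; [exact: ch'|exact: cg].
  - by move=> w; rewrite (le_trans (gle _)).
  - by move=> w; rewrite (le_trans (gle _)).
have := zero (@complex.Re R) (@continuous_Re R) (@cabs_Re R) (fun w t => proj1 (dh w t)).
have := zero (@complex.Im R) (@continuous_Im R) (@cabs_Im R) (fun w t => proj2 (dh w t)).
by rewrite /cintegral => /= -> ->.
Qed.

End GaussianCoords.

(** * Sums and linear functionals *)

Section HolomorphicSums.
Variables (R : realType) (V : normedModType R[i]).
Local Notation C := R[i].
Implicit Types (G H : V -> C) (x u v : V).

Lemma deriveD_at G H x u : derivable G x u -> derivable H x u ->
  derivable (fun y => G y + H y) x u /\
  'D_u (fun y => G y + H y) x = 'D_u G x + 'D_u H x.
Proof. by move=> dG dH; split; [exact: derivableD|exact: deriveD]. Qed.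

Lemma holD G H : hol G -> hol H -> hol (fun y => G y + H y).
Proof.
move=> [cG dG lG] [cH dH lH]; split.
- exact: (ccontinuousD cG cH).
- by move=> x v; have [] := deriveD_at (dG x v) (dH x v).
- move=> x k u v.
  have [_ ->] := deriveD_at (dG x (k *: u + v)) (dH x (k *: u + v)).
  have [_ ->] := deriveD_at (dG x u) (dH x u).
  have [_ ->] := deriveD_at (dG x v) (dH x v).
  by rewrite lG lH mulrDr addrACA.
Qed.

Lemma hol_sum (I : Type) (s : seq I) (G : I -> V -> C) : (forall i, hol (G i)) ->
  hol (fun y => \sum_(i <- s) G i y) /\
  forall x u, 'D_u (fun y => \sum_(i <- s) G i y) x = \sum_(i <- s) 'D_u (G i) x.
Proof.
move=> hG; elim: s => [|i s [IH1 IH2]].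
  have -> : (fun y => \sum_(i <- [::]) G i y) = (fun=> 0).
    by apply/funext => y; rewrite big_nil.
  split; first exact: hol_cst.
  by move=> x u; rewrite big_nil; have [_ ->] := derive_cst_at (0 : C) x u.
have -> : (fun y => \sum_(i <- i :: s) G i y) = (fun y => G i y + \sum_(i <- s) G i y).
  by apply/funext => y; rewrite big_cons.
split; first exact: (holD (hG i) IH1).
move=> x u; rewrite big_cons -IH2.
by have [_ ->] := deriveD_at (@hol_derivable R V _ (hG i) x u) (@hol_derivable R V _ IH1 x u).
Qed.

Lemma hol_linear (L : V -> C) : continuous L ->
  (forall (k : C) u v, L (k *: u + v) = k * L u + L v) ->
  hol L /\ forall x u, 'D_u L x = L u.
Proof.
move=> cL Llin.
have AL x (k : C) u : L (x + k *: u) = L x + k *: L u by rewrite addrC Llin addrC.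
have hid : hol (fun x : C => x).
  split; [exact: ccontinuous_id|by move=> x v; exact: derivable_id|].
  by move=> x k u v; rewrite !derive_id.
split; first exact: (@hol_affine R V C L L AL cL Llin _ hid).
move=> x u.
have [_ ->] := @derive_affine_at R V C L L AL _ x u (@hol_derivable R C _ hid (L x) (L u)).
exact: derive_id.
Qed.

End HolomorphicSums.

Local Opaque derive hol.

(** * Integration by parts on the antidiagonal *)

Section Antidiagonal.
Variables (R : realType) (d : nat).
Local Notation C := R[i].
Local Notation Cd := 'rV[C]_d.
Local Notation V := (Cd * Cd)%type.
Implicit Types (G H K M : V -> C) (h : Cd -> C) (z w u v : Cd) (j : 'I_d).

Definition antidiag w : V := (w, conjv w).

Lemma continuous_antidiag : continuous antidiag.
Proof.
move=> w; apply: (@cvg_pair _ _ _ (nbhs w) (nbhs w) (nbhs (conjv w))).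
  exact: cvg_id.
apply: (@cvg_row R d Cd (nbhs w)) => j; rewrite mxE.
under eq_fun do rewrite mxE.
by apply: (@continuous_comp _ _ _ (fun u : Cd => u 0 j) (@conjc R)); [exact: coord_continuous|exact: continuous_conjc].
Qed.

Lemma hol_fst_coord j : hol (fun x : V => x.1 0 j) /\
  forall (x u : V), 'D_u (fun y : V => y.1 0 j) x = u.1 0 j.
Proof.
apply: hol_linear => [x|k u v]; last by rewrite !mxE.
by apply: (@continuous_comp _ _ _ (fst : V -> Cd) (fun u : Cd => u 0 j)); [exact: cvg_fst|exact: coord_continuous].
Qed.

Lemma hol_snd_coord j : hol (fun x : V => x.2 0 j) /\
  forall (x u : V), 'D_u (fun y : V => y.2 0 j) x = u.2 0 j.
Proof.
apply: hol_linear => [x|k u v]; last by rewrite !mxE.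
by apply: (@continuous_comp _ _ _ (snd : V -> Cd) (fun u : Cd => u 0 j)); [exact: cvg_snd|exact: coord_continuous].
Qed.

Lemma hol_fst h : hol h -> hol (fun x : V => h x.1).
Proof. by move=> hh; apply: (@hol_affine R V Cd fst fst) => // x; exact: cvg_fst. Qed.

Lemma derive_snd_fst h j (x : V) : hol h -> 'D_(snd_dir R j) (fun y : V => h y.1) x = 0.
Proof.
move=> hh.
have [_ ->] := @derive_affine_at R V Cd fst fst (fun _ _ _ => erefl) h x (snd_dir R j)
  (@hol_derivable R Cd h hh _ _).
exact: hol_derive0.
Qed.

(** With [z] frozen, this is the symbol of the operator to be expanded. *)
Lemma hol_snd z G : hol G -> hol (fun x : V => G (z, x.2)).
Proof.
move=> hG; pose A (x : V) : V := (z, x.2); pose L (x : V) : V := (0, x.2).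
have AL (x : V) (k : C) (u : V) : A (x + k *: u) = A x + k *: L u.
  by congr pair; rewrite /= scaler0 addr0.
have Llin (k : C) (u v : V) : L (k *: u + v) = k *: L u + L v.
  by congr pair; rewrite /= scaler0 addr0.
have cA : continuous A.
  move=> x; apply: (@cvg_pair _ _ _ (nbhs x) (nbhs z) (nbhs x.2)); first exact: cvg_cst.
  exact: cvg_snd.
exact: (@hol_affine R V V A L AL cA Llin G hG).
Qed.

Definition antidiag_integral M : C :=
  cintegral (lebesgue_Cd R d) setT (fun x => M (antidiag (of_realcoords x))).

Definition antidiag_integrable M : Prop :=
  cintegrable (lebesgue_Cd R d) setT (fun x => M (antidiag (of_realcoords x))).

Lemma antidiag_integralD G H : antidiag_integrable G -> antidiag_integrable H ->
  antidiag_integral (fun x => G x + H x) = antidiag_integral G + antidiag_integral H.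
Proof. exact: (cintegralD measurableT). Qed.

Lemma antidiag_integrableZ (c : C) G : antidiag_integrable G ->
  antidiag_integrable (fun x => c * G x).
Proof. exact: (cintegrableZ measurableT). Qed.

Lemma antidiag_integralZ (c : C) G : antidiag_integrable G ->
  antidiag_integral (fun x => c * G x) = c * antidiag_integral G.
Proof. exact: (cintegralZ measurableT). Qed.

Lemma antidiag_integrable_sum (I : Type) (s : seq I) (P : pred I) (G : I -> V -> C) :
  (forall i, P i -> antidiag_integrable (G i)) ->
  antidiag_integrable (fun x => \sum_(i <- s | P i) G i x).
Proof.
move=> Gi; exact: (@cintegrable_sum _ _ _ _ _ measurableT I s P
  (fun i x => G i (antidiag (of_realcoords x)))).
Qed.

Lemma antidiag_integral_sum (I : Type) (s : seq I) (P : pred I) (G : I -> V -> C) :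
  (forall i, P i -> antidiag_integrable (G i)) ->
  antidiag_integral (fun x => \sum_(i <- s | P i) G i x) =
  \sum_(i <- s | P i) antidiag_integral (G i).
Proof.
move=> Gi; exact: (@cintegral_sum _ _ _ _ _ measurableT I s P
  (fun i x => G i (antidiag (of_realcoords x)))).
Qed.

Lemma diag_growth_decay (k : R) M : k < 0 -> diag_growth k M ->
  gauss_decay (fun w => M (antidiag w)).
Proof.
move=> k0 gM; have e0 : 0 < - k / 2 by rewrite divr_gt0// oppr_gt0.
have kE : k + - k / 2 = - (- k / 2) by lra.
have [c cP] := gM _ e0; exists (- k / 2), c; split => // w.
have := cP w 0 0; rewrite !addr0 sqn0 kE mulNr; apply; exact: ler01.
Qed.

(** Cauchy's estimate leaves the antidiagonal by a unit vector in each component; this is why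
    [diag_growth] controls a unit neighbourhood. *)
Lemma diag_growth_derive_decay (k : R) M (v : V) : k < 0 -> hol M ->
  diag_growth k M -> sqn v.1 <= 1 -> sqn v.2 <= 1 ->
  gauss_decay (fun w => 'D_v M (antidiag w)).
Proof.
move=> k0 hM gM v1 v2; have e0 : 0 < - k / 2 by rewrite divr_gt0// oppr_gt0.
have kE : k + - k / 2 = - (- k / 2) by lra.
have [c cP] := gM _ e0; exists (- k / 2), (2 * c); split => // w.
rewrite -mulrA; apply: cabs_derive_le => // e e1.
have := cP w (e *: v.1) (e *: v.2); rewrite !sqnZ e1 expr1n !mul1r kE mulNr.
by apply.
Qed.

Lemma antidiag_integrableP (k : R) M : k < 0 -> continuous M -> diag_growth k M ->
  antidiag_integrable M.
Proof.
move=> k0 cM gM.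
apply: (@gauss_decay_cintegrable R d (fun w => M (antidiag w))); last exact: diag_growth_decay gM.
by move=> w; apply: (@continuous_comp _ _ _ antidiag M); [exact: continuous_antidiag|exact: cM].
Qed.

Let real_dir (b : bool) j : Cd := (if b then 'i else 1 : C) *: delta_mx 0 j.

Let sqn_real_dir b j : sqn (real_dir b j) <= 1.
Proof.
rewrite sqnZ sqn_delta mulr1; case: b; last by rewrite cabs_real normr1 expr1n.
by rewrite cabs_sqr /= expr0n add0r expr1n.
Qed.

(** The directions [(u, conjv u)] with [u = e_j] and [u = i e_j] are tangent to the antidiagonal, so
    derivatives along them are real partial derivatives of the restriction and integrate to 0. Both
    are integrable, so a complex combination of them integrates to 0 as well. *)
Lemma antidiag_integral_derive_snd0 (k : R) M j : k < 0 -> hol M -> diag_growth k M ->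
  antidiag_integral ('D_(snd_dir R j) M) = 0.
Proof.
move=> k0 hM gM; pose e b : V := antidiag (real_dir b j).
have decay b : gauss_decay (fun w => 'D_(e b) M (antidiag w)).
  apply: (@diag_growth_derive_decay k) => //=; rewrite ?sqn_conjv; exact: sqn_real_dir.
have cont b : continuous (fun w => 'D_(e b) M (antidiag w)).
  move=> w; apply: (@continuous_comp _ _ _ antidiag ('D_(e b) M)); first exact: continuous_antidiag.
  exact: (@hol_derive_continuous R V M (e b) hM (antidiag w)).
have int b : antidiag_integrable ('D_(e b) M).
  exact: (gauss_decay_cintegrable (@cont b) (decay b)).
have zero b : antidiag_integral ('D_(e b) M) = 0.
  apply: (@cintegral_line_derive0 R d (fun w => M (antidiag w))
    (fun w => 'D_(e b) M (antidiag w)) j b _ (@cont b) _ (decay b)).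
    move=> w t; have lineE s : antidiag (w + s%:C *: real_dir b j) = antidiag w + s%:C *: e b.
      by congr pair; rewrite conjv_line conjc_real.
    rewrite lineE; under [X in path_derive X _ _]eq_fun do rewrite lineE.
    exact: hol_path_derive.
  exact: diag_growth_decay gM.
(* The direction form of [dbar = (d_x + i d_y) / 2]: the first components give [1/2 + i i / 2 = 0],
   the second [1/2 - i i / 2 = 1]. *)
have sndE : snd_dir R j = 2^-1 *: e false + (2^-1 * 'i) *: e true.
  have h : 2^-1 + 2^-1 = 1 :> C by rewrite -mulr2n -[LHS]mulr_natr mulVf// pnatr_eq0.
  have ii : 'i * 'i = -1 :> C by rewrite -expr2 sqr_i.
  have ci : conjc 'i = - 'i :> C by apply/eqP; rewrite eq_complex /= oppr0 !eqxx.
  have c1 : conjc 1 = 1 :> C by apply/eqP; rewrite eq_complex /= oppr0 !eqxx.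
  have vE b : conjv (real_dir b j) = conjc (if b then 'i else 1) *: delta_mx 0 j.
    by have := conjv_line 0 (delta_mx 0 j) (if b then 'i else 1 : C); rewrite !add0r conjv_delta => ->; rewrite /conjv map_mx0 add0r.
  have h1 : 2^-1 * 1 + 2^-1 * 'i * 'i = 0 :> C by rewrite -mulrA -mulrDr ii subrr mulr0.
  have h2 : 2^-1 * 1 + 2^-1 * 'i * - 'i = 1 :> C.
    by rewrite mulrN -mulrA ii mulrN1 opprK mulr1 h.
  congr pair.
    by rewrite /= /real_dir !scalerA -scalerDl h1 scale0r.
  by rewrite /= !vE c1 ci !scalerA -scalerDl h2 scale1r.
have lin (p q : C) (u v : V) : snd_dir R j = p *: u + q *: v ->
    antidiag_integrable ('D_u M) -> antidiag_integral ('D_u M) = 0 ->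
    antidiag_integrable ('D_v M) -> antidiag_integral ('D_v M) = 0 ->
    antidiag_integral ('D_(snd_dir R j) M) = 0.
  move=> -> iu u0 iv v0.
  have -> : 'D_(p *: u + q *: v) M = fun x => p * 'D_u M x + q * 'D_v M x.
    by apply/funext => x; rewrite (hol_deriveD x _ _ hM) !(hol_deriveZ x _ _ hM).
  rewrite (antidiag_integralD (antidiag_integrableZ p iu) (antidiag_integrableZ q iv)).
  have pu : antidiag_integral (fun x => p * 'D_u M x) = 0.
    by rewrite (antidiag_integralZ p iu) u0 mulr0.
  have qv : antidiag_integral (fun x => q * 'D_v M x) = 0.
    by rewrite (antidiag_integralZ q iv) v0 mulr0.
  by rewrite [X in X + _]pu [X in _ + X]qv addr0.
exact: (lin _ _ _ _ sndE (int false) (zero false) (int true) (zero true)).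
Qed.

End Antidiagonal.

(** * The damped kernel and integration by parts *)

Section Kernel.
Variables (R : realType) (d : nat).
Local Notation C := R[i].
Local Notation Cd := 'rV[C]_d.
Local Notation V := (Cd * Cd)%type.
Variables (z : Cd) (s : R).
Implicit Types (G H K M : V -> C) (h : Cd -> C) (w u v : Cd) (j : 'I_d).

(* At [(w, conj w)] the phase is [(z - w, w) - (s - 1) |z - w|^2]. *)
Definition phase (x : V) : C :=
  \sum_j (z 0 j - x.1 0 j) * (s%:C * x.2 0 j - (s - 1)%:C * conjc (z 0 j)).

Definition kernel (x : V) : C := cexp (phase x).

Let phase_left j : hol (fun x : V => z 0 j - x.1 0 j) /\
  forall x u : V, 'D_u (fun y : V => z 0 j - y.1 0 j) x = - u.1 0 j.
Proof.
have cL : continuous (fun x : V => - x.1 0 j).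
  by move=> x; apply: cvgN; exact: (@hol_continuous R V _ (hol_fst_coord R j).1 x).
have Llin (k : C) (u v : V) : - (k *: u + v).1 0 j = k * - u.1 0 j - v.1 0 j.
  by rewrite !mxE mulrN opprD.
have [h1 d1] := @hol_linear R V _ cL Llin.
split; first exact: (holD (hol_cst V (z 0 j)) h1).
move=> x u; have [dc Dc] := @derive_cst_at R V (z 0 j) x u.
by have [_ ->] := deriveD_at dc (@hol_derivable R V _ h1 x u); rewrite Dc d1 add0r.
Qed.

Let phase_right j : hol (fun x : V => s%:C * x.2 0 j - (s - 1)%:C * conjc (z 0 j)) /\
  forall x u : V, 'D_u (fun y : V => s%:C * y.2 0 j - (s - 1)%:C * conjc (z 0 j)) x =
    s%:C * u.2 0 j.
Proof.
have Llin (k : C) (u v : V) : s%:C * (k *: u + v).2 0 j = k * (s%:C * u.2 0 j) + s%:C * v.2 0 j.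
  by rewrite !mxE mulrDr mulrCA.
have cL := ccontinuousM (@ccontinuous_cst R V s%:C) (@hol_continuous R V _ (hol_snd_coord R j).1).
have [h1 d1] := @hol_linear R V _ cL Llin.
set c := - (_ * conjc _).
split; first exact: (holD h1 (hol_cst V c)).
move=> x u; have [dc Dc] := @derive_cst_at R V c x u.
by have [_ ->] := deriveD_at (@hol_derivable R V _ h1 x u) dc; rewrite Dc d1 addr0.
Qed.

Let hol_phase : hol phase /\
  forall x j, 'D_(snd_dir R j) phase x = s%:C * (z 0 j - x.1 0 j).
Proof.
have [h1 d1] := @hol_sum R V 'I_d (index_enum 'I_d) _
  (fun j => holM (phase_left j).1 (phase_right j).1).
split=> // x j; rewrite d1 (bigD1 j)//= big1 => [|i ij].
  have [_ ->] := deriveM_at (@hol_derivable R V _ (phase_left j).1 x (snd_dir R j))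
    (@hol_derivable R V _ (phase_right j).1 x (snd_dir R j)).
  rewrite (phase_left j).2 (phase_right j).2 /= !mxE !eqxx /=.
  by rewrite oppr0 mul0r add0r addr0 mulr1 mulrC.
have [_ ->] := deriveM_at (@hol_derivable R V _ (phase_left i).1 x (snd_dir R j))
  (@hol_derivable R V _ (phase_right i).1 x (snd_dir R j)).
rewrite (phase_left i).2 (phase_right i).2 /= !mxE eqxx (negbTE ij) /=.
by rewrite oppr0 mul0r mulr0 mulr0 addr0.
Qed.

Lemma hol_kernel : hol kernel.
Proof. exact: (hol_cexp hol_phase.1). Qed.

Lemma derive_kernel j (x : V) :
  'D_(snd_dir R j) kernel x = kernel x * (s%:C * (z 0 j - x.1 0 j)).
Proof.
have [_ ->] := derive_cexp_at (@hol_derivable R V _ hol_phase.1 x (snd_dir R j)).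
by rewrite hol_phase.2.
Qed.

Lemma kernel_antidiag w : kernel (antidiag w) =
  cexp (inner (z - w) w) * (expR (- ((s - 1) * sqn (z - w))))%:C.
Proof.
have -> : (expR (- ((s - 1) * sqn (z - w))))%:C = cexp (- ((s - 1) * sqn (z - w)))%:C.
  by rewrite /cexp /= cos0 sin0 mulr1.
rewrite -cexpD; congr cexp; rewrite /inner /phase /sqn.
rewrite mulr_sumr -sumrN (raddf_sum (real_complex R)) -big_split /=.
apply: eq_bigr => j _; rewrite !mxE.
(* Substituting [conj z = conj w + conj (z - w)] in the phase separates the damping
   [- (s - 1) |z - w|^2]. *)
have cj : conjc (z 0 j) = conjc (w 0 j) + conjc (z 0 j - w 0 j).
  by rewrite -raddfD /= addrC subrK.
have sq (x : C) : x * conjc x = (cabs x ^+ 2)%:C.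
  by rewrite cabs_sqr; case: x => a b; apply/eqP; rewrite eq_complex /=; apply/andP; split; apply/eqP; ring.
rewrite cj rmorphN rmorphM /= -sq rmorphB rmorph1 /=.
move: (z 0 j - w 0 j) (conjc _) (conjc _) (s%:C) => a b c t; ring.
Qed.

(** The phase has the quadratic part [- s |w|^2]; the terms linear in w are absorbed by Young's
    inequality at the price of [e]. *)
Lemma diag_growth_kernel : 1 <= s -> diag_growth (- s) kernel.
Proof.
move=> s1 e e0; have s0 : 0 <= s by rewrite (le_trans ler01).
(* [m j] bounds [A = z_j - p_j], and [s * m j] bounds [B = s q_j - (s - 1) conj z_j]. In [c j] the
   first term completes the square for the cross terms [2 s m t], and the second bounds [A B]. *)
pose m j := cabs (z 0 j) + 1.
pose c j := s ^+ 2 * m j ^+ 2 / e + s * m j ^+ 2.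
exists (expR (\sum_j c j)) => w p q p1 q1.
rewrite cabs_cexp -expRD ler_expR /sqn mulr_sumr -big_split /=.
rewrite /phase (raddf_sum (@complex.Re R)); apply: ler_sum => j _.
rewrite !mxE.
have pj : cabs (p 0 j) <= 1.
  by rewrite -(ler_pXn2r (n := 2))// ?nnegrE ?cabs_ge0// expr1n (le_trans (cabs_le_sqn p j)).
have qj : cabs (q 0 j) <= 1.
  by rewrite -(ler_pXn2r (n := 2))// ?nnegrE ?cabs_ge0// expr1n (le_trans (cabs_le_sqn q j)).
have m0 : 0 <= m j by rewrite addr_ge0 ?cabs_ge0.
pose A := z 0 j - p 0 j; pose B := s%:C * q 0 j - (s - 1)%:C * conjc (z 0 j).
have Am : cabs A <= m j by rewrite (le_trans (cabsB _ _))// lerD2l.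
have Bm : cabs B <= s * m j.
  rewrite (le_trans (cabsB _ _))// !cabsM !cabs_real cabs_conjc ger0_norm// ger0_norm ?subr_ge0//.
  have h1 : s * cabs (q 0 j) <= s by rewrite ler_piMr.
  have h2 : (s - 1) * cabs (z 0 j) = s * cabs (z 0 j) - cabs (z 0 j) by ring.
  by have := cabs_ge0 (z 0 j); rewrite h2 /m mulrDr mulr1; lra.
move: (w 0 j) => x.
have -> : (z 0 j - (x + p 0 j)) * (s%:C * (conjc x + q 0 j) - (s - 1)%:C * conjc (z 0 j)) =
    - (s%:C * (x * conjc x)) + (s%:C * (A * conjc x) - B * x + A * B).
  rewrite /A /B; move: x (z 0 j) (conjc (z 0 j)) (conjc x) (p 0 j) (q 0 j) (s%:C) ((s - 1)%:C) => *; ring.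
rewrite -[X in X <= _]/(complex.Re _) ReD.
have -> : Re (- (s%:C * (x * conjc x))) = - s * cabs x ^+ 2.
  by rewrite ReN cabs_sqr; case: (x) => a b /=; ring.
set t := cabs x.
have t0 : 0 <= t by exact: cabs_ge0.
have sm0 : 0 <= s * m j by rewrite mulr_ge0.
have hY : Re (s%:C * (A * conjc x) - B * x + A * B) <= s * m j * t + s * m j * t + m j * (s * m j).
  rewrite (le_trans (ler_norm _))// (le_trans (cabs_Re _))// (le_trans (cabsD _ _))//.
  rewrite lerD//; last by rewrite cabsM ler_pM ?cabs_ge0.
  rewrite (le_trans (cabsB _ _))// lerD//.
    by rewrite !cabsM cabs_real cabs_conjc ger0_norm// mulrA ler_wpM2r// ler_wpM2l.
  by rewrite cabsM ler_wpM2r.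
have h : 0 <= (s * m j - e * t) ^+ 2 / e by rewrite divr_ge0 ?sqr_ge0// ltW.
have hE : (s * m j - e * t) ^+ 2 / e =
    s ^+ 2 * m j ^+ 2 / e - 2 * (s * m j * t) + e * t ^+ 2 by field; rewrite gt_eqF.
move: h hY; rewrite hE /c.
have -> : m j * (s * m j) = s * m j ^+ 2 by ring.
have -> : (- s + e) * t ^+ 2 = - s * t ^+ 2 + e * t ^+ 2 by ring.
lra.
Qed.


Hypothesis s1 : 1 < s.

(** Contains the functions on which the operators act and is stable under the factors [z_j - u_j],
    which cost no Gaussian rate. *)
Definition subexp h := hol h /\ diag_growth 0 (fun x : V => h x.1).

Lemma subexpM_coord h j : subexp h -> subexp (fun u => (z 0 j - u 0 j) * h u).
Proof.
move=> [hh gh]; split; last first.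
  by have := diag_growthM (diag_growth_coord z j) gh; rewrite addr0.
have cc : continuous (fun u : Cd => u 0 j) by exact: coord_continuous.
have cL : continuous (fun u : Cd => - u 0 j) by move=> u; exact: (cvgN (@cc u)).
have Llin (k : C) (u v : Cd) : - (k *: u + v) 0 j = k * - u 0 j - v 0 j.
  by rewrite !mxE mulrN opprD.
have [h1 _] := @hol_linear R Cd _ cL Llin.
exact: (holM (holD (hol_cst Cd (z 0 j)) h1) hh).
Qed.

Lemma gauss_growth_iter (v : V) n G : hol G -> gauss_growth G ->
  gauss_growth (iter n (fun K => 'D_v K) G).
Proof.
move=> hG gG; elim: n => [|n IH]; first exact: gG.
exact: (gauss_growth_derive v (hol_iter_derive v n hG) IH).
Qed.

Lemma gauss_growth_dir_derive l (e : 'I_d -> V) alpha G : hol G -> gauss_growth G ->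
  gauss_growth (dir_derive l e alpha G).
Proof.
move=> hG gG; elim: l => [|j l IH]; first exact: gG.
exact: (gauss_growth_iter (e j) (alpha j) (hol_dir_derive l e alpha hG) IH).
Qed.

(** [h] sees only the holomorphic variable, so a derivative in conj w falls on [K] and on the kernel
    alone. *)
Definition weighted K h : V -> C := fun x => K x * h x.1 * kernel x.

Lemma hol_weighted K h : hol K -> subexp h -> hol (weighted K h).
Proof. by move=> hK [hh _]; exact: (holM (holM hK (hol_fst hh)) hol_kernel). Qed.

(** Rate 1 of the symbol against [- s] of the kernel: the margin [s - 1] is exactly what damping
    provides. *)
Lemma diag_growth_weighted K h : gauss_growth K -> subexp h ->
  diag_growth (1 - s) (weighted K h).
Proof.
move=> gK [_ gh]; have := diag_growthM (diag_growthM (gauss_diag_growth gK) gh)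
  (diag_growth_kernel (ltW s1)).
by rewrite addr0.
Qed.

Lemma integrable_weighted K h : hol K -> gauss_growth K -> subexp h ->
  antidiag_integrable (weighted K h).
Proof.
move=> hK gK hh; have k0 : 1 - s < 0 by rewrite subr_lt0.
exact: (antidiag_integrableP k0 (hol_continuous (hol_weighted hK hh)) (diag_growth_weighted gK hh)).
Qed.

(** The factor [z_j - u_j] from the kernel is moved into [h], so that the right-hand side has the
    same form and the identity can be iterated. *)
Lemma antidiag_integral_by_parts K h j : hol K -> gauss_growth K -> subexp h ->
  antidiag_integral (weighted ('D_(snd_dir R j) K) h) =
  - s%:C * antidiag_integral (weighted K (fun u => (z 0 j - u 0 j) * h u)).
Proof.
move=> hK gK hh; have k0 : 1 - s < 0 by rewrite subr_lt0.
have hc := subexpM_coord j hh.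
have i1 := integrable_weighted (hol_derive (snd_dir R j) hK) (gauss_growth_derive (snd_dir R j) hK gK) hh.
have i2 := integrable_weighted hK gK hc.
have E0 := antidiag_integral_derive_snd0 j k0 (hol_weighted hK hh) (diag_growth_weighted gK hh).
have E1 := antidiag_integralD i1 (antidiag_integrableZ s%:C i2).
have E2 := antidiag_integralZ s%:C i2.
apply/eqP; rewrite mulNr -addr_eq0 -E2; apply/eqP; apply: (etrans (esym E1)).
apply: (etrans _ E0); congr antidiag_integral; apply/funext => x.
have hf := hol_fst hh.1.
have [_ ->] := deriveM_at (@hol_derivable R V _ (holM hK hf) x (snd_dir R j))
  (@hol_derivable R V _ hol_kernel x (snd_dir R j)).
have [_ ->] := deriveM_at (@hol_derivable R V _ hK x (snd_dir R j))
  (@hol_derivable R V _ hf x (snd_dir R j)).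
rewrite derive_kernel (derive_snd_fst _ _ hh.1) /weighted.
move: ('D_(snd_dir R j) K x) (K x) (h x.1) (kernel x) (s%:C) (z 0 j - x.1 0 j) => *; ring.
Qed.

Lemma integral_by_parts_iter K h j n : hol K -> gauss_growth K -> subexp h ->
  subexp (fun u => (z 0 j - u 0 j) ^+ n * h u) /\
  antidiag_integral (weighted (iter n (fun K => 'D_(snd_dir R j) K) K) h) =
  (- s%:C) ^+ n * antidiag_integral (weighted K (fun u => (z 0 j - u 0 j) ^+ n * h u)).
Proof.
move=> hK gK; elim: n h => [|n IH] h hh.
  have -> : (fun u => (z 0 j - u 0 j) ^+ 0 * h u) = h by apply/funext => u; rewrite expr0 mul1r.
  by rewrite expr0 mul1r.
have hc := subexpM_coord j hh; have [h1 E1] := IH _ hc.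
have <- : (fun u => (z 0 j - u 0 j) ^+ n * ((z 0 j - u 0 j) * h u)) =
    (fun u => (z 0 j - u 0 j) ^+ n.+1 * h u).
  by apply/funext => u; rewrite mulrA -exprSr.
split; first exact: h1.
have E0 := antidiag_integral_by_parts j (hol_iter_derive (snd_dir R j) n hK)
  (gauss_growth_iter (snd_dir R j) n hK gK) hh.
by apply: (etrans E0); rewrite [X in _ * X]E1 mulrA -exprS.
Qed.

Lemma integral_by_parts_dir K h l alpha : hol K -> gauss_growth K -> subexp h ->
  subexp (fun u => (\prod_(j <- l) (z 0 j - u 0 j) ^+ alpha j) * h u) /\
  antidiag_integral (weighted (dir_derive l (@snd_dir R d) alpha K) h) =
  (- s%:C) ^+ (\sum_(j <- l) alpha j) *
    antidiag_integral (weighted K (fun u => (\prod_(j <- l) (z 0 j - u 0 j) ^+ alpha j) * h u)).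
Proof.
move=> hK gK; elim: l h => [|j l IH] h hh.
  have -> : (fun u => (\prod_(j <- [::]) (z 0 j - u 0 j) ^+ alpha j) * h u) = h.
    by apply/funext => u; rewrite big_nil mul1r.
  by rewrite big_nil expr0 mul1r.
have [h1 E1] := integral_by_parts_iter j (alpha j) (hol_dir_derive l (@snd_dir R d) alpha hK)
  (gauss_growth_dir_derive l (@snd_dir R d) alpha hK gK) hh.
have [h2 E2] := IH _ h1.
have <- : (fun u => (\prod_(i <- l) (z 0 i - u 0 i) ^+ alpha i) * ((z 0 j - u 0 j) ^+ alpha j * h u)) =
    (fun u => (\prod_(i <- j :: l) (z 0 i - u 0 i) ^+ alpha i) * h u).
  by apply/funext => u; rewrite big_cons mulrA [X in X * _]mulrC.
split; first exact: h2.
by apply: (etrans E1); rewrite [X in _ * X]E2 big_cons exprD mulrA.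
Qed.

Lemma integral_by_parts_dw K h alpha : hol K -> gauss_growth K -> subexp h ->
  subexp (fun u => mpow (z - u) alpha * h u) /\
  antidiag_integral (weighted (dw alpha K) h) =
  (- s%:C) ^+ mabs alpha * antidiag_integral (weighted K (fun u => mpow (z - u) alpha * h u)).
Proof.
move=> hK gK hh; have := integral_by_parts_dir (enum 'I_d) alpha hK gK hh.
have -> : (fun u => (\prod_(j <- enum 'I_d) (z 0 j - u 0 j) ^+ alpha j) * h u) =
    (fun u => mpow (z - u) alpha * h u).
  apply/funext => u; rewrite big_enum /mpow /=; congr (_ * _).
  by apply: eq_bigr => j _; rewrite !mxE.
by rewrite big_enum.
Qed.

End Kernel.

(** * Holomorphy and growth of the Taylor remainder *)

Section TaylorRemainder.
Variables (R : realType) (d : nat).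
Local Notation C := R[i].
Local Notation Cd := 'rV[C]_d.
Local Notation V := (Cd * Cd)%type.
Variables (z : Cd) (N : nat).
Implicit Types (G H K : V -> C) (w u v : Cd) (j : 'I_d).

Let seg (t : R) (x : V) : V := (x.1 + t%:C *: (z - x.1), x.2).
(** The linear part of the affine map [seg t]. *)
Let lin (t : R) (x : V) : V := ((1 - t)%:C *: x.1, x.2).
Let slice H (t : R) (x : V) : C := ((1 - t) ^+ N)%:C * H (seg t x).

Let ler01R : 0 <= 1 :> R. Proof. exact: ler01. Qed.

Let cseg : continuous (fun p : R * V => seg p.1 p.2).
Proof.
move=> p; have c1 : continuous (fun p : R * V => p.2.1).
  by move=> q; apply: (@continuous_comp _ _ _ (snd : R * V -> V) fst); [exact: cvg_snd|exact: cvg_fst].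
have ct : continuous (fun p : R * V => p.1%:C).
  move=> q; apply: (@continuous_comp _ _ _ (fst : R * V -> R) (@real_complex R)).
    exact: cvg_fst.
  exact: continuous_real_complex.
apply: (@cvg_pair _ _ _ (nbhs p) (nbhs (p.2.1 + p.1%:C *: (z - p.2.1))) (nbhs p.2.2)); last first.
  by apply: (@continuous_comp _ _ _ (snd : R * V -> V) snd); [exact: cvg_snd|exact: cvg_snd].
apply: cvgD; first exact: c1.
by apply: cvgZ; [exact: ct|apply: cvgB; [exact: cvg_cst|exact: c1]].
Qed.

Let seg_lin t (x : V) (k : C) (u : V) : seg t (x + k *: u) = seg t x + k *: lin t u.
Proof.
congr pair; apply/rowP => i; rewrite !mxE rmorphB rmorph1 /=.
by move: (x.1 0 i) (u.1 0 i) (z 0 i) (t%:C) => *; ring.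
Qed.

Let lin_lin t (k : C) (u v : V) : lin t (k *: u + v) = k *: lin t u + lin t v.
Proof.
congr pair; apply/rowP => i; rewrite !mxE.
by move: (u.1 0 i) (v.1 0 i) ((1 - t)%:C) => *; ring.
Qed.

Let cseg_t t : continuous (seg t).
Proof.
move=> x; apply: (@continuous_comp _ _ _ (fun x : V => (t, x)) (fun p : R * V => seg p.1 p.2)).
  by apply: (@cvg_pair _ _ _ (nbhs x) (nbhs t) (nbhs x)); [exact: cvg_cst|exact: cvg_id].
exact: cseg.
Qed.

Let hol_slice H t : hol H -> hol (slice H t).
Proof.
move=> hH; apply: (holM (hol_cst V ((1 - t) ^+ N)%:C)).
exact: (@hol_affine R V V (seg t) (lin t) (seg_lin t) (@cseg_t t) (lin_lin t) H hH).
Qed.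

Let cslice H : continuous H -> continuous (fun p : R * V => slice H p.1 p.2).
Proof.
move=> cH; apply: ccontinuousM.
  move=> p; apply: (@continuous_comp _ _ _ (fst : R * V -> R) (fun t => ((1 - t) ^+ N)%:C)).
    exact: cvg_fst.
  exact: continuous_onem_pow.
move=> p; apply: (@continuous_comp _ _ _ (fun p : R * V => seg p.1 p.2) H); last exact: cH.
exact: cseg.
Qed.

Let derive_slice H t (x u : V) : hol H ->
  'D_u (slice H t) x = ((1 - t) ^+ N)%:C * 'D_(lin t u) H (seg t x).
Proof.
move=> hH; have [dA DA] := @derive_affine_at R V V (seg t) (lin t) (seg_lin t) H x u
  (@hol_derivable R V H hH _ _).
have [dc Dc] := @derive_cst_at R V ((1 - t) ^+ N)%:C x u.
by have [_ ->] := deriveM_at dc dA; rewrite Dc DA mul0r add0r.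
Qed.

Let cDslice H (u : V) : hol H -> continuous (fun p : R * V => 'D_u (slice H p.1) p.2).
Proof.
move=> hH.
(* The direction [lin t u] moves with [t]. Linearity in the direction pulls out [1 - t] and leaves
   derivatives along two fixed directions, which are continuous. *)
have -> : (fun p : R * V => 'D_u (slice H p.1) p.2) = fun p =>
    (1 - p.1)%:C * slice ('D_((u.1, 0) : V) H) p.1 p.2 + slice ('D_((0, u.2) : V) H) p.1 p.2.
  apply/funext => -[t x]; rewrite (derive_slice _ _ _ hH) /slice /=.
  have -> : lin t u = (1 - t)%:C *: ((u.1, 0) : V) + (0, u.2).
    by congr pair; rewrite /= ?scaler0 ?addr0 ?add0r.
  rewrite (hol_deriveD _ _ _ hH) (hol_deriveZ _ _ _ hH) mulrDr; congr (_ + _).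
  by rewrite mulrCA.
have c1 := cslice (@hol_derive_continuous R V H (u.1, 0) hH).
have c2 := cslice (@hol_derive_continuous R V H (0, u.2) hH).
have c0 : continuous (fun p : R * V => (1 - p.1)%:C : C).
  move=> p; apply: (@continuous_comp _ _ _ (fun p : R * V => 1 - p.1) (@real_complex R)).
    by apply: cvgB; [exact: cvg_cst|exact: cvg_fst].
  exact: continuous_real_complex.
exact: (ccontinuousD (ccontinuousM c0 c1) c2).
Qed.

Lemma taylor_remE H : taylor_rem z N H =
  fun x => N.+1%:R * param_integral 0 1 (slice H) x.
Proof. by []. Qed.

Let hol_slice_integral H : hol H -> hol (param_integral 0 1 (slice H)).
Proof.
move=> hH; apply: (@hol_param_integral R V 0 1 (slice H) ler01R).
- exact: (@cslice H (@hol_continuous R V H hH)).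
- by move=> t; exact: hol_slice.
- by move=> u; exact: cDslice.
Qed.

Lemma hol_taylor_rem H : hol H -> hol (taylor_rem z N H).
Proof.
move=> hH; rewrite taylor_remE.
exact: (holM (hol_cst V N.+1%:R) (hol_slice_integral hH)).
Qed.

(** The segment moves only the first variable: [lin t] fixes [snd_dir j], and differentiation passes
    under the integral. *)
Lemma derive_snd_taylor_rem H j : hol H ->
  'D_(snd_dir R j) (taylor_rem z N H) = taylor_rem z N ('D_(snd_dir R j) H).
Proof.
move=> hH; apply/funext => x; rewrite !taylor_remE.
have hP := hol_slice_integral hH.
have [dc Dc] := @derive_cst_at R V N.+1%:R x (snd_dir R j).
have [_ ->] := deriveM_at dc (@hol_derivable R V _ hP x (snd_dir R j)).
rewrite Dc mul0r add0r; congr (_ * _).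
have -> : 'D_(snd_dir R j) (param_integral 0 1 (slice H)) x =
    param_integral 0 1 (fun t => 'D_(snd_dir R j) (slice H t)) x.
  apply: (@derive_param_integral R V 0 1 (slice H) ler01R).
  - exact: (@cslice H (@hol_continuous R V H hH)).
  - by move=> t; exact: hol_slice.
  - by move=> u; exact: cDslice.
apply: eq_itv_integral => t _; rewrite (derive_slice _ _ _ hH).
by congr (_ * 'D_ _ H _); congr pair; rewrite /= scaler0.
Qed.

Lemma dw_taylor_rem alpha H : hol H ->
  dw alpha (taylor_rem z N H) = taylor_rem z N (dw alpha H).
Proof.
move=> hH; rewrite /dw; elim: (enum 'I_d) => [|j l IH]; first by [].
rewrite /dir_derive /= -/(dir_derive l _ alpha _) -/(dir_derive l _ alpha H) IH.
have hK : hol (dir_derive l (@snd_dir R d) alpha H) by exact: hol_dir_derive.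
move: (dir_derive l _ alpha H) hK => K hK; elim: (alpha j) => [|n IHn]; first by [].
exact: (etrans (congr1 (fun K' => 'D_(snd_dir R j) K') IHn)
  (derive_snd_taylor_rem j (hol_iter_derive (snd_dir R j) n hK))).
Qed.

(** On the segment from [x.1] to [z] the squared norm is at most [|x.1|^2 + |z|^2]: the rate is
    unchanged and [z] enters the constant only. *)
Lemma gauss_growth_taylor_rem H : hol H -> gauss_growth H -> gauss_growth (taylor_rem z N H).
Proof.
move=> hH gH e e0; have [c cP] := gH _ e0.
have c0 := cabs_le_nonneg (cP 0).
have k0 : 0 <= 2^-1 + e by rewrite addr_ge0 ?invr_ge0// ltW.
exists (N.+1%:R * (2 * (c * expR ((2^-1 + e) * sqn z)))) => x.
rewrite taylor_remE cabsM -!mulrA.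
have -> : cabs (N.+1%:R : C) = N.+1%:R.
  by rewrite -[X in cabs X](rmorph_nat (real_complex R)) cabs_real ger0_norm.
rewrite ler_wpM2l ?ler0n//.
have cs := continuous_slice (x := x) (@cslice H (@hol_continuous R V H hH)).
have := @itv_integral_le R 0 1 _ (c * expR ((2^-1 + e) * (sqn z + (sqn x.1 + sqn x.2)))) ler01R cs.
rewrite subr0 mulr1 mulrDr expRD !mulrA; apply => t t01.
have /andP[t0 t1] := t01.
rewrite /slice cabsM cabs_real ger0_norm ?exprn_ge0 ?subr_ge0//.
have t1' : (1 - t) ^+ N <= 1 by rewrite exprn_ile1 ?subr_ge0// lerBlDr lerDl.
apply: (le_trans (ler_piMl (cabs_ge0 _) t1')).
apply: (le_trans (cP _)); rewrite -mulrA -expRD -mulrDr ler_wpM2l// ler_expR ler_wpM2l//=.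
by have := sqn_segment_le x.1 z t01; lra.
Qed.

End TaylorRemainder.

(** * The symbols of the expansion in terms of G *)

Section Symbols.
Variables (R : realType) (d : nat).
Local Notation C := R[i].
Local Notation Cd := 'rV[C]_d.
Variables (a : Cd -> Cd -> C) (G : Cd * Cd -> C).
Hypothesis hG : hol G.
Hypothesis aG : forall z w, a z w = G (z, conjv w).

Lemma diag_symbolE alpha w : diag_symbol a alpha w = dw alpha (dz alpha G) (antidiag w).
Proof. exact: symbol_derivE. Qed.

Lemma remainder_symbolE N alpha z w : mabs alpha = N.+1 ->
  remainder_symbol a alpha z w = taylor_rem z N (dw alpha (dz alpha G)) (antidiag w).
Proof.
move=> aN; rewrite /remainder_symbol aN /=; congr (_ * _).
by apply: eq_cintegral => t _; rewrite (symbol_derivE _ _ _ hG aG).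
Qed.

End Symbols.

(** * Removing the damping *)

Section Regularisation.
Variables (R : realType) (d : nat).
Local Notation C := R[i].
Local Notation Cd := 'rV[C]_d.
Local Notation V := (Cd * Cd)%type.
Variable z : Cd.
Implicit Types (G H K : V -> C) (h : Cd -> C) (w u v : Cd) (s : R).

Lemma weighted_antidiag1 K h w :
  weighted z 1 K h (antidiag w) = K (antidiag w) * h w * cexp (inner (z - w) w).
Proof. by rewrite /weighted kernel_antidiag subrr mul0r oppr0 expR0 mulr1. Qed.

Lemma weighted_antidiag s K h w : weighted z s K h (antidiag w) =
  weighted z 1 K h (antidiag w) * (expR (- ((s - 1) * sqn (z - w))))%:C.
Proof. by rewrite weighted_antidiag1 /weighted kernel_antidiag mulrA. Qed.

(** A sequence decreasing to 1, as dominated convergence is sequential; each term exceeds 1, so the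
    damped expansion holds along it. *)
Let rate (n : nat) : R := 1 + n.+1%:R^-1.

Let rate_gt1 n : 1 < rate n. Proof. by rewrite ltrDl invr_gt0. Qed.

Let measurable_weighted s K h : hol K -> subexp h ->
  cmeasurable setT (fun x => weighted z s K h (antidiag (of_realcoords x))).
Proof.
move=> hK hh; apply: (cmeasurable_continuous_coords (f := fun w => weighted z s K h (antidiag w))).
move=> w; apply: (@continuous_comp _ _ _ (@antidiag R d) (weighted z s K h)).
  exact: continuous_antidiag.
exact: (@hol_continuous R V _ (hol_weighted z s hK hh)).
Qed.

(** The damping factor lies between 0 and 1 and tends to 1 pointwise, so the undamped integrand,
    integrable by hypothesis, is a majorant. *)
Lemma weighted_integral_cvg K h : hol K -> subexp h ->
  antidiag_integrable (weighted z 1 K h) ->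
  antidiag_integral (weighted z (rate n) K h) @[n --> \oo] -->
  antidiag_integral (weighted z 1 K h).
Proof.
move=> hK hh Wi.
have mT : measurable [set: d.-tuple (measurableTypeR R * measurableTypeR R)] by exact: measurableT.
apply: (cintegral_dominated_cvg mT _ _ _ (cintegrable_integrable_cabs mT Wi)).
- by move=> n; exact: measurable_weighted.
- exact: measurable_weighted.
- move=> x _; set w := of_realcoords x; set c := weighted z 1 K h (antidiag w).
  have E n : weighted z (rate n) K h (antidiag w) =
      c * (expR (- (n.+1%:R^-1 * sqn (z - w))))%:C.
    have rE : rate n - 1 = n.+1%:R^-1 by rewrite /rate addrC addKr.
    by rewrite weighted_antidiag rE.
  rewrite (funext E) -[X in _ --> X](mulr1 c).
  have cc : continuous (fun y : C => c * y).
    exact: (ccontinuousM (@ccontinuous_cst R C c) (@ccontinuous_id R)).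
  apply: (continuous_cvg _ (cc 1)); rewrite -[X in _ --> X]/((1 : R)%:C).
  apply: (continuous_cvg _ (@continuous_real_complex R 1)).
  rewrite -[X in _ --> X]expR0; apply: (continuous_cvg _ (@continuous_expR R 0)).
  rewrite -[X in _ --> X]oppr0; apply: cvgN; rewrite -(mul0r (sqn (z - w))).
  by apply: cvgM; [exact: cvg_harmonic|exact: cvg_cst].
- move=> n x _; rewrite weighted_antidiag cabsM cabs_real ger0_norm ?expR_ge0//.
  apply: (le_trans _ (cabs_le_ReIm _)); apply: ler_piMr; first exact: cabs_ge0.
  by rewrite -[X in _ <= X]expR0 ler_expR oppr_le0 mulr_ge0 ?sqn_ge0// subr_ge0; exact: ltW (rate_gt1 n).
Qed.

(** Freezing the first argument leaves only the contribution 1/2 of conj w. *)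
Lemma diag_growth_snd G : gauss_growth G -> diag_growth 2^-1 (fun x => G (z, x.2)).
Proof.
(* The rate obtained is [(1/2 + f)(1 + f) <= 1/2 + 5/2 f], below [1/2 + 3 f]. *)
move=> gG e e0; pose f := Num.min 1 (e / 3).
have f0 : 0 < f by rewrite lt_min ltr01 divr_gt0.
have f1 : f <= 1 by rewrite ge_min lexx.
have fe : f <= e / 3 by rewrite ge_min lexx orbT.
have [c cP] := gG _ f0.
exists (c * expR ((2^-1 + f) * (sqn z + (1 + f^-1)))) => w p q p1 q1 /=.
have c0 := cabs_le_nonneg (cP (w, w)).
rewrite (le_trans (cP _))// -mulrA -expRD ler_wpM2l// ler_expR /=.
have h2 := sqnD_le (conjv w) q f0; rewrite sqn_conjv in h2.
have fi : 0 <= 1 + f^-1 by rewrite addr_ge0// invr_ge0 ltW.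
have h3 : (1 + f^-1) * sqn q <= 1 + f^-1 by rewrite ler_piMr.
have k0 : 0 <= 2^-1 + f by rewrite addr_ge0 ?invr_ge0// ltW.
have h4 : (2^-1 + f) * (sqn z + sqn (conjv w + q)) <=
    (2^-1 + f) * (sqn z + ((1 + f) * sqn w + (1 + f^-1))) by rewrite ler_wpM2l//; lra.
apply: (le_trans h4).
have -> : (2^-1 + f) * (sqn z + ((1 + f) * sqn w + (1 + f^-1))) =
   (2^-1 + f) * (sqn z + (1 + f^-1)) + (2^-1 + f) * (1 + f) * sqn w by ring.
rewrite lerD2l ler_wpM2r ?sqn_ge0//.
have ff : f * f <= f by rewrite ler_piMl// ltW.
have -> : (2^-1 + f) * (1 + f) = 2^-1 + (2^-1 * f + f + f * f) by field.
lra.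
Qed.

(** The rates add up to [1/2 + 0 - 1 < 0], so the Wick integral of the symbol itself converges
    without damping. *)
Lemma integrable_weighted_snd G h : hol G -> gauss_growth G -> subexp h ->
  antidiag_integrable (weighted z 1 (fun x => G (z, x.2)) h).
Proof.
move=> hG gG hh.
have hW := hol_weighted z 1 (hol_snd z hG) hh.
have gW := diag_growthM (diag_growthM (diag_growth_snd gG) hh.2) (diag_growth_kernel z (lexx 1)).
apply: (antidiag_integrableP _ (@hol_continuous R V _ hW) gW).
by lra.
Qed.

(** Integration by parts yields [(- s)^|alpha|]; it is used from right to left, hence the
    inverse. *)
Let signed_fact s (alpha : 'I_d -> nat) : C :=
  ((- s%:C) ^+ mabs alpha)^-1 / (mfact alpha)%:R.

(** The Taylor expansion is integrated term by term, which is legitimate since every term converges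
    for [s > 1], and each power of [z - u] is traded for [dw]. In the remainder terms [dw] then
    passes inside [taylor_rem]. *)
Lemma weighted_taylor N s G h : 1 < s -> hol G -> gauss_growth G -> subexp h ->
  antidiag_integral (weighted z s (fun x => G (z, x.2)) h) =
  \sum_(alpha : {ffun 'I_d -> 'I_N.+2} | (mabs (mindex alpha) <= N)%N)
     signed_fact s (mindex alpha) *
     antidiag_integral (weighted z s (dw (mindex alpha) (dz (mindex alpha) G)) h)
  + \sum_(alpha : {ffun 'I_d -> 'I_N.+2} | mabs (mindex alpha) == N.+1)
     signed_fact s (mindex alpha) *
     antidiag_integral (weighted z s (taylor_rem z N (dw (mindex alpha) (dz (mindex alpha) G))) h).
Proof.
move=> s1 hG gG hh.
pose W alpha K : V -> C := weighted z s K (fun u => mpow (z - u) alpha * h u).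
have Wi alpha K : hol K -> gauss_growth K -> antidiag_integrable (W alpha K).
  move=> hK gK; apply: integrable_weighted => //.
  by have [] := integral_by_parts_dw z s1 alpha hK gK hh.
have WE alpha K : hol K -> gauss_growth K ->
    antidiag_integral (fun x => (mfact alpha)%:R^-1 * W alpha K x) =
    signed_fact s alpha * antidiag_integral (weighted z s (dw alpha K) h).
  move=> hK gK; have [_ ->] := integral_by_parts_dw z s1 alpha hK gK hh.
  rewrite (antidiag_integralZ _ (Wi alpha K hK gK)) /signed_fact.
  have n0 : (- s%:C) ^+ mabs alpha != 0 :> C.
    rewrite expf_eq0 negb_and oppr_eq0 orbC; apply/orP; left.
    by apply/eqP => /(congr1 (@complex.Re R)) /= s0; move: s1; rewrite s0 ltr10.
  by rewrite [RHS]mulrA [X in _ = X * _]mulrAC mulVf// mul1r.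
have hz alpha : hol (dz alpha G) by exact: hol_dz.
have gz alpha : gauss_growth (dz alpha G) by exact: (gauss_growth_dir_derive _ _ _ hG gG).
have hr alpha : hol (taylor_rem z N (dz alpha G)) by exact: (hol_taylor_rem z N (hz alpha)).
have gr alpha : gauss_growth (taylor_rem z N (dz alpha G)).
  exact: (gauss_growth_taylor_rem z N (hz alpha) (gz alpha)).
transitivity (antidiag_integral (fun x =>
    \sum_(alpha : {ffun 'I_d -> 'I_N.+2} | (mabs (mindex alpha) <= N)%N)
       (mfact (mindex alpha))%:R^-1 * W (mindex alpha) (dz (mindex alpha) G) x +
    \sum_(alpha : {ffun 'I_d -> 'I_N.+2} | mabs (mindex alpha) == N.+1)
       (mfact (mindex alpha))%:R^-1 * W (mindex alpha) (taylor_rem z N (dz (mindex alpha) G)) x)).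
  congr antidiag_integral; apply/funext => -[u v].
  rewrite /weighted /= (fst_taylor N z u v hG) mulrDl mulrDl !mulr_suml.
  have ident (m f D y k : C) : m * f * D * y * k = f * (D * (m * y) * k) by ring.
  by congr (_ + _); apply: eq_bigr => alpha _; exact: ident.
have sumW (P : pred {ffun 'I_d -> 'I_N.+2}) (K : ('I_d -> nat) -> V -> C) :
    (forall alpha, hol (K alpha)) -> (forall alpha, gauss_growth (K alpha)) ->
    antidiag_integrable (fun x => \sum_(alpha | P alpha)
      (mfact (mindex alpha))%:R^-1 * W (mindex alpha) (K (mindex alpha)) x) /\
    antidiag_integral (fun x => \sum_(alpha | P alpha)
      (mfact (mindex alpha))%:R^-1 * W (mindex alpha) (K (mindex alpha)) x) =
    \sum_(alpha | P alpha) signed_fact s (mindex alpha) *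
      antidiag_integral (weighted z s (dw (mindex alpha) (K (mindex alpha))) h).
  move=> hK gK; pose T (alpha : {ffun 'I_d -> 'I_N.+2}) x : C :=
    (mfact (mindex alpha))%:R^-1 * W (mindex alpha) (K (mindex alpha)) x.
  have Ti alpha : P alpha -> antidiag_integrable (T alpha).
    by move=> _; exact: (antidiag_integrableZ _ (Wi _ _ (hK _) (gK _))).
  split; first exact: (antidiag_integrable_sum (index_enum _) Ti).
  apply: (etrans (antidiag_integral_sum (index_enum _) Ti)).
  by apply: eq_bigr => alpha _; exact: (WE _ _ (hK _) (gK _)).
have [Ia Ea] := sumW (fun alpha => mabs (mindex alpha) <= N)%N (fun alpha => dz alpha G) hz gz.
have [Ib Eb] := sumW (fun alpha => mabs (mindex alpha) == N.+1)
  (fun alpha => taylor_rem z N (dz alpha G)) hr gr.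
apply: (etrans (antidiag_integralD Ia Ib)); rewrite [X in X + _]Ea [X in _ + X]Eb.
by congr (_ + _); apply: eq_bigr => alpha _; rewrite (dw_taylor_rem _ _ _ (hz _)).
Qed.

Lemma cvg_csum (I : Type) (r : seq I) (P : pred I) (f : I -> nat -> C) (l : I -> C) :
  (forall i, P i -> f i n @[n --> \oo] --> l i) ->
  \sum_(i <- r | P i) f i n @[n --> \oo] --> \sum_(i <- r | P i) l i.
Proof.
move=> fl; elim: r => [|i r IH].
  by rewrite big_nil; under eq_fun do rewrite big_nil; exact: cvg_cst.
rewrite big_cons; under eq_fun do rewrite big_cons.
by case: (boolP (P i)) => [Pi|_]; [exact: cvgD (fl _ Pi) IH|exact: IH].
Qed.

Let signed_fact_cvg alpha : signed_fact (rate n) alpha @[n --> \oo] -->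
  ((-1) ^+ mabs alpha / (mfact alpha)%:R : C).
Proof.
have E n : signed_fact (rate n) alpha =
    (((- (1 + n.+1%:R^-1)) ^+ mabs alpha)^-1)%:C / (mfact alpha)%:R.
  by rewrite /signed_fact /rate fmorphV rmorphXn rmorphN.
rewrite (funext E).
have cc : continuous (fun y : C => y / (mfact alpha)%:R).
  exact: (ccontinuousM (@ccontinuous_id R) (@ccontinuous_cst R C _)).
apply: (continuous_cvg _ (cc ((-1) ^+ mabs alpha))).
have -> : (-1) ^+ mabs alpha = ((((- 1) ^+ mabs alpha)^-1 : R))%:C.
  by rewrite -exprVn invrN1 rmorphXn rmorphN1.
apply: (continuous_cvg _ (@continuous_real_complex R _)).
apply: cvgV; first by rewrite expf_neq0// oppr_eq0 oner_eq0.
apply: (continuous_cvg _ (@exprn_continuous R (mabs alpha) (- 1))).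
apply: cvgN; rewrite -[X in _ --> X](addr0 1); apply: cvgD; first exact: cvg_cst.
exact: cvg_harmonic.
Qed.

(** At [s = 1] the rates on the right add up to [1 + 0 - 1 = 0], which decides nothing; the two
    integrability hypotheses replace the missing margin and let every damped integral converge to
    its undamped value. Uniqueness of limits concludes. *)
Lemma integral_taylor N G h : hol G -> gauss_growth G -> subexp h ->
  (forall alpha, (mabs alpha <= N)%N ->
     antidiag_integrable (weighted z 1 (dw alpha (dz alpha G)) h)) ->
  (forall alpha, mabs alpha = N.+1 ->
     antidiag_integrable (weighted z 1 (taylor_rem z N (dw alpha (dz alpha G))) h)) ->
  antidiag_integral (weighted z 1 (fun x => G (z, x.2)) h) =
  \sum_(alpha : {ffun 'I_d -> 'I_N.+2} | (mabs (mindex alpha) <= N)%N)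
     ((-1) ^+ mabs (mindex alpha) / (mfact (mindex alpha))%:R) *
     antidiag_integral (weighted z 1 (dw (mindex alpha) (dz (mindex alpha) G)) h)
  + \sum_(alpha : {ffun 'I_d -> 'I_N.+2} | mabs (mindex alpha) == N.+1)
     ((-1) ^+ mabs (mindex alpha) / (mfact (mindex alpha))%:R) *
     antidiag_integral (weighted z 1 (taylor_rem z N (dw (mindex alpha) (dz (mindex alpha) G))) h).
Proof.
move=> hG gG hh i1 i2.
have hd alpha : hol (dw alpha (dz alpha G)) by exact: (hol_dir_derive _ _ _ (hol_dz alpha hG)).
have hr alpha : hol (taylor_rem z N (dw alpha (dz alpha G))).
  exact: (hol_taylor_rem z N (hd alpha)).
have prod_cvg (f g : nat -> C) (a b : C) : f n @[n --> \oo] --> a -> g n @[n --> \oo] --> b ->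
    f n * g n @[n --> \oo] --> a * b by exact: cvgM.
have c0 := weighted_integral_cvg (hol_snd z hG) hh (integrable_weighted_snd hG gG hh).
apply: (cvg_unique _ c0); first exact: norm_hausdorff.
rewrite /= (funext (fun n => weighted_taylor N (rate_gt1 n) hG gG hh)).
apply: cvgD; apply: cvg_csum => alpha Pa.
  exact: (prod_cvg _ _ _ _ (@signed_fact_cvg (mindex alpha))
    (@weighted_integral_cvg _ h (hd (mindex alpha)) hh (i1 _ Pa))).
exact: (prod_cvg _ _ _ _ (@signed_fact_cvg (mindex alpha))
  (@weighted_integral_cvg _ h (hr (mindex alpha)) hh (i2 _ (eqP Pa)))).
Qed.

End Regularisation.

(** Convergence of the Wick integral of [a] is proved; for the operators on the right it is assumed
    at the given [F] and [z], where the growth bounds only give Gaussian rate 0. *)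
Theorem proposition4p1 (R : realType) (d N : nat) (s : R)
    (a : 'rV[R[i]]_d -> 'rV[R[i]]_d -> R[i]) :
  2^-1 <= s -> A_hat' s a ->
  forall F : 'rV[R[i]]_d -> R[i], A_flat1 F -> forall z : 'rV[R[i]]_d,
    wick_defined a F z /\
    ((forall alpha : 'I_d -> nat, (mabs alpha <= N)%N ->
        aw_defined (diag_symbol a alpha) F z) ->
     (forall alpha : 'I_d -> nat, mabs alpha = N.+1 ->
        wick_defined (remainder_symbol a alpha) F z) ->
     Op_wick a F z =
       \sum_(alpha : {ffun 'I_d -> 'I_N.+1} | (mabs (mindex alpha) <= N)%N)
         (-1) ^+ mabs (mindex alpha) * Op_aw (diag_symbol a (mindex alpha)) F z
           / (mfact (mindex alpha))%:R
       + \sum_(alpha : {ffun 'I_d -> 'I_N.+2} | mabs (mindex alpha) == N.+1)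
         (-1) ^+ mabs (mindex alpha)
           * Op_wick (remainder_symbol a (mindex alpha)) F z
           / (mfact (mindex alpha))%:R).
Proof.
move=> s2 [ha ba] F [eF [r [c [r0 Fb]]]] z.
pose G (x : 'rV[R[i]]_d * 'rV[R[i]]_d) := a x.1 (conjv x.2).
have hG : hol G by exact: entire_hol.
have gG : gauss_growth G by exact: (A_hat'_gauss_growth s2 (conj ha ba)).
have aG z' w : a z' w = G (z', conjv w) by rewrite /G conjvK.
have hF : subexp F by split; [exact: entire_hol|exact: diag_growth_fst Fb].
have wickE : wick_integrand a F z = fun w => weighted z 1 (fun x => G (z, x.2)) F (antidiag w).
  by apply/funext => w; rewrite weighted_antidiag1 /wick_integrand aG.
have awE alpha : aw_integrand (diag_symbol a alpha) F z =
    fun w => weighted z 1 (dw alpha (dz alpha G)) F (antidiag w).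
  by apply/funext => w; rewrite weighted_antidiag1 /aw_integrand (diag_symbolE hG aG).
have remE alpha : mabs alpha = N.+1 -> wick_integrand (remainder_symbol a alpha) F z =
    fun w => weighted z 1 (taylor_rem z N (dw alpha (dz alpha G))) F (antidiag w).
  by move=> aN; apply/funext => w; rewrite weighted_antidiag1 /wick_integrand (remainder_symbolE hG aG z w aN).
split; first by rewrite /wick_defined wickE; exact: integrable_weighted_snd.
move=> i1 i2.
have j1 alpha : (mabs alpha <= N)%N ->
    antidiag_integrable (weighted z 1 (dw alpha (dz alpha G)) F).
  by move=> aN; have := i1 alpha aN; rewrite /aw_defined awE.
have j2 alpha : mabs alpha = N.+1 ->
    antidiag_integrable (weighted z 1 (taylor_rem z N (dw alpha (dz alpha G))) F).
  by move=> aN; have := i2 alpha aN; rewrite /wick_defined (remE _ aN).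
have := integral_taylor hG gG hF j1 j2.
rewrite (sum_mindex_widen N (fun alpha => (-1) ^+ mabs alpha * Op_aw (diag_symbol a alpha) F z
           / (mfact alpha)%:R)).
pose p : R[i] := (pi ^- d)%:C.
have -> : Op_wick a F z = p * antidiag_integral (weighted z 1 (fun x => G (z, x.2)) F).
  by rewrite /Op_wick wickE.
move=> ->; rewrite mulrDr !mulr_sumr; congr (_ + _); apply: eq_bigr => alpha aN.
  have -> : Op_aw (diag_symbol a (mindex alpha)) F z =
      p * antidiag_integral (weighted z 1 (dw (mindex alpha) (dz (mindex alpha) G)) F).
    by rewrite /Op_aw awE.
  by rewrite mulrCA mulrAC -!mulrA.
have -> : Op_wick (remainder_symbol a (mindex alpha)) F z = p * antidiag_integral
    (weighted z 1 (taylor_rem z N (dw (mindex alpha) (dz (mindex alpha) G))) F).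
  by rewrite /Op_wick (remE _ (eqP aN)).
by rewrite mulrCA mulrAC -!mulrA.
Qed.
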